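(* For $\alpha\in(0,2)$, let $S_1,S_2$ be i.i.d. with distribution $S_\alpha$, let $X=(1,1)S_1-(0,1)S_2$, let $\Lambda$ be the spectral measure of $X$ (which has mass $2^{\alpha/2}/2$ at each of $\pm(1,1)/\sqrt2$ and mass $1/2$ at each of $\pm(0,1)$), and let $$E=\{\mathbf{x}\in\mathbb{R}^2: x_1>1,\ x_2<1\}.$$ For $\varepsilon>0$ let $B_\varepsilon$ be the open ball of radius $\varepsilon$ around $(1,1)$ in the $L_\infty$ metric on $\mathbb{R}^2$, and define $g^+(\alpha,\varepsilon)=L(E^o\cup B_\varepsilon,1,\alpha)$ for $\varepsilon\in(0,1)$ and $g^-(\alpha,\varepsilon)=L((E\setminus B_\varepsilon)^o,2,\alpha)$ for $\varepsilon>0$. Then the following hold. (i) If $\alpha<1$, then $$\lim_{h\to\infty}h^{2\alpha}P(X\in hE)=\frac{C_\alpha^2\,\alpha\,\Gamma(2\alpha)\Gamma(1-\alpha)}{4\Gamma(1+\alpha)}<\infty.$$ If $\alpha=1$, then $$\lim_{h\to\infty}\frac{h^2}{\log h}P(X\in hE)=\frac{C_1^2}{4}.$$ If $\alpha>1$, then $$\lim_{h\to\infty}h^{1+\alpha}P(X\in hE)=\frac{C_\alpha\,\alpha\,\mathbb{E}[|S_1|]}{4}.$$ (ii) For all $\alpha\in(0,2)$, $\lim_{\delta\to0}L(E_{\delta,+},2,\alpha)=\infty$. Moreover, $L(E^o,2,\alpha)=L(\bar E,2,\alpha)$, and this common value is $\infty$ if $\alpha\in[1,2)$ and is $\frac{C_\alpha^2\alpha\Gamma(2\alpha)\Gamma(1-\alpha)}{4\Gamma(1+\alpha)}$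 if $\alpha\in(0,1)$. (iii) Let $\alpha\in(0,1)$. For every $\varepsilon\in(0,1)$, $$g^+(\alpha,\varepsilon)=\lim_{\delta\to0}L((E\cup B_\varepsilon)_{\delta,+},1,\alpha)\in(0,\infty)\quad\text{and}\quad \lim_{h\to\infty}h^{\alpha}P(X\in h(E\cup B_\varepsilon))=g^+(\alpha,\varepsilon).$$ For every $\varepsilon>0$, $$g^-(\alpha,\varepsilon)=\lim_{\delta\to0}L((E\setminus B_\varepsilon)_{\delta,+},2,\alpha)\in(0,\infty)\quad\text{and}\quad \lim_{h\to\infty}h^{2\alpha}P(X\in h(E\setminus B_\varepsilon))=g^-(\alpha,\varepsilon).$$ (iv) For all $\alpha\in(0,2)$, $g^+(\alpha,\varepsilon)$ is increasing in $\varepsilon$ with $\lim_{\varepsilon\to0}g^+(\alpha,\varepsilon)=0$, while $g^-(\alpha,\varepsilon)$ is decreasing in $\varepsilon$, with $\lim_{\varepsilon\to0}g^-(\alpha,\varepsilon)$ equal to $\infty$ for $\alpha\in[1,2)$ and equal to $\frac{C_\alpha^2\alpha\Gamma(2\alpha)\Gamma(1-\alpha)}{4\Gamma(1+\alpha)}$ for $\alpha\in(0,1)$.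
   Context: $S_\alpha$ denotes the distribution on $\mathbb{R}$ with characteristic function $e^{-|\theta|^\alpha}$. The constant $C_\alpha\in(0,\infty)$ is defined by $P(Y\ge h)\sim C_\alpha h^{-\alpha}/2$ as $h\to\infty$ for $Y\sim S_\alpha$. $\Gamma$ is the Gamma function. The spectral measure of a symmetric $\alpha$-stable vector $X$ in $\mathbb{R}^n$ is the unique finite measure $\Lambda$ on the unit sphere $\mathbb{S}^{n-1}$, invariant under $\mathbf{x}\mapsto-\mathbf{x}$, such that $X$ has characteristic function $\theta\mapsto\exp\bigl(-\int_{\mathbb{S}^{n-1}}|\theta\cdot\mathbf{x}|^\alpha\,d\Lambda(\mathbf{x})\bigr)$. $\bar F$ and $F^o$ denote the closure and interior of a set $F$; $hF=\{h\mathbf{x}:\mathbf{x}\in F\}$; and, with $d$ the Euclidean distance, $F_{\delta,+}=\{\mathbf{x}: d(\mathbf{x},F)<\delta\}$ for $\delta>0$. With $\Lambda^k=\Lambda\times\cdots\times\Lambda$ ($k$ times), for Borel $F\subseteq\mathbb{R}^2$ and an integer $k\ge1$, $$L(F,k,\alpha)=\frac{C_\alpha^k}{k!}\int_0^\infty\cdots\int_0^\infty \Lambda^k\Bigl(\Bigl\{(\mathbf{x}_1,\ldots,\mathbf{x}_k)\in(\mathbb{S}^{1})^k:\ \sum_{i=1}^k s_i\mathbf{x}_i\in F\Bigr\}\Bigr)\prod_{i=1}^k\alpha s_i^{-(1+\alpha)}\,ds_i\in[0,\infty].$$ Limits $\delta\to0$ and $\varepsilon\to0$ are through positive values. *)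

(* Defs.v *)
From HB Require Import structures.
From mathcomp Require Import all_boot all_order all_algebra.
From mathcomp Require Import all_classical all_reals all_analysis.
From mathcomp.real_closed Require Import complex.
Set Implicit Arguments.
Unset Strict Implicit.
Unset Printing Implicit Defensive.
Import Order.TTheory GRing.Theory Num.Theory.
Import numFieldNormedType.Exports.
Local Open Scope classical_set_scope.
Local Open Scope ring_scope.

(** Points of the plane are pairs: the product topology and the product
    sigma-algebra on [R * R] are the Euclidean topology and its Borel
    sigma-algebra, and the library's [ball] on [R * R] is the open ball of the
    L_infinity metric. *)

Definition dot (R : realType) (x y : R * R) : R := x.1 * y.1 + x.2 * y.2.

Definition circle (R : realType) : set (R * R) :=
  [set x | x.1 ^+ 2 + x.2 ^+ 2 = 1].
Arguments circle R : clear implicits.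

Definition eucl_dist (R : realType) (x y : R * R) : R :=
  Num.sqrt ((x.1 - y.1) ^+ 2 + (x.2 - y.2) ^+ 2).

(** Extended-real valued, so that the distance to the empty set is [+oo]. *)
Definition dist_to (R : realType) (F : set (R * R)) (x : R * R) : \bar R :=
  ereal_inf [set (eucl_dist x y)%:E | y in F].

Definition enlarge (R : realType) (F : set (R * R)) (delta : R) : set (R * R) :=
  [set x | (dist_to F x < delta%:E)%E].

Definition dilate (R : realType) (h : R) (F : set (R * R)) : set (R * R) :=
  [set h *: x | x in F].

Definition Gamma (R : realType) (a : R) : R :=
  \int[@lebesgue_measure R]_(t in `]0, +oo[) (t `^ (a - 1) * expR (- t)).

(** E[e^{iZ}] for a real random variable [Z], integrated componentwise. *)
Definition expect_cis (R : realType) (d : measure_display)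
    (T : measurableType d) (P : probability T R) (Z : T -> R) : R[i] :=
  (\int[P]_w cos (Z w) +i* \int[P]_w sin (Z w))%C.

Definition has_law_stable (R : realType) (d : measure_display)
    (T : measurableType d) (P : probability T R) (alpha : R) (Y : T -> R) :
    Prop :=
  forall theta : R,
    expect_cis P (fun w => theta * Y w) = (expR (- (`|theta| `^ alpha)))%:C%C.

Definition independent (R : realType) (d : measure_display)
    (T : measurableType d) (P : probability T R) (Y Z : T -> R) : Prop :=
  forall A B : set R, measurable A -> measurable B ->
    P ((Y @^-1` A) `&` (Z @^-1` B)) = (P (Y @^-1` A) * P (Z @^-1` B))%E.

Definition tail_constant (R : realType) (d : measure_display)
    (T : measurableType d) (P : probability T R) (alpha : R) (Y : T -> R)
    (C : R) : Prop :=
  0 < C /\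
  (fun h : R => fine (P [set w | h <= Y w]) / (C * h `^ (- alpha) / 2))
    @ +oo --> (1 : R).

(** Measures on the unit circle are represented as measures on the plane for
    which the complement of the circle is null. *)
Definition spectral_measure (R : realType) (d : measure_display)
    (T : measurableType d) (P : probability T R) (alpha : R) (X : T -> R * R)
    (Lambda : {finite_measure set (R * R)%type -> \bar R}) : Prop :=
  [/\ Lambda (~` circle R) = 0%E,
      (forall A : set (R * R), measurable A ->
         Lambda ((fun x => - x) @^-1` A) = Lambda A) &
      forall theta : R * R,
        expect_cis P (fun w => dot theta (X w)) =
        (expR (- \int[Lambda]_(x in circle R) (`|dot theta x| `^ alpha)))%:C%C].

(** The k-fold product Lambda x ... x Lambda: one step of the recursion is the
    library's product measure [Lambda \x Lambda^k], read through the
    identification of [k.+1]-tuples with pairs of a head and a [k]-tuple. *)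
Fixpoint power_measure (R : realType) (d : measure_display)
    (T : measurableType d) (Lambda : set T -> \bar R) (k : nat) :
    set (k.-tuple T) -> \bar R :=
  match k with
  | 0 => fun A => (\1_A [tuple])%:E
  | k'.+1 => fun A =>
      (\int[Lambda]_x power_measure Lambda [set t | A (cons_tuple x t)])%E
  end.

(** The k-fold iterated integral over [0 < s_i < +oo], the first coordinate
    being the outermost one. *)
Fixpoint iterated_integral (R : realType) (k : nat) :
    (k.-tuple R -> \bar R) -> \bar R :=
  match k with
  | 0 => fun f => f [tuple]
  | k'.+1 => fun f =>
      (\int[@lebesgue_measure R]_(s in `]0%R, +oo[)
         iterated_integral (fun t => f (cons_tuple s t)))%E
  end.

Definition directions_into (R : realType) (F : set (R * R)) (k : nat)
    (s : k.-tuple R) : set (k.-tuple (R * R)) :=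
  [set x | (forall i, circle R (tnth x i)) /\
           F (\sum_(i < k) tnth s i *: tnth x i)].

Definition L (R : realType) (C : R) (Lambda : set (R * R) -> \bar R)
    (F : set (R * R)) (k : nat) (alpha : R) : \bar R :=
  ((C ^+ k / (k`!)%:R)%:E *
   iterated_integral (fun s : k.-tuple R =>
     power_measure Lambda (directions_into F s)
     * (\prod_(i < k) (alpha * tnth s i `^ (- (1 + alpha))))%:E))%E.

Definition E (R : realType) : set (R * R) := [set x | 1 < x.1 /\ x.2 < 1].
Arguments E R : clear implicits.

Definition B (R : realType) (eps : R) : set (R * R) := ball ((1, 1) : R * R) eps.

Definition gplus (R : realType) (C : R) (Lambda : set (R * R) -> \bar R)
    (alpha eps : R) : \bar R :=
  L C Lambda ((E R)° `|` B eps) 1 alpha.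

Definition gminus (R : realType) (C : R) (Lambda : set (R * R) -> \bar R)
    (alpha eps : R) : \bar R :=
  L C Lambda ((E R `\` B eps)°) 2 alpha.

Definition limit_constant (R : realType) (C alpha : R) : R :=
  C ^+ 2 * alpha * Gamma (2 * alpha) * Gamma (1 - alpha)
  / (4 * Gamma (1 + alpha)).

(* Main.v *)
(** Since X = (S1, S1 - S2), the event X \in hE is {S1 > h, S1 - S2 < h}.  The
    symmetric stable law is a scale mixture of Gaussians, so it has an even
    density f that decreases on the half line, and this monotonicity turns the
    tail asymptotics into f(x) ~ (alpha C / 2) x^(-1-alpha), with a domination
    f(x) <= M |x|^(-1-alpha).  By dominated convergence h^(2 alpha)
    P((S1, S2) \in hD) tends to (C^2 / 4) times the mass of D under the product
    of two copies of alpha s^(-1-alpha) ds, whenever D lies in the positive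
    quadrant and has finite mass.  The wedge {s > 1, s - t < 1} has mass
    alpha Beta(2 alpha, 1 - alpha), which is infinite for alpha >= 1; then one
    uses P(X \in hE) = \int_0^oo f(h + z) P(S2 >= z) dz, where the contribution
    comes from z of order 1 if alpha > 1, and equally from all logarithmic
    scales between 1 and h if alpha = 1.

    On the side of L, |u + v|^alpha + |u - v|^alpha <= 2 (|u|^alpha + |v|^alpha)
    with equality only if u v = 0.  The defect in this inequality with
    u = x1 - x2, v = x1 has integral zero against Lambda, which therefore
    charges only the four stated points.  The functional L(F, 2) then becomes
    the same product mass of F read in the coordinates (S1, S2), and L(F, 1) an
    integral along the diagonal and the vertical axis. *)
Require Import Defs.
From HB Require Import structures.
From mathcomp Require Import all_boot all_order all_algebra.
From mathcomp Require Import all_classical all_reals all_analysis.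
From mathcomp Require Import measurable_realfun.
From mathcomp.real_closed Require Import complex.
From mathcomp Require Import ring lra.
Import Order.TTheory GRing.Theory Num.Theory.
Import numFieldNormedType.Exports.
Local Open Scope classical_set_scope.
Local Open Scope ring_scope.
Set Implicit Arguments.
Unset Strict Implicit.
Unset Printing Implicit Defensive.

(** The hypotheses give only characteristic functions. Convolution with a Gaussian makes Fourier
    inversion absolutely convergent; letting the variance tend to 0 yields the density, its sign
    and, by uniqueness of measures on intervals, the law on Borel sets. Monotonicity is proved on
    the Fourier side: functions whose smoothed cosine transform decreases form a class stable under
    multiplication by Gaussian mixtures, and the stable characteristic function is a limit of
    exponentials of such mixtures, once their infinite mixing measure is cut off near 0.

    The obstacle on the planar side is the corner (1, 1). It lies on the diagonal, which S1 reaches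
    alone; near it S2 may be arbitrarily small, where s^(-1-alpha) is not integrable. Without a
    square around the corner both coordinates stay away from 0 and the product mass is finite; with
    the square, one large S1 suffices.

    The factor C^2/4 arises twice: as the square of the one-sided tail constant C/2, and as C^2/2!
    times 1/2 for each atom of a pair, times the two orders of the pair. *)

(** * Changes of variable and integrals of powers *)

(** The image of Lebesgue measure under multiplication by [c], multiplied by [c], has the right
    value on half-open intervals, hence is Lebesgue measure by uniqueness. *)
Lemma ge0_integral_scale (R : realType) (c : R) (g : R -> \bar R) : 0 < c ->
  measurable_fun setT g -> (forall x, 0 <= g x)%E ->
  (\int[@lebesgue_measure R]_x g (c * x)%R =
   (c^-1)%:E * \int[@lebesgue_measure R]_x g x)%E.
Proof.
move=> c0 mg g0.
have mc : measurable_fun setT ( *%R c).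
  by apply: measurable_funM.
have k0 : 0 <= c^-1 by rewrite invr_ge0 ltW.
pose k : {nonneg R} := NngNum k0.
have eqm A : measurable A -> (pushforward (@lebesgue_measure R) (( *%R c) : _ -> measurableTypeR R)) A = mscale k (@lebesgue_measure R) A.
  move=> mA.
  have c'0 : 0 <= c by exact: ltW.
  pose c' : {nonneg R} := NngNum c'0.
  have := @lebesgue_measure_unique R (mscale c' (pushforward (@lebesgue_measure R) (( *%R c) : _ -> measurableTypeR R))).
  move=> /(_ mc) H.
  rewrite /mscale/= H; last 2 first.
    move=> X [[a b] _ <-] /=.
    rewrite /mscale /= /pushforward.
    have E : ( *%R c) @^-1` `]a, b]%classic = `]a / c, b / c]%classic.
      apply/seteqP; split => x /=; rewrite !in_itv /= ltr_pdivrMr // ler_pdivlMr // ![c * x]mulrC //.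
    rewrite E !lebesgue_measure_itv/= !lte_fin ltr_pM2r ?invr_gt0 //.
    case: ifPn => ab; last by rewrite mule0.
    by rewrite -!EFinB -EFinM; congr (_%:E); field; rewrite gt_eqF.
    exact: mA.
  by rewrite /mscale /= muleA -EFinM mulVf ?mul1e ?gt_eqF.
transitivity (\int[pushforward (@lebesgue_measure R) (( *%R c)%R : _ -> measurableTypeR R)]_x g x)%E.
  by rewrite ge0_integral_pushforward.
rewrite (eq_measure_integral (mscale k (@lebesgue_measure R))).
  by rewrite ge0_integral_mscale.
by move=> A mA _; exact: eqm.
Qed.

Lemma ge0_integral_shift (R : realType) (c : R) (g : R -> \bar R) :
  measurable_fun setT g -> (forall x, 0 <= g x)%E ->
  (\int[@lebesgue_measure R]_x g (c + x)%R = \int[@lebesgue_measure R]_x g x)%E.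
Proof.
move=> mg g0.
have mc : measurable_fun setT (+%R c).
  by apply: measurable_funD.
transitivity (\int[pushforward (@lebesgue_measure R) ((+%R c)%R : _ -> measurableTypeR R)]_x g x)%E.
  by rewrite ge0_integral_pushforward.
apply: eq_measure_integral => A mA _.
rewrite [RHS](@lebesgue_measure_unique R (pushforward (@lebesgue_measure R) ((+%R c) : _ -> measurableTypeR R))) //.
move=> X [[a b] _ <-] /=.
rewrite /= /pushforward.
have E : (+%R c) @^-1` `]a, b]%classic = `]a - c, b - c]%classic.
  by apply/seteqP; split => x /=; rewrite !in_itv /= ltrBlDl lerBrDl.
rewrite E !lebesgue_measure_itv/= !lte_fin ltrD2r.
by case: ifPn => // ab; rewrite -!EFinB; congr (_%:E); ring.
Qed.

Lemma ge0_integral_opp (R : realType) (g : R -> \bar R) :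
  measurable_fun setT g -> (forall x, 0 <= g x)%E ->
  (\int[@lebesgue_measure R]_x g (- x)%R = \int[@lebesgue_measure R]_x g x)%E.
Proof.
move=> mg g0.
transitivity (\int[pushforward (@lebesgue_measure R) ((-%R)%R : _ -> measurableTypeR R)]_x g x)%E.
  by rewrite ge0_integral_pushforward.
by apply: eq_measure_integral => A mA _; exact: lebesgue_measureN.
Qed.

Lemma powR_continuous (R : realType) (p x : R) : 0 < x ->
  {for x, continuous (@powR R ^~ p)}.
Proof.
move=> x0; apply/differentiable_continuous/derivable1_diffP.
by apply: derivable_powR; rewrite in_itv/= x0.
Qed.

Lemma powRN_cvg_pinfty (R : realType) (p : R) : 0 < p ->
  x `^ (- p) @[x --> +oo] --> (0 : R).
Proof.
move=> p0; apply/cvgrPdist_le => e e0; near=> x.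
have x0 : 0 < e `^ (- p^-1) by exact: powR_gt0.
have ex : e `^ (- p^-1) <= x by near: x; apply: nbhs_pinfty_ge; exact: num_real.
rewrite sub0r normrN ger0_norm ?powR_ge0//.
have -> : e = (e `^ (- p^-1)) `^ (- p).
  by rewrite -powRrM mulrNN mulVf ?gt_eqF// powRr1// ltW.
have xx : 0 < x by exact: lt_le_trans ex.
rewrite [x `^ _]powRN [X in _ <= X]powRN lef_pV2 ?posrE ?powR_gt0//.
by apply: ge0_ler_powR; rewrite ?nnegrE ?(ltW p0) ?(ltW x0) ?(ltW xx).
Unshelve. all: by end_near. Qed.

Lemma integral_powR_tail (R : realType) (g a : R) : 0 < g -> 0 < a ->
  (\int[@lebesgue_measure R]_(x in `[a, +oo[) (g * x `^ (- (1 + g)))%:E =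
   (a `^ (- g))%:E)%E.
Proof.
move=> g0 a0.
have D (x : R) : 0 < x -> is_derive x 1 (fun x => - x `^ (- g)) (g * x `^ (- (1 + g))).
  move=> x0; have := is_derive1_powR (- g) x0.
  move=> /is_deriveN h; apply: is_derive_eq (h) _.
  by rewrite mulNr opprK opprD addrC.
rewrite (@ge0_continuous_FTC2y R _ (fun x => - x `^ (- g)) a 0).
- by rewrite EFinN oppeK add0e.
- by move=> x ax; rewrite mulr_ge0 ?powR_ge0 ?ltW.
- apply: continuous_in_subspaceT => x; rewrite inE/= in_itv/= andbT => ax.
  apply: cvgM; first exact: cvg_cst.
  by apply: powR_continuous; exact: lt_le_trans ax.
- rewrite -oppr0; apply: cvgN; exact: powRN_cvg_pinfty.
- by move=> x ax; apply: ex_derive; apply: D; exact: lt_trans ax.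
- apply: cvg_at_right_filter; apply: cvgN; exact: powR_continuous.
- move=> x; rewrite in_itv/= andbT => ax; rewrite derive1E.
  by have [_ ->] := D _ (lt_trans a0 ax).
Qed.

(** The antiderivative need not be differentiable at 0, so the fundamental theorem is applied on
    [[b / n.+2, b]], and these intervals increase to []0, b]]. The shift by 2 keeps them
    nondegenerate already for [n = 0]. *)
Lemma integral_powR_head (R : realType) (p b : R) : - 1 < p -> 0 < b ->
  (\int[@lebesgue_measure R]_(x in `]0%R, b]) (x `^ p)%:E =
   (b `^ (p + 1) / (p + 1))%:E)%E.
Proof.
move=> p1 b0.
have q0 : 0 < p + 1 by rewrite -ltrBlDr sub0r.
have bn (n : nat) : 0 < b / n.+2%:R by rewrite divr_gt0.
have D (x : R) : 0 < x -> is_derive x 1 (fun x => x `^ (p + 1) / (p + 1)) (x `^ p).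
  move=> x0; have h := is_derive1_powR (p + 1) x0.
  have h2 := @is_deriveM R R (@powR R ^~ (p + 1)) (cst (p + 1)^-1) x 1 _ _ h (is_derive_cst _ _ _).
  apply: is_derive_eq (h2) _.
  rewrite scaler0 add0r /= addrK /GRing.scale/=; by field; rewrite gt_eqF.
have E n : (\int[@lebesgue_measure R]_(x in `[(b / n.+2%:R)%R, b]) (x `^ p)%:E =
   (b `^ (p + 1) / (p + 1))%:E - ((b / n.+2%:R) `^ (p + 1) / (p + 1))%:E)%E.
  apply: (@continuous_FTC2 R _ (fun x => x `^ (p + 1) / (p + 1))).
  - by rewrite ltr_pdivrMr// ltr_pMr// ltr1n.
  - apply: continuous_in_subspaceT => x; rewrite inE/= in_itv/= => /andP[ax _].
    by apply: powR_continuous; exact: lt_le_trans ax.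
  - split.
    + move=> x; rewrite in_itv/= => /andP[ax _].
      by apply: ex_derive; apply: D; exact: lt_trans ax.
    + apply: cvg_at_right_filter; apply: cvgM; last exact: cvg_cst.
      exact: powR_continuous.
    + apply: cvg_at_left_filter; apply: cvgM; last exact: cvg_cst.
      exact: powR_continuous.
  - move=> x; rewrite in_itv/= => /andP[ax _]; rewrite derive1E.
    by have [_ ->] := D _ (lt_trans (bn n) ax).
have U : `]0%R, b]%classic = \bigcup_n `[(b / n.+2%:R)%R, b]%classic.
  apply/seteqP; split => x /=; last first.
    move=> [n _] /=; rewrite !in_itv/= => /andP[ax ->]; rewrite andbT.
    exact: lt_le_trans ax.
  rewrite in_itv/= => /andP[x0 xb].
  exists (Num.truncn (b / x)) => //=; rewrite in_itv/= xb andbT.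
  rewrite ler_pdivrMr// mulrC -ler_pdivrMr// ltW//.
  by apply: (lt_le_trans (truncnS_gt _)); rewrite ler_nat.
have H : (\int[@lebesgue_measure R]_(x in `[(b / n.+2%:R)%R, b]) (x `^ p)%:E)%E @[n --> \oo] -->
  (\int[@lebesgue_measure R]_(x in `]0%R, b]) (x `^ p)%:E)%E.
  rewrite U; apply: ge0_nondecreasing_set_cvg_integral.
  - move=> n m nm; apply/subsetPset => x /=; rewrite !in_itv/= => /andP[ax ->].
    rewrite andbT; apply: le_trans ax.
    by rewrite ler_pM2l// lef_pV2 ?posrE// ler_nat ltnS ltnS.
  - by move=> n; exact: measurable_itv.
  - move=> n; apply/measurable_EFinP; apply: measurable_funTS; exact: measurable_powR.
  - by move=> n x _; rewrite lee_fin powR_ge0.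
rewrite -(cvg_lim _ H)//; apply: cvg_lim => //.
rewrite (_ : (fun n => _) = (fun n => (b `^ (p + 1) / (p + 1) - (b / n.+2%:R) `^ (p + 1) / (p + 1))%:E)); last first.
  by apply/funext => n; rewrite E.
apply/fine_cvgP; split; first by apply: nearW.
rewrite -[X in _ --> X]subr0; apply: cvgB; first exact: cvg_cst.
rewrite -(mul0r (p + 1)^-1); apply: cvgM; last exact: cvg_cst.
have /cvg_at_rightP := powR_cvg0 q0; apply; split => //.
rewrite -(mulr0 b); apply: cvgM; first exact: cvg_cst.
rewrite (_ : (fun n => _) = (fun n => @harmonic R n.+1))//.
by have := @cvg_harmonic R; rewrite -cvg_shiftS.
Qed.

(** * Gaussian integrals and the Fourier transform of a Gaussian *)

(** Unnormalised, and parametrised by the coefficient in the exponent rather than by the variance,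
    so that a product of two Gaussians adds the parameters. *)
Definition gauss (R : realType) (v x : R) : R := expR (- (v * x ^+ 2)).

Lemma gauss_gt0 (R : realType) (v x : R) : 0 < gauss v x.
Proof. exact: expR_gt0. Qed.

Lemma gauss_le1 (R : realType) (v x : R) : 0 <= v -> gauss v x <= 1.
Proof. by move=> v0; rewrite /gauss expR_le1 oppr_le0 mulr_ge0// sqr_ge0. Qed.

Lemma gaussD (R : realType) (v w x : R) : gauss (v + w) x = gauss v x * gauss w x.
Proof. by rewrite /gauss mulrDl opprD expRD. Qed.

Lemma measurable_gauss (R : realType) (v : R) : measurable_fun setT (gauss v).
Proof.
apply: measurableT_comp; first exact: measurable_expR.
by apply: measurable_funN; apply: measurable_funM.
Qed.

Lemma continuous_gauss (R : realType) (v : R) : continuous (gauss v).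
Proof.
move=> x; apply: continuous_comp; last exact: continuous_expR.
by apply: cvgN; apply: cvgM; [exact: cvg_cst|exact: exprn_continuous].
Qed.

Lemma integral_gauss (R : realType) (v : R) : 0 < v ->
  (\int[@lebesgue_measure R]_x (gauss v x)%:E = (Num.sqrt (pi / v))%:E)%E.
Proof.
move=> v0; have s0 : 0 < Num.sqrt v by rewrite sqrtr_gt0.
under eq_integral => x _.
  rewrite (_ : gauss v x = gauss_fun (Num.sqrt v * x)); last first.
    by rewrite /gauss /gauss_fun exprMn sqr_sqrtr// ltW.
  over.
rewrite (@ge0_integral_scale R _ (EFin \o @gauss_fun R) s0).
- by rewrite integralT_gauss -EFinM sqrtrM ?pi_ge0// sqrtrV 1?mulrC// ltW.
- by apply/measurable_EFinP; exact: measurable_gauss_fun.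
- by move=> x; rewrite lee_fin gauss_fun_ge0.
Qed.

Lemma integrable_gauss (R : realType) (v : R) : 0 < v ->
  (@lebesgue_measure R).-integrable setT (EFin \o gauss v).
Proof.
move=> v0; apply/integrableP; split.
  by apply/measurable_EFinP; exact: measurable_gauss.
under eq_integral => x _ do rewrite /= ger0_norm ?expR_ge0//.
by rewrite integral_gauss// ltry.
Qed.

Lemma cvg_gauss_pinfty (R : realType) (v : R) : 0 < v ->
  gauss v x @[x --> +oo] --> (0 : R).
Proof.
move=> v0; apply/cvgrPdist_le => e e0; near=> x.
rewrite sub0r normrN ger0_norm ?expR_ge0//.
have [x1 xe] : 1 <= x /\ (v * e)^-1 <= x.
  by split; near: x; apply: nbhs_pinfty_ge; exact: num_real.
have vx : v * x <= v * x ^+ 2 by rewrite ler_pM2l// expr2 ler_peMr// ltW.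
rewrite /gauss expRN -[e]invrK lef_pV2 ?posrE ?invr_gt0 ?expR_gt0//.
apply: le_trans (expR_ge1Dx _); apply: le_trans (_ : v * x <= _); last by lra.
by rewrite -ler_pdivrMl// -invfM.
Unshelve. all: by end_near. Qed.

Lemma real_dominated_cvg d (T : measurableType d) (R : realType)
    (mu : {measure set T -> \bar R}) (f_ : nat -> T -> R) (f g : T -> R) :
  (forall n, measurable_fun setT (f_ n)) ->
  (forall x, f_ n x @[n --> \oo] --> f x) ->
  mu.-integrable setT (EFin \o g) ->
  (forall n x, `|f_ n x| <= g x) ->
  (\int[mu]_x (f_ n x)%:E)%E @[n --> \oo] --> (\int[mu]_x (f x)%:E)%E.
Proof.
move=> mf ff ig fg.
apply: (@dominated_cvg _ _ R mu setT measurableT (fun n => EFin \o f_ n) (EFin \o f) (EFin \o g)) => //.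
- by move=> n; apply/measurable_EFinP.
- by move=> x _; apply/fine_cvgP; split; [apply: nearW|exact: ff].
- by move=> n x _; rewrite lee_fin.
Qed.

(** The integrals over [[- n.+1, n.+1]] tend to 0 by the fundamental theorem and to the full
    integral by dominated convergence. *)
Lemma integral_derive_eq0 (R : realType) (G g : R -> R) :
  (forall t : R, is_derive t 1 G (g t)) -> continuous g ->
  (@lebesgue_measure R).-integrable setT (EFin \o g) ->
  G x @[x --> +oo] --> (0 : R) -> G x @[x --> -oo] --> (0 : R) ->
  \int[@lebesgue_measure R]_x g x = 0.
Proof.
move=> DG cg ig Gp Gm.
have E (n : nat) : (\int[@lebesgue_measure R]_(x in `[(- n.+1%:R)%R, n.+1%:R]) (g x)%:E =
   (G n.+1%:R)%:E - (G (- n.+1%:R))%:E)%E.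
  have cG x : {for x, continuous G}.
    by apply/differentiable_continuous/derivable1_diffP; apply: ex_derive.
  apply: continuous_FTC2.
  - by rewrite (@lt_trans _ _ 0)// oppr_lt0.
  - by apply: continuous_subspaceT.
  - split.
    + by move=> x _; apply: ex_derive.
    + by apply: cvg_at_right_filter; apply: cG.
    + by apply: cvg_at_left_filter; apply: cG.
  - by move=> x _; rewrite derive1E; have [_ ->] := DG x.
have mg : measurable_fun setT g by exact: continuous_measurable_fun.
have H1 : (\int[@lebesgue_measure R]_x (g x * \1_(`[(- n.+1%:R)%R, n.+1%:R]%classic) x)%:E)%E @[n --> \oo] --> (0%R : R)%:E.
  rewrite (_ : (fun n => _) = (fun n => (G n.+1%:R - G (- n.+1%:R))%:E)); last first.
    apply/funext => n; rewrite EFinB -E [RHS]integral_mkcond.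
    by apply: eq_integral => x _; rewrite restrict_EFin patch_indic.
  apply/fine_cvgP; split; first by apply: nearW.
  rewrite -[0]subr0; apply: cvgB.
    apply: (cvg_comp _ _ _ Gp).
    by have := @cvgr_idn R; rewrite -cvg_shiftS.
  have /cvgNy_compNP Gm' := Gm.
  apply: (cvg_comp _ _ _ Gm').
  by have := @cvgr_idn R; rewrite -cvg_shiftS.
have H2 : (\int[@lebesgue_measure R]_x (g x * \1_(`[(- n.+1%:R)%R, n.+1%:R]%classic) x)%:E)%E @[n --> \oo] --> (\int[@lebesgue_measure R]_x (g x)%:E)%E.
  apply: (@real_dominated_cvg _ (measurableTypeR R) R _ _ _ (fun x => `|g x|)).
  - by move=> n; apply: measurable_funM.
  - move=> x; apply: cvg_near_cst; near=> n => /=.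
    rewrite indicE mem_set ?mulr1//= in_itv/= -ler_norml.
    apply: (@le_trans _ _ n%:R); last by rewrite ler_nat.
    by near: n; exact: nbhs_infty_ger.
  - exact: (integrable_abse ig).
  - move=> n x /=; rewrite normrM indicE ler_piMr//.
    by case: (_ \in _); rewrite ?normr1 ?normr0.
by rewrite /Rintegral -(cvg_lim _ H2)// (cvg_lim _ H1).
Unshelve. all: by end_near. Qed.

(** Half of the exponent absorbs the factor [|x|] through [1 + y <= expR y]. What remains is
    quadratic in [|x|] and follows from the squares of [v * y - 1] and [y - 1]. *)
Lemma norm_gauss_le (R : realType) (v x : R) : 0 < v ->
  `|x| * gauss v x <= (1 + v^-1) * gauss (v / 2) x.
Proof.
move=> v0; have -> : gauss v x = gauss (v / 2) x * gauss (v / 2) x.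
  by have := gaussD (v / 2) (v / 2) x; rewrite -splitr.
rewrite mulrA ler_pM2r ?gauss_gt0//.
rewrite /gauss expRN ler_pdivrMr ?expR_gt0//.
apply: (@le_trans _ _ ((1 + v^-1) * (1 + v / 2 * x ^+ 2))); last first.
  by rewrite ler_pM2l ?expR_ge1Dx// addr_gt0// invr_gt0.
have vi : 0 < v^-1 by rewrite invr_gt0.
have vv : v^-1 * v = 1 by rewrite mulVf// gt_eqF.
have K (y : R) : y <= (1 + v^-1) * (1 + v / 2 * y ^+ 2).
  have : 0 <= v^-1 * (v * y - 1) ^+ 2 by rewrite mulr_ge0 ?sqr_ge0// ltW.
  have -> : v^-1 * (v * y - 1) ^+ 2 = (v^-1 * v) * v * y ^+ 2 - 2 * (v^-1 * v) * y + v^-1 by ring.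
  have -> : (1 + v^-1) * (1 + v / 2 * y ^+ 2) = 1 + v * y ^+ 2 / 2 + v^-1 + (v^-1 * v) * y ^+ 2 / 2.
    by field; rewrite gt_eqF.
  rewrite vv !mul1r mulr1 => h.
  have h2 := sqr_ge0 (y - 1).
  have h3 : 0 <= v * y ^+ 2 by rewrite mulr_ge0 ?sqr_ge0// ltW.
  lra.
by apply: le_trans (K _) _; rewrite real_normK ?num_real.
Qed.

Lemma integrable_norm_gauss (R : realType) (v : R) : 0 < v ->
  (@lebesgue_measure R).-integrable setT (fun x => (`|x| * gauss v x)%:E).
Proof.
move=> v0; apply: (@le_integrable _ (measurableTypeR R) R _ _ measurableT _ (fun x => (1 + v^-1)%:E * (gauss (v / 2) x)%:E)%E).
- apply/measurable_EFinP; apply: measurable_funM; last exact: measurable_gauss.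
  exact: normr_measurable.
- move=> x _ /=; rewrite lee_fin ger0_norm; last by rewrite mulr_ge0 ?expR_ge0.
  by apply: le_trans (ler_norm _); exact: norm_gauss_le.
- by apply: integrableZl => //; apply: integrable_gauss; rewrite divr_gt0.
Qed.

Lemma is_derive_gauss (R : realType) (v t : R) :
  is_derive t 1 (gauss v) (- (2 * v * t) * gauss v t).
Proof.
have h : is_derive t 1 (fun t : R => - (v * t ^+ 2)) (- (2 * v * t)).
  apply: is_derive_eq; rewrite /GRing.scale/=; ring.
have := @is_derive1_comp R expR _ t _ _ (is_derive_expR _) h.
by rewrite mulrC.
Qed.
Lemma is_derive_cosM (R : realType) (x t : R) :
  is_derive t 1 (fun t => cos (x * t)) (- (x * sin (x * t))).
Proof.
have h : is_derive t 1 (fun t : R => x * t) x.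
  apply: is_derive_eq; by rewrite /GRing.scale/= mulr1.
have h2 := @is_derive1_comp R cos _ t _ _ (is_derive_cos _) h.
by apply: (is_derive_eq h2); rewrite mulrC mulrN.
Qed.
Lemma is_derive_sinM (R : realType) (x t : R) :
  is_derive t 1 (fun t => sin (x * t)) (x * cos (x * t)).
Proof.
have h : is_derive t 1 (fun t : R => x * t) x.
  apply: is_derive_eq; by rewrite /GRing.scale/= mulr1.
have h2 := @is_derive1_comp R sin _ t _ _ (is_derive_sin _) h.
by apply: (is_derive_eq h2); rewrite mulrC.
Qed.

Lemma measurable_sinM (R : realType) (x : R) : measurable_fun setT (fun t : R => sin (x * t)).
Proof.
apply: continuous_measurable_fun => t.
by apply/differentiable_continuous/derivable1_diffP; apply: ex_derive; exact: is_derive_sinM.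
Qed.
Lemma measurable_cosM (R : realType) (x : R) : measurable_fun setT (fun t : R => cos (x * t)).
Proof.
apply: continuous_measurable_fun => t.
by apply/differentiable_continuous/derivable1_diffP; apply: ex_derive; exact: is_derive_cosM.
Qed.

Lemma norm_cos_le1 (R : realType) (x : R) : `|cos x| <= 1.
Proof. by rewrite ler_norml cos_geN1 cos_le1. Qed.
Lemma norm_sin_le1 (R : realType) (x : R) : `|sin x| <= 1.
Proof. by rewrite ler_norml sin_geN1 sin_le1. Qed.

Lemma integrable_cos_gauss (R : realType) (v x : R) : 0 < v ->
  (@lebesgue_measure R).-integrable setT (fun t => (cos (x * t) * gauss v t)%:E).
Proof.
move=> v0; apply: (@le_integrable _ (measurableTypeR R) R _ _ measurableT _ (EFin \o gauss v)).
- apply/measurable_EFinP; apply: measurable_funM; last exact: measurable_gauss.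
  exact: measurable_cosM.
- move=> t _ /=; rewrite lee_fin normrM ler_piMl// norm_cos_le1//.
- exact: integrable_gauss.
Qed.

Lemma integrable_sin_gauss (R : realType) (v x : R) : 0 < v ->
  (@lebesgue_measure R).-integrable setT (fun t => (t * sin (x * t) * gauss v t)%:E).
Proof.
move=> v0; apply: (@le_integrable _ (measurableTypeR R) R _ _ measurableT _ (fun t => (`|t| * gauss v t)%:E)).
- apply/measurable_EFinP; apply: measurable_funM; last exact: measurable_gauss.
  by apply: measurable_funM => //; exact: measurable_sinM.
- move=> t _ /=; rewrite lee_fin !normrM normr_id ler_wpM2r// ler_piMr// norm_sin_le1//.
- exact: integrable_norm_gauss.
Qed.

(** Integration by parts: the derivative of [sin (x * t) * gauss v t] has integral 0. *)
Lemma gauss_sin_cos (R : realType) (v x : R) : 0 < v ->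
  \int[@lebesgue_measure R]_t (t * sin (x * t) * gauss v t) =
  x / (2 * v) * \int[@lebesgue_measure R]_t (cos (x * t) * gauss v t).
Proof.
move=> v0.
have DG (t : R) : is_derive t 1 (fun t => sin (x * t) * gauss v t)
   (x * (cos (x * t) * gauss v t) - 2 * v * (t * sin (x * t) * gauss v t)).
  have h := @is_deriveM R R (fun t => sin (x * t)) (gauss v) t 1 _ _ (is_derive_sinM x t) (is_derive_gauss v t).
  by apply: (is_derive_eq h); rewrite /GRing.scale/=; ring.
have ic := @integrable_cos_gauss R v x v0.
have iS := @integrable_sin_gauss R v x v0.
have ic' : (@lebesgue_measure R).-integrable setT (EFin \o (fun t => x * (cos (x * t) * gauss v t))).
  exact: (@integrableZl _ (measurableTypeR R) R _ _ measurableT x _ ic).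
have iS' : (@lebesgue_measure R).-integrable setT (EFin \o (fun t => 2 * v * (t * sin (x * t) * gauss v t))).
  exact: (@integrableZl _ (measurableTypeR R) R _ _ measurableT (2 * v) _ iS).
have lim0 (u : R -> R) (F : set_system R) : Filter F -> u t @[t --> F] --> (0 : R) -> (forall t, u t = gauss v t) -> sin (x * t) * gauss v t @[t --> F] --> (0 : R).
  move=> FF u0 uE; apply: (@squeeze_cvgr _ _ _ _ (fun t => - u t) u).
  - apply: nearW => t; rewrite -ler_norml normrM uE (ger0_norm (ltW (gauss_gt0 _ _))).
    by rewrite ler_piMl ?norm_sin_le1// ltW// gauss_gt0.
  - by rewrite -oppr0; apply: cvgN.
  - exact: u0.
have H := @integral_derive_eq0 R _ _ DG.
have : \int[@lebesgue_measure R]_t (x * (cos (x * t) * gauss v t) - 2 * v * (t * sin (x * t) * gauss v t)) = 0.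
  apply: H.
  - move=> t; apply: cvgB; apply: cvgM.
    + exact: cvg_cst.
    + apply: cvgM; last exact: continuous_gauss.
      by apply/differentiable_continuous/derivable1_diffP; apply: ex_derive; exact: is_derive_cosM.
    + exact: cvg_cst.
    + apply: cvgM; last exact: continuous_gauss.
      apply: cvgM; first exact: cvg_id.
      by apply/differentiable_continuous/derivable1_diffP; apply: ex_derive; exact: is_derive_sinM.
  - exact: (@integrableB _ (measurableTypeR R) R _ _ measurableT _ _ ic' iS').
  - apply: (lim0 (gauss v)) => //; exact: cvg_gauss_pinfty.
  - apply: (lim0 (gauss v)) => //.
    apply/cvgNy_compNP.
    rewrite (_ : _ \o _ = gauss v); first exact: cvg_gauss_pinfty.
    by apply/funext => t; rewrite /gauss /= sqrrN.
rewrite RintegralB// RintegralZl// RintegralZl// => /eqP; rewrite subr_eq0 => /eqP E.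
have v2 : 2 * v != 0 by rewrite mulf_neq0// gt_eqF.
by apply: (mulfI v2); rewrite -E mulrA [2 * v * (x / _)]mulrC divfK.
Qed.

(** Differentiation under the integral and [gauss_sin_cos] give the equation F'(y) = - y / (2 v)
    F(y). Hence F(y) times exp(y^2 / (4 v)) is constant, and its value at 0 is the Gaussian
    integral. *)
Lemma integral_cos_gauss (R : realType) (v x : R) : 0 < v ->
  \int[@lebesgue_measure R]_t (cos (x * t) * gauss v t) = Num.sqrt (pi / v) * gauss (4 * v)^-1 x.
Proof.
move=> v0.
pose F x := \int[@lebesgue_measure R]_t (cos (x * t) * gauss v t).
have DF (y : R) : is_derive y 1 F (- (y / (2 * v)) * F y).
  have E z t : partial1of2 (fun x t : R => cos (x * t) * gauss v t) z t = - (t * sin (z * t) * gauss v t).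
    rewrite partial1of2E.
    have h := @is_deriveM R R (fun z => cos (t * z)) (cst (gauss v t)) z 1 _ _ (is_derive_cosM t z) (is_derive_cst _ _ _).
    rewrite (_ : (fun y => _) = (fun z => cos (t * z)) * cst (gauss v t)); last first.
      by apply/funext => w; rewrite /= mulrC [X in cos X]mulrC mulrC.
    have [_ ->] := h.
    by rewrite scaler0 add0r /GRing.scale/= [t * z]mulrC; ring.
  have H1 : (`](y - 1), (y + 1)[%classic : set R) y by rewrite /= in_itv/=; lra.
  have I1 z : (`](y - 1), (y + 1)[%classic : set R) z ->
    (@lebesgue_measure R).-integrable setT (EFin \o (fun t => cos (z * t) * gauss v t)).
    by move=> _; exact: integrable_cos_gauss.
  have I2 z t : (`](y - 1), (y + 1)[%classic : set R) z -> [set: R] t ->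
    derivable (fun z : R => cos (z * t) * gauss v t) z 1.
    move=> _ _; have h := @is_deriveM R R (fun z => cos (t * z)) (cst (gauss v t)) z 1 _ _ (is_derive_cosM t z) (is_derive_cst _ _ _).
    rewrite (_ : (fun z => _) = (fun z => cos (t * z)) * cst (gauss v t)); last first.
      by apply/funext => w; rewrite /= mulrC [X in cos X]mulrC mulrC.
    by apply: ex_derive.
  have I3 t : 0 <= `|t| * gauss v t by rewrite mulr_ge0// expR_ge0.
  have I4 z t : (`](y - 1), (y + 1)[%classic : set R) z -> [set: R] t ->
    `|partial1of2 (fun x t : R => cos (x * t) * gauss v t) z t| <= `|t| * gauss v t.
    move=> _ _; rewrite E normrN !normrM (ger0_norm (expR_ge0 _)) ler_wpM2r ?expR_ge0//.
    by rewrite ler_piMr// norm_sin_le1.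
  have D1 := @derivable_under_integral R _ _ (@lebesgue_measure R) _ setT measurableT y _ _ H1 I1 I2 _ I3 (integrable_norm_gauss v0) I4.
  have D2 := @differentiation_under_integral R _ _ (@lebesgue_measure R) _ setT measurableT y _ _ H1 I1 I2 _ I3 (integrable_norm_gauss v0) I4.
  split; first exact: D1.
  rewrite -derive1E [LHS]D2.
  under eq_Rintegral do rewrite E -mulN1r.
  rewrite RintegralZl//; last exact: integrable_sin_gauss.
  by rewrite gauss_sin_cos// mulN1r mulNr.
pose H (y : R) := F y * expR ((4 * v)^-1 * y ^+ 2).
have DH (y : R) : is_derive y 1 H 0.
  have h1 : is_derive y 1 (fun y : R => (4 * v)^-1 * y ^+ 2) (y / (2 * v)).
    by apply: is_derive_eq; rewrite /GRing.scale/=; field; rewrite gt_eqF.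
  have h2 := @is_derive1_comp R expR _ y _ _ (is_derive_expR _) h1.
  have h := @is_deriveM R R F _ y 1 _ _ (DF y) h2.
  by apply: (is_derive_eq h); rewrite /GRing.scale/=; ring.
have := @is_derive_0_is_cst R H x 0 DH.
rewrite /H expr0n mulr0 expR0 mulr1 => HE.
have -> : \int[@lebesgue_measure R]_t (cos (x * t) * gauss v t) = F x by [].
rewrite /gauss expRN -[F x](@mulfK _ (expR ((4 * v)^-1 * x ^+ 2))) ?gt_eqF ?expR_gt0// HE.
congr (_ / _).
rewrite /F; under eq_Rintegral do rewrite mul0r cos0 mul1r.
by rewrite /Rintegral integral_gauss.
Qed.

(** * Unimodality of the symmetric stable laws *)

Lemma integrable_prodM (R : realType) d1 d2 (T1 : measurableType d1) (T2 : measurableType d2)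
   (m1 : {sigma_finite_measure set T1 -> \bar R}) (m2 : {sigma_finite_measure set T2 -> \bar R})
   (f : T1 -> R) (g : T2 -> R) :
  m1.-integrable setT (EFin \o f) -> m2.-integrable setT (EFin \o g) ->
  (m1 \x m2)%E.-integrable setT (EFin \o (fun z => f z.1 * g z.2)).
Proof.
move=> /integrableP[/measurable_EFinP mf fi] /integrableP[/measurable_EFinP mg gi].
have mfg : measurable_fun setT (EFin \o (fun z : T1 * T2 => f z.1 * g z.2)).
  apply/measurable_EFinP; apply: measurable_funM.
    by apply: measurableT_comp => //; exact: measurable_fst.
  by apply: measurableT_comp => //; exact: measurable_snd.
have [_ h] := @integrable12ltyP _ _ T1 T2 R m1 m2 _ mfg; apply: h.
have gfin : (\int[m2]_y `|g y|%:E)%E \is a fin_num.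
  by rewrite ge0_fin_numE// integral_ge0// => x _; rewrite lee_fin.
under eq_integral => x _.
  rewrite (_ : (\int[m2]_y _)%E = (`|f x|%:E * \int[m2]_y `|g y|%:E)%E); last first.
    rewrite -ge0_integralZl//=.
    - by apply: eq_integral => y _; rewrite /= normrM EFinM.
    - by apply/measurable_EFinP; exact: measurableT_comp.
  over.
rewrite ge0_integralZr//=.
- by rewrite lte_mul_pinfty// ?ge0_fin_numE// integral_ge0.
- by apply/measurable_EFinP; exact: measurableT_comp.
- by rewrite integral_ge0.
Qed.

(* Unimodality of the Fourier transform, smoothed by a Gaussian so that [g] need
   only be bounded.  The class is closed under sums, Gaussian mixtures and
   bounded limits, hence under exponentials of Gaussian mixtures. *)
Definition cos_transform_nonincreasing (R : realType) (g : R -> R) := forall v x y : R,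
  0 < v -> 0 <= x -> x <= y ->
  \int[@lebesgue_measure R]_t (cos (y * t) * (g t * gauss v t)) <=
  \int[@lebesgue_measure R]_t (cos (x * t) * (g t * gauss v t)).

Lemma integrable_bounded_gauss (R : realType) (g h : R -> R) (K v : R) : 0 < v ->
  measurable_fun setT g -> (forall t, `|g t| <= K) ->
  measurable_fun setT h -> (forall t, `|h t| <= 1) ->
  (@lebesgue_measure R).-integrable setT (EFin \o (fun t => h t * (g t * gauss v t))).
Proof.
move=> v0 mg gK mh h1.
apply: (@le_integrable _ (measurableTypeR R) R _ _ measurableT _ (fun t => K%:E * (gauss v t)%:E)%E).
- apply/measurable_EFinP; apply: measurable_funM => //; apply: measurable_funM => //.
  exact: measurable_gauss.
- move=> t _ /=; rewrite lee_fin !normrM (ger0_norm (expR_ge0 _)) mulrA ler_wpM2r ?expR_ge0//.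
  rewrite -[X in _ <= X]mul1r ler_pM// (le_trans (gK t))// ler_norm//.
- by apply: integrableZl => //; exact: integrable_gauss.
Qed.

Lemma cos_transform_nonincreasing1 (R : realType) : cos_transform_nonincreasing (fun _ : R => 1).
Proof.
move=> v x y v0 x0 xy.
under eq_Rintegral do rewrite mul1r.
under [X in _ <= X]eq_Rintegral do rewrite mul1r.
rewrite !integral_cos_gauss// ler_wpM2l ?sqrtr_ge0// /gauss ler_expR lerN2.
rewrite ler_wpM2l ?invr_ge0 ?mulr_ge0// ?(ltW v0)// ler_pXn2r// nnegrE//.
exact: le_trans xy.
Qed.

(** The extra factor [gauss s] is absorbed into the smoothing parameter; this is what the
    quantification over all [v] in the definition is for. *)
Lemma cos_transform_nonincreasing_gauss (R : realType) (g : R -> R) (s : R) : 0 <= s ->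
  cos_transform_nonincreasing g -> cos_transform_nonincreasing (fun t => g t * gauss s t).
Proof.
move=> s0 gD v x y v0 x0 xy.
under eq_Rintegral do rewrite -(mulrA (g _)) -gaussD.
under [X in _ <= X]eq_Rintegral do rewrite -(mulrA (g _)) -gaussD.
by apply: gD => //; lra.
Qed.

Lemma cos_transform_nonincreasingD (R : realType) (g h : R -> R) (K : R) :
  measurable_fun setT g -> (forall t, `|g t| <= K) ->
  measurable_fun setT h -> (forall t, `|h t| <= K) ->
  cos_transform_nonincreasing g -> cos_transform_nonincreasing h ->
  cos_transform_nonincreasing (fun t => g t + h t).
Proof.
move=> mg gK mh hK gD hD v x y v0 x0 xy.
have E z : \int[@lebesgue_measure R]_t (cos (z * t) * ((g t + h t) * gauss v t)) =
   \int[@lebesgue_measure R]_t (cos (z * t) * (g t * gauss v t)) +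
   \int[@lebesgue_measure R]_t (cos (z * t) * (h t * gauss v t)).
  rewrite -RintegralD//.
  - by apply: eq_Rintegral => t _; rewrite mulrDl mulrDr.
  - by apply: (integrable_bounded_gauss v0 mg gK (measurable_cosM _)) => t; exact: norm_cos_le1.
  - by apply: (integrable_bounded_gauss v0 mh hK (measurable_cosM _)) => t; exact: norm_cos_le1.
by rewrite !E lerD// ?gD// hD.
Qed.

Lemma cos_transform_nonincreasingZ (R : realType) (g : R -> R) (K c : R) :
  measurable_fun setT g -> (forall t, `|g t| <= K) -> 0 <= c ->
  cos_transform_nonincreasing g -> 
  cos_transform_nonincreasing (fun t => c * g t).
Proof.
move=> mg gK c0 gD v x y v0 x0 xy.
have E z : \int[@lebesgue_measure R]_t (cos (z * t) * ((c * g t) * gauss v t)) =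
   c * \int[@lebesgue_measure R]_t (cos (z * t) * (g t * gauss v t)).
  rewrite -RintegralZl//.
  - by apply: eq_Rintegral => t _; rewrite !mulrA [_ * c]mulrC.
  - by apply: (integrable_bounded_gauss v0 mg gK (measurable_cosM _)) => t; exact: norm_cos_le1.
by rewrite !E ler_wpM2l// gD.
Qed.

Lemma Rintegral_dominated_cvg d (T : measurableType d) (R : realType)
    (mu : {measure set T -> \bar R}) (f_ : nat -> T -> R) (f g : T -> R) :
  (forall n, measurable_fun setT (f_ n)) ->
  (forall x, f_ n x @[n --> \oo] --> f x) ->
  mu.-integrable setT (EFin \o g) ->
  (forall n x, `|f_ n x| <= g x) ->
  (\int[mu]_x (f_ n x)) @[n --> \oo] --> (\int[mu]_x (f x)).
Proof.
move=> mf ff ig fg.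
have := real_dominated_cvg mf ff ig fg.
have mff : measurable_fun setT f.
  by apply: (@measurable_fun_cvg _ _ _ _ f_) => // x _; exact: ff.
have fgx x : `|f x| <= g x.
  have ffx : `|f_ n x| @[n --> \oo] --> `|f x| by apply: cvg_norm; exact: ff.
  by rewrite -(cvg_lim _ ffx)//; apply: limr_le; [by apply/cvg_ex; exists (`|f x|)|exact: nearW].
have If : mu.-integrable setT (EFin \o f).
  apply: (le_integrable measurableT _ _ ig); first exact/measurable_EFinP.
  by move=> x _ /=; rewrite lee_fin (le_trans _ (ler_norm _)).
move=> H; rewrite /Rintegral; apply: fine_cvg; rewrite fineK//.
exact: integrable_fin_num.
Qed.

Lemma cos_transform_nonincreasing_lim (R : realType) (g_ : nat -> R -> R) (g : R -> R) (K : R) :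
  (forall n, measurable_fun setT (g_ n)) -> (forall n t, `|g_ n t| <= K) ->
  (forall t, g_ n t @[n --> \oo] --> g t) ->
  (forall n, cos_transform_nonincreasing (g_ n)) ->
  cos_transform_nonincreasing g.
Proof.
move=> mg gK gg gD v x y v0 x0 xy.
have H z : \int[@lebesgue_measure R]_t (cos (z * t) * (g_ n t * gauss v t)) @[n --> \oo] -->
   \int[@lebesgue_measure R]_t (cos (z * t) * (g t * gauss v t)).
  apply: (@Rintegral_dominated_cvg _ (measurableTypeR R) R _ _ _ (fun t => K * gauss v t)).
  - move=> n; apply: measurable_funM; first exact: measurable_cosM.
    by apply: measurable_funM; [exact: mg|exact: measurable_gauss].
  - move=> t; apply: cvgM; first exact: cvg_cst.
    by apply: cvgM; [exact: gg|exact: cvg_cst].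
  - by apply: (@integrableZl _ (measurableTypeR R) R _ _ measurableT K (EFin \o gauss v)); exact: integrable_gauss.
  - move=> n t; rewrite !normrM (ger0_norm (expR_ge0 _)) mulrA ler_wpM2r ?expR_ge0//.
    by rewrite -[X in _ <= X]mul1r ler_pM// norm_cos_le1.
rewrite -(cvg_lim _ (H x))// -(cvg_lim _ (H y))//.
apply: ler_lim; [by apply/cvg_ex; eexists; exact: H|by apply/cvg_ex; eexists; exact: H|].
by apply: nearW => n; exact: gD.
Qed.

Lemma measurable_gauss2 (R : realType) :
  measurable_fun setT (fun p : measurableTypeR R * measurableTypeR R => gauss p.1 p.2).
Proof.
apply: measurableT_comp; first exact: measurable_expR.
apply: measurable_funN; apply: measurable_funM; first exact: measurable_fst.
by apply: measurable_funX; exact: measurable_snd.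
Qed.

Section gauss_mixture.
Context (R : realType) (rho : R -> R).
Hypothesis irho : (@lebesgue_measure R).-integrable setT (EFin \o rho).
Hypothesis rho0 : forall s, 0 <= rho s.
Hypothesis rhoN : forall s, s < 0 -> rho s = 0.

(** As a function of [t ^+ 2], the Laplace transform of the finite measure on the half line with
    density [rho]. *)
Definition gauss_mixture t := \int[@lebesgue_measure R]_s (rho s * gauss s t).

Let mrho : measurable_fun [set: measurableTypeR R] rho.
Proof. by apply/measurable_EFinP; exact: measurable_int irho. Qed.

Lemma gauss_mixture_dens_le s t : rho s * gauss s t <= rho s.
Proof.
have [s0|s0] := ltP s 0; first by rewrite (rhoN s0) mul0r.
by rewrite ler_piMr// gauss_le1.
Qed.

Lemma integrable_gauss_mixture t :
  (@lebesgue_measure R).-integrable setT (EFin \o (fun s => rho s * gauss s t)).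
Proof.
apply: (@le_integrable _ (measurableTypeR R) R _ _ measurableT _ (EFin \o rho)) => //.
- apply/measurable_EFinP; apply: measurable_funM; first exact: mrho.
  apply: measurableT_comp; first exact: measurable_expR.
  by apply: measurable_funN; exact: measurable_funM.
- move=> s _ /=; rewrite lee_fin (ger0_norm (rho0 s)) ger0_norm ?gauss_mixture_dens_le//.
  by rewrite mulr_ge0// expR_ge0.
Qed.

Lemma gauss_mixture_ge0 t : 0 <= gauss_mixture t.
Proof. by apply: Rintegral_ge0 => s _; rewrite mulr_ge0// expR_ge0. Qed.

Lemma gauss_mixture_le t : gauss_mixture t <= \int[@lebesgue_measure R]_s rho s.
Proof.
apply: le_Rintegral => //.
- exact: integrable_gauss_mixture.
- by move=> s _; exact: gauss_mixture_dens_le.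
Qed.

Lemma measurable_gauss_mixture : measurable_fun setT gauss_mixture.
Proof.
apply: measurableT_comp; first exact: fine_measurable.
apply: (@measurable_fun_fubini_tonelli_F _ _ (measurableTypeR R) (measurableTypeR R) R (@lebesgue_measure R)
  (fun p => (rho p.2 * gauss p.2 p.1)%:E)).
- apply/measurable_EFinP; apply: measurable_funM.
    by apply: measurableT_comp; [exact: mrho|exact: measurable_snd].
  apply: (@measurableT_comp _ _ _ _ _ _ (fun p : measurableTypeR R * measurableTypeR R => gauss p.1 p.2) _ (fun p => (p.2, p.1))).
    exact: measurable_gauss2.
  by apply: measurable_fun_pair; [exact: measurable_snd|exact: measurable_fst].
- by move=> p; rewrite lee_fin mulr_ge0// expR_ge0.
Qed.

(** By Fubini the transform of the product is the [rho]-mixture, over [s], of the transforms of [g]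
    times [gauss s], each of which is nonincreasing. *)
Lemma cos_transform_nonincreasing_mix (g : R -> R) (K : R) :
  measurable_fun setT g -> (forall t, `|g t| <= K) ->
  cos_transform_nonincreasing g ->
  cos_transform_nonincreasing (fun t => g t * gauss_mixture t).
Proof.
move=> mg gK gD v x y v0 x0 xy.
pose F z (p : measurableTypeR R * measurableTypeR R) := rho p.1 * gauss p.1 p.2 * (cos (z * p.2) * (g p.2 * gauss v p.2)).
have mF z : measurable_fun setT (F z).
  apply: measurable_funM.
    apply: measurable_funM; last exact: measurable_gauss2.
    by apply: measurableT_comp; [exact: mrho|exact: measurable_fst].
  apply: (@measurableT_comp _ _ _ _ _ _ (fun t : R => cos (z * t) * (g t * gauss v t))); last exact: measurable_snd.
  apply: measurable_funM; first exact: measurable_cosM.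
  by apply: measurable_funM; [exact: mg|exact: measurable_gauss].
have iF z : ((@lebesgue_measure R) \x (@lebesgue_measure R))%E.-integrable setT (EFin \o F z).
  apply: (@le_integrable _ _ R _ _ measurableT _ (EFin \o (fun p : measurableTypeR R * measurableTypeR R => rho p.1 * (K * gauss v p.2)))).
  - by apply/measurable_EFinP; exact: mF.
  - move=> [t s] _ /=; rewrite lee_fin /F/=.
    rewrite normrM [X in _ <= X]normrM ler_pM//.
      rewrite (ger0_norm (rho0 _)) ger0_norm ?gauss_mixture_dens_le//.
      by rewrite mulr_ge0// expR_ge0.
    rewrite !normrM mulrA ler_wpM2r//.
    by rewrite -[X in _ <= X]mul1r ler_pM ?norm_cos_le1// (le_trans (gK _))// ler_norm.
  - apply: (@integrable_prodM R _ _ (measurableTypeR R) (measurableTypeR R) _ _ rho (fun t => K * gauss v t)) => //.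
    by apply: (@integrableZl _ (measurableTypeR R) R _ _ measurableT K (EFin \o gauss v)); exact: integrable_gauss.
pose J z s := \int[@lebesgue_measure R]_t (cos (z * t) * (g t * gauss s t * gauss v t)).
have igv z (s : R) : 0 <= s -> (@lebesgue_measure R).-integrable setT (EFin \o (fun t => cos (z * t) * (g t * gauss s t * gauss v t))).
  move=> s0; apply: (@integrable_bounded_gauss R (fun t => g t * gauss s t) (fun t => cos (z * t)) K) => //.
  - by apply: measurable_funM; [exact: mg|exact: measurable_gauss].
  - move=> t; rewrite normrM (ger0_norm (expR_ge0 _)) (le_trans _ (gK t))// ler_piMr//.
    exact: gauss_le1.
  - exact: measurable_cosM.
  - by move=> t; exact: norm_cos_le1.
have JE z s : (rho s * J z s)%:E = (\int[@lebesgue_measure R]_t (F z (s, t))%:E)%E.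
  have [s0|s0] := ltP s 0.
    rewrite rhoN// mul0r; under eq_integral => t _ do rewrite /F/= rhoN// mul0r mul0r.
    by rewrite integral0.
  rewrite EFinM /J /Rintegral fineK; last exact: (integrable_fin_num _ (igv z s s0)).
  rewrite -(@integralZl _ (measurableTypeR R))//; last exact: (igv z s s0).
  by apply: eq_integral => t _; rewrite /F/= -EFinM; congr (_%:E); ring.
have iJ z : (@lebesgue_measure R).-integrable setT (EFin \o (fun s => rho s * J z s)).
  apply: eq_integrable (integrable_fubini_F (iF z)) => //.
  by move=> s _; rewrite /= JE.
have E z : \int[@lebesgue_measure R]_t (cos (z * t) * (g t * gauss_mixture t * gauss v t)) =
   \int[@lebesgue_measure R]_s (rho s * J z s).
  rewrite /Rintegral; congr fine.
  under [RHS]eq_integral do rewrite JE.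
  rewrite (Fubini (iF z)).
  apply: eq_integral => t _.
  transitivity ((cos (z * t) * (g t * gauss v t))%:E * (gauss_mixture t)%:E)%E.
    by rewrite -EFinM; congr (_%:E); ring.
  rewrite /gauss_mixture /Rintegral fineK; last exact: (integrable_fin_num _ (integrable_gauss_mixture t)).
  rewrite -(@integralZl _ (measurableTypeR R))//; last exact: integrable_gauss_mixture.
  by apply: eq_integral => s _; rewrite /F/= -EFinM; congr (_%:E); ring.
rewrite !E; apply: le_Rintegral => // s _.
have [s0|s0] := ltP s 0; first by rewrite rhoN// !mul0r.
by rewrite ler_wpM2l//; apply: (cos_transform_nonincreasing_gauss s0 gD).
Qed.

Lemma cos_transform_nonincreasing_mixX n :
  cos_transform_nonincreasing (fun t => gauss_mixture t ^+ n).
Proof.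
elim: n => [|n IH].
  by under eq_fun do rewrite expr0; exact: cos_transform_nonincreasing1.
under eq_fun do rewrite exprSr.
apply: (@cos_transform_nonincreasing_mix _ ((\int[@lebesgue_measure R]_s rho s) ^+ n)) => //.
- by apply: measurable_funX; exact: measurable_gauss_mixture.
- move=> t; rewrite ger0_norm ?exprn_ge0 ?gauss_mixture_ge0//.
  apply: lerXn2r; rewrite ?nnegrE ?gauss_mixture_ge0 ?gauss_mixture_le//.
  exact: (le_trans (gauss_mixture_ge0 0) (gauss_mixture_le 0)).
Qed.

(** The partial sums of the exponential series have nonnegative coefficients and stay below
    [expR W], where [W] is the total mass of [rho]; sums, multiples and bounded limits preserve
    monotonicity of the transform. *)
Lemma cos_transform_nonincreasing_expR_mix :
  cos_transform_nonincreasing (fun t => expR (gauss_mixture t)).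
Proof.
pose W := \int[@lebesgue_measure R]_s rho s.
have mw := measurable_gauss_mixture.
have w0 := gauss_mixture_ge0; have wW := gauss_mixture_le.
have W0 : 0 <= W by apply: le_trans (w0 0) (wW 0).
pose p n t := series (exp_coeff (gauss_mixture t)) n.
have pS n : p n.+1 = (fun t => p n t + (n`!%:R)^-1 * gauss_mixture t ^+ n).
  by apply/funext => t; rewrite /p /series/= big_nat_recr//= /exp_coeff/= [X in _ + X]mulrC.
have p0' : p 0 = cst 0 by apply/funext => t; rewrite /p /series/= big_nil.
have mp n : measurable_fun setT (p n).
  elim: n => [|n IH]; first by rewrite p0'.
  rewrite pS; apply: measurable_funD => //; apply: measurable_funM => //.
  exact: measurable_funX.
have c0 n t : 0 <= exp_coeff (gauss_mixture t) n by rewrite /exp_coeff/= divr_ge0// exprn_ge0.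
have p0 n t : 0 <= p n t by apply: sumr_ge0 => k _.
have pW n t : `|p n t| <= expR W.
  rewrite ger0_norm//; apply: (@le_trans _ _ (expR (gauss_mixture t))); last by rewrite ler_expR.
  apply: (nondecreasing_cvgn_le (u_ := series (exp_coeff (gauss_mixture t)))).
    by apply/nondecreasing_seqP => k; rewrite /series/= big_nat_recr//= lerDl.
  exact: is_cvg_series_exp_coeff.
apply: (@cos_transform_nonincreasing_lim _ p _ (expR W)) => //.
  by move=> t; exact: is_cvg_series_exp_coeff.
elim=> [|n IH].
  rewrite p0' => v x y v0 x0 xy.
  under eq_Rintegral do rewrite /= mul0r mulr0.
  by under [X in _ <= X]eq_Rintegral do rewrite /= mul0r mulr0.
have ni : 0 <= (n`!%:R)^-1 :> R by rewrite invr_ge0.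
have WX t : `|gauss_mixture t ^+ n| <= W ^+ n.
  by rewrite ger0_norm ?exprn_ge0//; apply: lerXn2r; rewrite ?nnegrE.
rewrite pS.
apply: (@cos_transform_nonincreasingD _ _ _ (expR W + (n`!%:R)^-1 * W ^+ n)) => //.
- by move=> t; rewrite (le_trans (pW n t))// lerDl mulr_ge0// exprn_ge0.
- by apply: measurable_funM => //; exact: measurable_funX.
- move=> t; rewrite normrM (ger0_norm ni) (@le_trans _ _ ((n`!%:R)^-1 * W ^+ n))//.
    by rewrite ler_wpM2l.
  by rewrite lerDr expR_ge0.
- apply: (cos_transform_nonincreasingZ (K := W ^+ n)) => //.
    exact: measurable_funX.
  exact: cos_transform_nonincreasing_mixX.
Qed.
End gauss_mixture.

(** * Truncated power densities and the integral representation of a power *)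

Lemma integrable_ge0 d (T : measurableType d) (R : realType) (mu : {measure set T -> \bar R}) (f : T -> R) :
  measurable_fun setT f -> (forall x, 0 <= f x) -> (\int[mu]_x (f x)%:E < +oo)%E ->
  mu.-integrable setT (EFin \o f).
Proof.
move=> mf f0 fi; apply/integrableP; split; first exact/measurable_EFinP.
by under eq_integral => x _ do rewrite /= ger0_norm//.
Qed.

(* [powR] takes the value 1 at negative arguments, hence the indicator. *)
Definition pareto_dens (R : realType) (e b s : R) : R :=
  \1_(`[e, +oo[%classic : set R) s * s `^ (- (1 + b)).

Lemma measurable_pareto_dens (R : realType) (e b : R) : measurable_fun setT (pareto_dens e b).
Proof.
by apply: measurable_funM; [exact: measurable_indic|exact: measurable_powR].
Qed.

Lemma pareto_dens_ge0 (R : realType) (e b s : R) : 0 <= pareto_dens e b s.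
Proof. by rewrite mulr_ge0// powR_ge0. Qed.

Lemma integral_pareto_dens (R : realType) (e b : R) : 0 < e -> 0 < b ->
  (\int[@lebesgue_measure R]_s (pareto_dens e b s)%:E = (e `^ (- b) / b)%:E)%E.
Proof.
move=> e0 b0.
have H := integral_powR_tail b0 e0.
rewrite mulrC EFinM -H -ge0_integralZl//=.
- rewrite [RHS]integral_mkcond; apply: eq_integral => s _.
  rewrite restrict_EFin patch_indic /pareto_dens /= mulrA mulVf ?gt_eqF// mul1r mulrC//.
- apply/measurable_EFinP; apply: measurable_funTS.
  by apply: measurable_funM; [|exact: measurable_powR].
- by move=> s _; rewrite lee_fin mulr_ge0 ?powR_ge0// ltW.
- by rewrite lee_fin invr_ge0 ltW.
Qed.

Lemma integrable_pareto_dens (R : realType) (e b : R) : 0 < e -> 0 < b ->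
  (@lebesgue_measure R).-integrable setT (EFin \o pareto_dens e b).
Proof.
move=> e0 b0; apply: (@integrable_ge0 _ (measurableTypeR R)).
- exact: measurable_pareto_dens.
- exact: pareto_dens_ge0.
- by rewrite integral_pareto_dens// ltry.
Qed.

(** Integrand of the subordination formula: for 0 < b < 1 its integral over [s] is a constant times
    |t|^(2b). *)
Definition levy_kernel (R : realType) (b t s : R) : R :=
  \1_(`]0%R, +oo[%classic : set R) s * s `^ (- (1 + b)) * (1 - gauss s t).

Lemma levy_kernelE (R : realType) (b t s : R) : levy_kernel b t s =
  if 0 < s then s `^ (- (1 + b)) * (1 - gauss s t) else 0.
Proof.
rewrite /levy_kernel indicE.
case: ifPn => s0; first by rewrite mem_set ?mul1r//= in_itv/= s0.
by rewrite memNset ?mul0r//= in_itv/= andbT; exact/negP.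
Qed.

Lemma levy_kernel_ge0 (R : realType) (b t s : R) : 0 <= levy_kernel b t s.
Proof.
rewrite levy_kernelE; case: ifPn => // s0.
by rewrite mulr_ge0 ?powR_ge0// subr_ge0 gauss_le1// ltW.
Qed.

Lemma measurable_levy_kernel (R : realType) (b t : R) : measurable_fun setT (levy_kernel b t).
Proof.
apply: measurable_funM.
  by apply: measurable_funM; [exact: measurable_indic|exact: measurable_powR].
apply: measurable_funB => //; apply: measurableT_comp; first exact: measurable_expR.
by apply: measurable_funN; apply: measurable_funM.
Qed.

(** Near 0 the factor 1 - e^(-s) is at most s, which raises the exponent to -b; beyond 1 it is at
    most 1. *)
Lemma levy_kernel1_le (R : realType) (b s : R) :
  levy_kernel b 1 s <= \1_(`]0%R, 1%R]%classic : set R) s * s `^ (- b) + pareto_dens 1 b s.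
Proof.
rewrite levy_kernelE /pareto_dens !indicE; case: ifPn => s0; last first.
  by rewrite addr_ge0// mulr_ge0 ?powR_ge0.
have [s1|s1] := leP s 1.
  rewrite mem_set ?mul1r; last by rewrite /= in_itv/= s0.
  apply: ler_wpDr; first by rewrite mulr_ge0 ?powR_ge0.
  have -> : s `^ (- b) = s `^ (- (1 + b)) * s.
    rewrite -{3}[s]powRr1 ?(ltW s0)// -powRD; last by rewrite (gt_eqF s0) implybT.
    by congr (_ `^ _); ring.
  rewrite ler_wpM2l ?powR_ge0// /gauss expr1n mulr1.
  by have := expR_ge1Dx (- s); lra.
have -> : s \in `[1, +oo[%classic by rewrite inE/= in_itv/= andbT ltW.
rewrite [X in _ <= _ + X]mul1r.
apply: ler_wpDl; first by rewrite mulr_ge0 ?powR_ge0.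
by rewrite ler_piMr ?powR_ge0// gerBl expR_ge0.
Qed.

Lemma integrable_levy_kernel1 (R : realType) (b : R) : 0 < b -> b < 1 ->
  (@lebesgue_measure R).-integrable setT (EFin \o levy_kernel b 1).
Proof.
move=> b0 b1.
apply: (@le_integrable _ (measurableTypeR R) R _ _ measurableT _
  (EFin \o (fun s => \1_(`]0%R, 1%R]%classic : set R) s * s `^ (- b) + pareto_dens 1 b s))).
- by apply/measurable_EFinP; exact: measurable_levy_kernel.
- move=> s _ /=; rewrite lee_fin ger0_norm ?levy_kernel_ge0//.
  by apply: le_trans (ler_norm _); exact: levy_kernel1_le.
- suff h : (@lebesgue_measure R).-integrable setT (EFin \o (fun s => \1_(`]0%R, 1%R]%classic : set R) s * s `^ (- b))).
    exact: (@integrableD _ (measurableTypeR R) R _ _ measurableT _ _ h (integrable_pareto_dens ltr01 b0)).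
  apply: (@integrable_ge0 _ (measurableTypeR R)).
  + by apply: measurable_funM; [exact: measurable_indic|exact: measurable_powR].
  + by move=> s; rewrite mulr_ge0 ?powR_ge0.
  + rewrite (_ : (\int[_]_x _)%E = (\int[@lebesgue_measure R]_(x in `]0%R, 1%R]) (x `^ (- b))%:E)%E).
      by rewrite integral_powR_head ?ltry// ltrN2.
    rewrite [RHS]integral_mkcond; apply: eq_integral => s _.
    by rewrite restrict_EFin patch_indic /= mulrC.
Qed.

(** The value is Gamma(1 - b) / b; what follows uses that it is finite and positive. *)
Definition levy_const (R : realType) (b : R) : R := \int[@lebesgue_measure R]_s levy_kernel b 1 s.

(** On [[1, +oo[] the factor 1 - e^(-s) is at least 1 - e^(-1), which leaves a positive multiple of
    a Pareto integral. *)
Lemma levy_const_gt0 (R : realType) (b : R) : 0 < b -> b < 1 -> 0 < levy_const b.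
Proof.
move=> b0 b1.
apply: (@lt_le_trans _ _ (\int[@lebesgue_measure R]_s ((1 - expR (- 1)) * pareto_dens 1 b s))).
  rewrite RintegralZl//; last exact: integrable_pareto_dens.
  by rewrite mulr_gt0// /Rintegral integral_pareto_dens//= powR1 divr_gt0.
apply: le_Rintegral => //.
- apply: (@integrableZl _ (measurableTypeR R) R _ _ measurableT (1 - expR (- 1)) (EFin \o pareto_dens 1 b)).
  exact: integrable_pareto_dens.
- exact: integrable_levy_kernel1.
- move=> s _; rewrite /pareto_dens indicE.
  have [s1|s1] := leP 1 s; last first.
    by rewrite memNset ?mul0r ?mulr0 ?levy_kernel_ge0//= in_itv/= andbT; apply/negP; rewrite -ltNge.
  rewrite mem_set ?mul1r; last by rewrite /= in_itv/= s1.
  rewrite levy_kernelE (lt_le_trans _ s1)// mulrC ler_wpM2l ?powR_ge0//.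
  by rewrite lerD2l lerN2 ler_expR expr1n mulr1 lerN2.
Qed.

Lemma levy_kernel_scale (R : realType) (b t s : R) : t != 0 ->
  levy_kernel b t s = (t ^+ 2) `^ (1 + b) * levy_kernel b 1 (t ^+ 2 * s).
Proof.
move=> t0; have t2 : 0 < t ^+ 2 by rewrite exprn_even_gt0.
rewrite !levy_kernelE pmulr_rgt0//; case: ifPn => s0; last by rewrite mulr0.
rewrite powRM ?(ltW t2) ?(ltW s0)// !mulrA -powRD ?(gt_eqF t2) ?implybT//.
by rewrite addrN powRr0 mul1r /gauss expr1n mulr1 [s * _]mulrC.
Qed.

(** The substitution of [t ^+ 2 * s] for the variable reduces the kernel at [t] to the kernel at 1.
    At [t = 0] both sides vanish, the right one because the exponent [2 * b] is nonzero. *)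
Lemma integral_levy_kernel (R : realType) (b t : R) : 0 < b -> b < 1 ->
  (\int[@lebesgue_measure R]_s (levy_kernel b t s)%:E = (`|t| `^ (2 * b) * levy_const b)%:E)%E.
Proof.
move=> b0 b1; have [->|t0] := eqVneq t 0.
  under eq_integral => s _.
    rewrite (_ : levy_kernel b 0 s = 0); last first.
      by rewrite levy_kernelE; case: ifP => // _; rewrite /gauss expr0n/= mulr0 oppr0 expR0 subrr mulr0.
    over.
  by rewrite integral0 normr0 powR0 ?mul0r// mulf_neq0// gt_eqF.
have t2 : 0 < t ^+ 2 by rewrite exprn_even_gt0.
have m1 : measurable_fun setT (fun x => (levy_kernel b 1 x)%:E).
  by apply/measurable_EFinP; exact: measurable_levy_kernel.
under eq_integral => s _ do rewrite (levy_kernel_scale _ _ t0) EFinM.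
rewrite ge0_integralZl//; last 3 first.
- apply: (measurableT_comp m1 (g := fun s => t ^+ 2 * s)).
  by apply: measurable_funM.
- by move=> s _; rewrite lee_fin levy_kernel_ge0.
- by rewrite lee_fin powR_ge0.
rewrite (@ge0_integral_scale R _ (fun s => (levy_kernel b 1 s)%:E) t2)//; last first.
  by move=> s; rewrite lee_fin levy_kernel_ge0.
rewrite -[(\int[_]_x _)%E]fineK; last exact: (integrable_fin_num _ (integrable_levy_kernel1 b0 b1)).
rewrite -!EFinM mulrA; congr (_ * _)%:E.
rewrite -powR_inv1 ?(ltW t2)// -powRD ?(gt_eqF t2) ?implybT// -[t ^+ 2]real_normK ?num_real//.
by rewrite -powR_mulrn// -powRrM; congr (_ `^ _); ring.
Qed.

Definition stable_cf (R : realType) (alpha t : R) : R := expR (- (`|t| `^ alpha)).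

Lemma measurable_stable_cf (R : realType) (alpha : R) : measurable_fun setT (stable_cf alpha).
Proof.
apply: measurableT_comp; first exact: measurable_expR.
apply: measurable_funN; apply: (measurableT_comp (f := @powR R ^~ alpha)); first exact: measurable_powR.
exact: normr_measurable.
Qed.

Lemma stable_cf_gt0 (R : realType) (alpha t : R) : 0 < stable_cf alpha t.
Proof. exact: expR_gt0. Qed.

Lemma stable_cf_le1 (R : realType) (alpha t : R) : stable_cf alpha t <= 1.
Proof. by rewrite expR_le1 oppr_le0 powR_ge0. Qed.

(* The symmetric stable law is a scale mixture of Gaussians: [|t| ^ alpha] is
   the integral of [1 - e^{- s t^2}] against a multiple of [s ^ (-1 - alpha/2)]. *)
Lemma cos_transform_nonincreasing_stable (R : realType) (alpha : R) : 0 < alpha -> alpha < 2 ->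
  cos_transform_nonincreasing (stable_cf alpha).
Proof.
move=> a0 a2; pose b := alpha / 2.
have b0 : 0 < b by rewrite divr_gt0.
have b1 : b < 1 by rewrite /b; lra.
pose c := (levy_const b)^-1.
have K0 := levy_const_gt0 b0 b1.
have c0 : 0 < c by rewrite invr_gt0.
(* The mixing density s^(-1-b) has infinite mass at 0, so it is cut off below 1/(n+1). The factor
   [c] normalises the limiting exponent to exactly |t|^alpha. *)
pose rho n s := c * pareto_dens (n.+1%:R^-1) b s.
have en (n : nat) : 0 < n.+1%:R^-1 :> R by rewrite invr_gt0.
have irho n : (@lebesgue_measure R).-integrable setT (EFin \o rho n).
  apply: (@integrableZl _ (measurableTypeR R) R _ _ measurableT c (EFin \o pareto_dens _ b)).
  exact: integrable_pareto_dens.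
have rho0 n s : 0 <= rho n s by rewrite mulr_ge0 ?pareto_dens_ge0// ltW.
have rhoN n s : s < 0 -> rho n s = 0.
  move=> s0; rewrite /rho /pareto_dens indicE memNset ?mul0r ?mulr0//= in_itv/= andbT.
  by apply/negP; rewrite -ltNge (lt_trans s0).
pose m n := \int[@lebesgue_measure R]_s rho n s.
have imix n t := integrable_gauss_mixture (irho n) (rho0 n) (rhoN n) t.
have E n t : m n - gauss_mixture (rho n) t = \int[@lebesgue_measure R]_s (rho n s * (1 - gauss s t)).
  rewrite /m /gauss_mixture -(RintegralB measurableT (irho n) (imix n t)).
  by apply: eq_Rintegral => s _; rewrite mulrBr mulr1.
have ilk t : (@lebesgue_measure R).-integrable setT (EFin \o levy_kernel b t).
  apply: (@integrable_ge0 _ (measurableTypeR R)).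
  - exact: measurable_levy_kernel.
  - exact: levy_kernel_ge0.
  - by rewrite integral_levy_kernel// ltry.
have lim t : m n - gauss_mixture (rho n) t @[n --> \oo] --> `|t| `^ alpha.
  have -> : `|t| `^ alpha = \int[@lebesgue_measure R]_s (c * levy_kernel b t s).
    rewrite RintegralZl// /Rintegral integral_levy_kernel//= mulrCA mulVf ?gt_eqF// mulr1.
    by congr (_ `^ _); rewrite /b; field.
  under eq_fun do rewrite E.
  apply: (@Rintegral_dominated_cvg _ (measurableTypeR R) R _ _ _ (fun s => c * levy_kernel b t s)).
  - move=> n; apply: measurable_funM.
      by apply: measurable_funM => //; exact: measurable_pareto_dens.
    apply: measurable_funB => //; apply: measurableT_comp; first exact: measurable_expR.
    by apply: measurable_funN; apply: measurable_funM.
  - move=> s; rewrite levy_kernelE; case: ifPn => s0.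
      rewrite mulrA; apply: cvgM; last exact: cvg_cst.
      apply: cvgM; first exact: cvg_cst.
      rewrite -[X in _ --> X]mul1r; apply: cvgM; last exact: cvg_cst.
      apply: cvg_near_cst; near=> n.
      rewrite indicE mem_set//= in_itv/= andbT.
      rewrite invf_ple ?posrE//; apply: (@le_trans _ _ n%:R); last by rewrite ler_nat.
      by near: n; exact: nbhs_infty_ger.
    apply: cvg_near_cst; near=> n.
    rewrite /rho /pareto_dens indicE memNset ?mul0r ?mulr0 ?mul0r//= in_itv/= andbT.
    by apply/negP; rewrite -ltNge (le_lt_trans _ (en n))// leNgt.
  - exact: (@integrableZl _ (measurableTypeR R) R _ _ measurableT c (EFin \o levy_kernel b t) (ilk t)).
  - move=> n s; rewrite /rho /pareto_dens levy_kernelE indicE.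
    case: ifPn => s0.
      rewrite ger0_norm; last first.
        by rewrite !mulr_ge0 ?powR_ge0 ?subr_ge0 ?gauss_le1// ltW.
      rewrite -!mulrA ler_wpM2l ?(ltW c0)// ler_piMl ?mulr_ge0 ?powR_ge0 ?subr_ge0 ?gauss_le1 ?(ltW s0)//.
      by case: (_ \in _).
    rewrite memNset ?mul0r ?mulr0 ?mul0r ?normr0//= in_itv/= andbT.
    by apply/negP; rewrite -ltNge (le_lt_trans _ (en n))// leNgt.
(* The factor [expR (- m n)] turns the exponential of the mixture into the exponential of minus the
   truncated exponent, which is at most 1 and converges. *)
apply: (@cos_transform_nonincreasing_lim _ (fun n t => expR (- m n) * expR (gauss_mixture (rho n) t)) _ 1).
- move=> n; apply: measurable_funM => //; apply: measurableT_comp; first exact: measurable_expR.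
  by apply: measurable_gauss_mixture; [exact: irho|exact: rho0].
- move=> n t; rewrite -expRD ger0_norm ?expR_ge0// expR_le1 addrC subr_le0.
  by apply: gauss_mixture_le; [exact: irho|exact: rho0|exact: rhoN].
- move=> t; under eq_fun do rewrite -expRD.
  have h : (- m n + gauss_mixture (rho n) t) @[n --> \oo] --> - (`|t| `^ alpha).
    by under eq_fun do rewrite addrC -opprB; apply: cvgN; exact: lim.
  have h2 := @continuous_expR R (- (`|t| `^ alpha)).
  exact: (cvg_comp (fun n => - m n + gauss_mixture (rho n) t) expR h h2).
- move=> n; apply: (cos_transform_nonincreasingZ (K := expR (m n))).
  + apply: measurableT_comp; first exact: measurable_expR.
    by apply: measurable_gauss_mixture; [exact: irho|exact: rho0].
  + move=> t; rewrite ger0_norm ?expR_ge0// ler_expR.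
    by apply: gauss_mixture_le; [exact: irho|exact: rho0|exact: rhoN].
  + exact: expR_ge0.
  + by apply: cos_transform_nonincreasing_expR_mix; [exact: irho|exact: rho0|exact: rhoN].
Unshelve. all: by end_near. Qed.

(** * The stable density *)

Lemma integrable_pareto_densN (R : realType) (e b : R) : 0 < e -> 0 < b ->
  (@lebesgue_measure R).-integrable setT (EFin \o (fun t => pareto_dens e b (- t))).
Proof.
move=> e0 b0; apply: (@integrable_ge0 _ (measurableTypeR R)).
- by apply: measurableT_comp; [exact: measurable_pareto_dens|exact: oppr_measurable].
- by move=> x; exact: pareto_dens_ge0.
- rewrite (@ge0_integral_opp R (fun t => (pareto_dens e b t)%:E)).
  + by rewrite integral_pareto_dens// ltry.
  + by apply/measurable_EFinP; exact: measurable_pareto_dens.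
  + by move=> x; rewrite lee_fin pareto_dens_ge0.
Qed.

Lemma integrable_indic_itvcc (R : realType) (a b : R) :
  (@lebesgue_measure R).-integrable setT (EFin \o (\1_(`[a, b]%classic : set R))).
Proof.
exact: integrable_indic_itv.
Qed.

Lemma pareto_dens1E (R : realType) (b s : R) : 1 <= s -> pareto_dens 1 b s = s `^ (- (1 + b)).
Proof. by move=> s1; rewrite /pareto_dens indicE mem_set ?mul1r//= in_itv/= s1. Qed.

Lemma integrable_stable_cf (R : realType) (alpha : R) : 0 < alpha ->
  (@lebesgue_measure R).-integrable setT (EFin \o stable_cf alpha).
Proof.
move=> a0.
(* With (n+1) alpha >= 2, the term of index n+1 in the exponential series of |t|^alpha already
   dominates t^2, so that [stable_cf] decays at least like t^(-2). *)
pose n := Num.truncn (2 / alpha).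
have n2 : 2 <= n.+1%:R * alpha.
  by rewrite -ler_pdivrMr// ltW// truncnS_gt.
pose K := n.+1`!%:R : R.
have i1 := integrable_indic_itvcc (-1 : R) 1.
have i2 := @integrable_pareto_dens R 1 1 ltr01 ltr01.
have i3 := @integrable_pareto_densN R 1 1 ltr01 ltr01.
have i4 := @integrableD _ (measurableTypeR R) R _ _ measurableT _ _ i2 i3.
have i5 := @integrableZl _ (measurableTypeR R) R _ _ measurableT K _ i4.
have i6 := @integrableD _ (measurableTypeR R) R _ _ measurableT _ _ i1 i5.
apply: (@le_integrable _ (measurableTypeR R) R _ _ measurableT _ _ _ _ i6).
- by apply/measurable_EFinP; exact: measurable_stable_cf.
- move=> t _ /=; rewrite lee_fin ger0_norm ?(ltW (stable_cf_gt0 _ _))//.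
  apply: le_trans (ler_norm _).
  have p1 := pareto_dens_ge0 1 1 t; have p2 := pareto_dens_ge0 1 1 (- t).
  have [t1|t1] := leP `|t| 1.
    rewrite indicE mem_set/=; last by rewrite in_itv/= -ler_norml.
    by rewrite (le_trans (stable_cf_le1 _ _))// lerDl mulr_ge0// addr_ge0.
  apply: ler_wpDl; first by [].
  have H : stable_cf alpha t <= K * `|t| `^ (- (1 + 1)).
    have t0 : 0 < `|t| by apply: lt_trans t1.
    rewrite /stable_cf expRN powRN -[K]invrK -invfM lef_pV2 ?posrE ?expR_gt0 ?mulr_gt0 ?invr_gt0 ?powR_gt0//; last first.
      by rewrite /K ltr0n fact_gt0.
    apply: le_trans (_ : 1 + (`|t| `^ alpha) ^+ n.+1 / K <= _); last first.
      by apply: expR_ge1Dxn; exact: powR_ge0.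
    apply: ler_wpDl => //; rewrite mulrC ler_wpM2r ?invr_ge0//.
    rewrite -powR_mulrn ?powR_ge0// -powRrM; apply: ler_powR; first exact: ltW.
    by rewrite mulrC.
  apply: le_trans H _; rewrite ler_wpM2l//.
  have [t0|t0] := leP 0 t.
    rewrite ger0_norm// in t1 *.
    by rewrite -(pareto_dens1E _ (ltW t1)) lerDl.
  rewrite ltr0_norm// in t1 *.
  by rewrite -(pareto_dens1E _ (ltW t1)) lerDr.
Qed.

(** Fourier inversion formula; only the cosine appears because [stable_cf] is even. *)
Definition stable_dens (R : realType) (alpha x : R) : R :=
  (2 * pi)^-1 * \int[@lebesgue_measure R]_t (cos (x * t) * stable_cf alpha t).

(* The density after convolution with a centred Gaussian of variance [2 v]. *)
Definition stable_dens_smooth (R : realType) (alpha v x : R) : R :=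
  (2 * pi)^-1 * \int[@lebesgue_measure R]_t (cos (x * t) * (stable_cf alpha t * gauss v t)).

Lemma cvg_stable_dens_smooth (R : realType) (alpha : R) (v : nat -> R) x : 0 < alpha ->
  (forall n, 0 <= v n) -> v n @[n --> \oo] --> (0 : R) ->
  stable_dens_smooth alpha (v n) x @[n --> \oo] --> stable_dens alpha x.
Proof.
move=> a0 v0 vl; apply: cvgM; first exact: cvg_cst.
apply: (@Rintegral_dominated_cvg _ (measurableTypeR R) R _ _ _ (stable_cf alpha)).
- move=> n; apply: measurable_funM; first exact: measurable_cosM.
  by apply: measurable_funM; [exact: measurable_stable_cf|exact: measurable_gauss].
- move=> t; apply: cvgM; first exact: cvg_cst.
  rewrite -[X in _ --> X]mulr1; apply: cvgM; first exact: cvg_cst.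
  have h : - (v n * t ^+ 2) @[n --> \oo] --> (0 : R).
    by rewrite -oppr0 -(mul0r (t ^+ 2)); apply: cvgN; apply: cvgM => //; exact: cvg_cst.
  have h2 := @continuous_expR R 0; rewrite /continuous_at expR0 in h2.
  exact: (cvg_comp (fun n => - (v n * t ^+ 2)) expR h h2).
- exact: integrable_stable_cf.
- move=> n t; rewrite !normrM (ger0_norm (ltW (stable_cf_gt0 _ _))) (ger0_norm (ltW (gauss_gt0 _ _))).
  rewrite mulrCA ler_piMr ?(ltW (stable_cf_gt0 _ _))// -[1]mulr1 ler_pM ?norm_cos_le1//.
    by rewrite ltW// gauss_gt0.
  exact: gauss_le1.
Qed.

Lemma norm_stable_dens_smooth_le (R : realType) (alpha v x : R) : 0 < alpha -> 0 <= v ->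
  `|\int[@lebesgue_measure R]_t (cos (x * t) * (stable_cf alpha t * gauss v t))| <= 
  \int[@lebesgue_measure R]_t stable_cf alpha t.
Proof.
move=> a0 v0.
have H t : `|cos (x * t) * (stable_cf alpha t * gauss v t)| <= stable_cf alpha t.
  rewrite !normrM (ger0_norm (ltW (stable_cf_gt0 _ _))) (ger0_norm (ltW (gauss_gt0 _ _))).
  rewrite mulrCA ler_piMr ?(ltW (stable_cf_gt0 _ _))// -[1]mulr1 ler_pM ?norm_cos_le1//.
    by rewrite ltW// gauss_gt0.
  exact: gauss_le1.
have m : measurable_fun [set: measurableTypeR R] (fun t => cos (x * t) * (stable_cf alpha t * gauss v t)).
  apply: measurable_funM; first exact: measurable_cosM.
  by apply: measurable_funM; [exact: measurable_stable_cf|exact: measurable_gauss].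
have i1 : (@lebesgue_measure R).-integrable setT (EFin \o (fun t => cos (x * t) * (stable_cf alpha t * gauss v t))).
  apply: (@le_integrable _ (measurableTypeR R) R _ _ measurableT _ (EFin \o stable_cf alpha)).
  - exact/measurable_EFinP.
  - by move=> t _ /=; rewrite lee_fin (le_trans (H t))// ler_norm.
  - exact: integrable_stable_cf.
apply: le_trans (le_normr_Rintegral _ i1) _ => //.
apply: le_Rintegral => //.
- exact: (integrable_norm i1).
- exact: integrable_stable_cf.
Qed.

Section stable_law.
Context (R : realType) d (T : measurableType d) (P : probability T R) (alpha : R).
Context (Y : {RV P >-> R}).
Hypothesis alpha0 : 0 < alpha.
Hypothesis hY : has_law_stable P alpha Y.

Lemma stable_law_cos t : \int[P]_w cos (t * Y w) = stable_cf alpha t.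
Proof. by have := hY t; rewrite /expect_cis => -[]. Qed.

Lemma stable_law_sin t : \int[P]_w sin (t * Y w) = 0.
Proof. by have := hY t; rewrite /expect_cis => -[]. Qed.

Let mY : measurable_fun setT (Y : T -> R).
Proof. exact: measurable_funPT. Qed.

Lemma measurable_fun_cos : measurable_fun [set: R] (@cos R).
Proof. by apply: continuous_measurable_fun; exact: continuous_cos. Qed.

Lemma measurable_fun_sin : measurable_fun [set: R] (@sin R).
Proof. by apply: continuous_measurable_fun; exact: continuous_sin. Qed.

Lemma integrable_bounded_prob (g : T -> R) (K : R) : measurable_fun setT g ->
  (forall w, `|g w| <= K) -> P.-integrable setT (EFin \o g).
Proof.
move=> mg gK.
apply: (@le_integrable _ _ _ P _ measurableT _ (EFin \o cst K)).
- exact/measurable_EFinP.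
- by move=> w _ /=; rewrite lee_fin (le_trans (gK w))// ler_norm.
- exact: finite_measure_integrable_cst.
Qed.

Lemma stable_law_cosB x t : \int[P]_w cos ((x - Y w) * t) = cos (x * t) * stable_cf alpha t.
Proof.
have mt : measurable_fun setT (fun w => t * Y w) by exact: measurable_funM.
have ic : P.-integrable setT (EFin \o (fun w => cos (t * Y w))).
  apply: (@integrable_bounded_prob _ 1); last by move=> w; exact: norm_cos_le1.
  by apply: (measurableT_comp (f := cos)) => //; exact: measurable_fun_cos.
have iS : P.-integrable setT (EFin \o (fun w => sin (t * Y w))).
  apply: (@integrable_bounded_prob _ 1); last by move=> w; exact: norm_sin_le1.
  by apply: (measurableT_comp (f := sin)) => //; exact: measurable_fun_sin.
transitivity (\int[P]_w (cos (x * t) * cos (t * Y w) + sin (x * t) * sin (t * Y w))).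
  by apply: eq_Rintegral => w _; rewrite mulrBl cosB [Y w * t]mulrC.
rewrite RintegralD//.
- by rewrite !RintegralZl// stable_law_cos stable_law_sin mulr0 addr0.
- exact: (@integrableZl _ _ R P _ measurableT (cos (x * t)) _ ic).
- exact: (@integrableZl _ _ R P _ measurableT (sin (x * t)) _ iS).
Qed.

(** Parseval identity: both sides are iterated integrals of [cos ((x - Y w) * t) * gauss v t], and
    the Gaussian factor makes Fubini applicable. *)
Lemma stable_law_smooth v x : 0 < v ->
  \int[P]_w (Num.sqrt (pi / v) * gauss (4 * v)^-1 (x - Y w)) =
  \int[@lebesgue_measure R]_t (cos (x * t) * (stable_cf alpha t * gauss v t)).
Proof.
move=> v0.
pose F (p : T * measurableTypeR R) := cos ((x - Y p.1) * p.2) * gauss v p.2.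
have mF : measurable_fun setT F.
  apply: measurable_funM.
    apply: measurableT_comp; first exact: measurable_fun_cos.
    apply: measurable_funM; last exact: measurable_snd.
    apply: measurable_funB => //.
    by apply: measurableT_comp; [exact: mY|exact: measurable_fst].
  by apply: measurableT_comp; [exact: measurable_gauss|exact: measurable_snd].
have iF : (P \x (@lebesgue_measure R))%E.-integrable setT (EFin \o F).
  apply: (@le_integrable _ _ R _ _ measurableT _ (EFin \o (fun p : T * measurableTypeR R => cst 1 p.1 * gauss v p.2))).
  - exact/measurable_EFinP.
  - move=> [w t] _ /=; rewrite lee_fin /F/= mul1r normrM ler_piMl//.
    exact: norm_cos_le1.
  - apply: (@integrable_prodM R _ _ T (measurableTypeR R) P _ (cst 1) (gauss v)).
      exact: finite_measure_integrable_cst.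
    exact: integrable_gauss.
have icg y : (@lebesgue_measure R).-integrable setT (EFin \o (fun t => cos (y * t) * gauss v t)).
  exact: integrable_cos_gauss.
have ics t : P.-integrable setT (EFin \o (fun w => cos ((x - Y w) * t))).
  apply: (@integrable_bounded_prob _ 1); last by move=> w; exact: norm_cos_le1.
  apply: (measurableT_comp (f := cos)); first exact: measurable_fun_cos.
  by apply: measurable_funM => //; apply: measurable_funB.
rewrite /Rintegral; congr fine.
transitivity (\int[P]_w \int[@lebesgue_measure R]_t (F (w, t))%:E)%E.
  apply: eq_integral => w _; rewrite -integral_cos_gauss// /Rintegral fineK//.
  exact: (integrable_fin_num _ (icg (x - Y w))).
rewrite (Fubini iF).
apply: eq_integral => t _.
transitivity ((\int[P]_w cos ((x - Y w) * t)) * gauss v t)%:E; last first.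
  by rewrite stable_law_cosB -mulrA.
rewrite EFinM /Rintegral fineK; last exact: (integrable_fin_num _ (ics t)).
transitivity (\int[P]_w ((cos ((x - Y w) * t))%:E * (gauss v t)%:E))%E.
  by apply: eq_integral => w _; rewrite -EFinM.
by rewrite (integralZr measurableT (ics t)).
Qed.

(** The left side averages the density of a centred Gaussian of variance 2v over the law of [Y]. In
    this form the smoothed density is visibly nonnegative and measurable, which the Fourier integral
    hides. *)
Lemma stable_dens_smoothE v x : 0 < v ->
  (\int[P]_w ((2 * pi)^-1 * (Num.sqrt (pi / v) * gauss (4 * v)^-1 (x - Y w)))%:E)%E =
  (stable_dens_smooth alpha v x)%:E.
Proof.
move=> v0.
have i1 : P.-integrable setT (EFin \o (fun w => Num.sqrt (pi / v) * gauss (4 * v)^-1 (x - Y w))).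
  have v4 : 0 <= (4 * v)^-1 by rewrite invr_ge0 mulr_ge0// ltW.
  apply: (@integrable_bounded_prob _ (Num.sqrt (pi / v))).
    apply: measurable_funM => //; apply: (measurableT_comp (f := gauss _)); first exact: measurable_gauss.
    by apply: measurable_funB.
  move=> w; rewrite ger0_norm ?mulr_ge0 ?expR_ge0 ?sqrtr_ge0//.
  by rewrite ler_piMr ?sqrtr_ge0 ?gauss_le1.
under eq_integral => w _ do rewrite EFinM.
rewrite integralZl// -[(\int[_]_x _)%E]fineK; last exact: (integrable_fin_num _ i1).
by rewrite -EFinM -[fine _]/(\int[P]_w _) stable_law_smooth.
Qed.

Lemma stable_dens_smooth_ge0 v x : 0 < v -> 0 <= stable_dens_smooth alpha v x.
Proof.
move=> v0; rewrite -lee_fin -stable_dens_smoothE//; apply: integral_ge0 => w _.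
by rewrite lee_fin mulr_ge0 ?invr_ge0 ?mulr_ge0 ?pi_ge0 ?sqrtr_ge0 ?expR_ge0.
Qed.

(** An atom of mass [p] at [y] would make the smoothed integral at [y] at least
    [Num.sqrt (pi / v) * p], whereas it is bounded by the integral of [stable_cf] uniformly in
    [v]. *)
Lemma stable_law_set1 y : P (Y @^-1` [set y]) = 0%E.
Proof.
have mS : measurable (Y @^-1` [set y]).
  by rewrite -[X in measurable X]setTI; exact: mY.
pose I := \int[@lebesgue_measure R]_t stable_cf alpha t.
have I0 : 0 <= I by apply: Rintegral_ge0 => t _; exact/ltW/stable_cf_gt0.
pose p := fine (P (Y @^-1` [set y])).
have pE : P (Y @^-1` [set y]) = p%:E by rewrite fineK// fin_num_measure.
have p0 : 0 <= p by rewrite fine_ge0.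
have H v : 0 < v -> Num.sqrt (pi / v) * p <= I.
  move=> v0.
  have v4 : 0 <= (4 * v)^-1 by rewrite invr_ge0 mulr_ge0// ltW.
  have i1 : P.-integrable setT (EFin \o (\1_(Y @^-1` [set y]) : T -> R)).
    by apply: integrable_indic => //; rewrite -ge0_fin_numE// fin_num_measure.
  apply: (@le_trans _ _ (\int[P]_w (Num.sqrt (pi / v) * gauss (4 * v)^-1 (y - Y w)))); last first.
    rewrite stable_law_smooth//; apply: le_trans (ler_norm _) _.
    by apply: norm_stable_dens_smooth_le => //; exact: ltW.
  apply: (@le_trans _ _ (\int[P]_w (Num.sqrt (pi / v) * \1_(Y @^-1` [set y]) w))).
    by rewrite RintegralZl// /Rintegral integral_indic// setIT.
  apply: le_Rintegral => //.
  - exact: (@integrableZl _ _ R P _ measurableT (Num.sqrt (pi / v)) _ i1).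
  - apply: (@integrable_bounded_prob _ (Num.sqrt (pi / v))).
      apply: measurable_funM => //; apply: (measurableT_comp (f := gauss _)); first exact: measurable_gauss.
      by apply: measurable_funB.
    move=> w; rewrite ger0_norm ?mulr_ge0 ?expR_ge0 ?sqrtr_ge0//.
    by rewrite ler_piMr ?sqrtr_ge0 ?gauss_le1.
  - move=> w _; rewrite ler_wpM2l ?sqrtr_ge0// indicE.
    have [|_] := boolP (w \in _); last by rewrite expR_ge0.
    by rewrite inE/= => ->; rewrite /gauss subrr expr0n/= mulr0 oppr0 expR0.
rewrite pE; congr (_%:E); apply/eqP; rewrite eq_le p0 andbT leNgt; apply/negP => p1.
(* At [v = pi / k ^+ 2] the factor [Num.sqrt (pi / v)] equals [k], and [k * p = I + p] exceeds
   [I]. *)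
pose k := I / p + 1.
have k0 : 0 < k by rewrite ltr_wpDl// divr_ge0.
have := H (pi / k ^+ 2).
rewrite divr_gt0 ?pi_gt0 ?exprn_gt0// => /(_ isT).
rewrite invf_div mulrCA divff ?gt_eqF ?pi_gt0// mulr1 sqrtr_sqr ger0_norm ?(ltW k0)//.
by rewrite /k mulrDl mul1r divfK ?gt_eqF// gerDl leNgt p1.
Qed.

(* Smooth the law by a Gaussian whose variance tends to 0; the indicator of the
   interval converges except at its end points, which are not atoms. *)
Lemma stable_law_open_itv a b :
  P (Y @^-1` `]a, b[) = (\int[@lebesgue_measure R]_(x in `]a, b[) (stable_dens alpha x)%:E)%E.
Proof.
pose I1 : R -> R := \1_(`]a, b[%classic : set R).
pose c (n : nat) : R := n.+1%:R.
(* Chosen so that [(4 * v n)^-1 = c n ^+ 2]: the smoothing kernel becomes the normalised [gauss 1]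
   rescaled by [c n]. *)
pose v n : R := (4 * c n ^+ 2)^-1.
have v0 n : 0 < v n by rewrite /v invr_gt0 mulr_gt0// exprn_gt0.
pose q n z := (2 * pi)^-1 * (Num.sqrt (pi / v n) * gauss (4 * v n)^-1 z).
have sp0 : 0 < Num.sqrt (pi : R) by rewrite sqrtr_gt0 pi_gt0.
have qE n z : q n z = c n * ((Num.sqrt pi)^-1 * gauss 1 (c n * z)).
  rewrite /q /v.
  have -> : (4 * (4 * c n ^+ 2)^-1)^-1 = c n ^+ 2.
    by rewrite invfM invrK mulrA mulVf// mul1r.
  rewrite /gauss mul1r exprMn invrK sqrtrM ?pi_ge0//.
  have -> : Num.sqrt (4 * c n ^+ 2) = 2 * c n.
    rewrite (_ : 4 * _ = (2 * c n) ^+ 2); last by ring.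
    by rewrite sqrtr_sqr ger0_norm// mulr_ge0// ltW.
  have E : pi = Num.sqrt (pi : R) * Num.sqrt pi by rewrite -expr2 sqr_sqrtr// pi_ge0.
  by rewrite {1}E; field; rewrite gt_eqF.
have q0 n z : 0 <= q n z by rewrite qE !mulr_ge0 ?expR_ge0 ?invr_ge0 ?(ltW sp0)// ltW.
have mq n : measurable_fun setT (q n).
  by apply: measurable_funM => //; apply: measurable_funM => //; exact: measurable_gauss.
have mI1 : measurable_fun setT I1 by exact: measurable_indic.
have I10 x : 0 <= I1 x by [].
have I11 x : I1 x <= 1 by rewrite /I1 indicE; case: (_ \in _).
pose F n (p : T * measurableTypeR R) := I1 p.2 * q n (p.2 - Y p.1).
have mF n : measurable_fun setT (F n).
  apply: measurable_funM; first by apply: measurableT_comp => //; exact: measurable_snd.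
  apply: (measurableT_comp (f := q n)) => //.
  apply: measurable_funB; first exact: measurable_snd.
  by apply: measurableT_comp; [exact: mY|exact: measurable_fst].
have F0 n p : 0 <= F n p by rewrite mulr_ge0.
(* The smoothed indicator at [y], with the noise rescaled so that [n] occurs only inside the
   indicator; dominated convergence then applies. *)
pose h n y := (\int[@lebesgue_measure R]_u (I1 (y + (c n)^-1 * u)%R * ((Num.sqrt pi)^-1 * gauss 1 u))%:E)%E.
have hE n y : (\int[@lebesgue_measure R]_x (I1 x * q n (x - y))%:E)%E = h n y.
  transitivity (\int[@lebesgue_measure R]_z (I1 (y + z) * q n z)%:E)%E.
    rewrite -(@ge0_integral_shift R y (fun x => (I1 x * q n (x - y))%:E)).
    - by apply: eq_integral => z _; rewrite addrAC subrr add0r.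
    - apply/measurable_EFinP; apply: measurable_funM => //.
      by apply: (measurableT_comp (f := q n)) => //; exact: measurable_funB.
    - by move=> x; rewrite lee_fin mulr_ge0.
  have cV : 0 < (c n)^-1 by rewrite invr_gt0.
  have := @ge0_integral_scale R (c n)^-1 (fun z => (I1 (y + z) * q n z)%:E) cV.
  rewrite invrK => H.
  have {}H : (\int[@lebesgue_measure R]_x (I1 (y + (c n)^-1 * x) * q n ((c n)^-1 * x))%:E = (c n)%:E * \int[@lebesgue_measure R]_x (I1 (y + x) * q n x)%:E)%E.
    apply: H; last by move=> x; rewrite lee_fin mulr_ge0.
    apply/measurable_EFinP; apply: measurable_funM => //.
    by apply: (measurableT_comp (f := I1)) => //; exact: measurable_funD.
  have Hc : forall X : \bar R, (X = ((c n)^-1)%:E * ((c n)%:E * X))%E.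
    by move=> X; rewrite muleA -EFinM mulVf ?mul1e// gt_eqF.
  rewrite [LHS]Hc -H -ge0_integralZl//.
  - apply: eq_integral => u _; rewrite -EFinM qE; congr (_%:E).
    by rewrite mulrA (mulrA (c n)) mulfV ?gt_eqF// mul1r; field; rewrite !gt_eqF.
  - apply/measurable_EFinP; apply: measurable_funM.
      by apply: (measurableT_comp (f := I1)) => //; apply: measurable_funD => //; exact: measurable_funM.
    by apply: (measurableT_comp (f := q n)) => //; exact: measurable_funM.
  - by move=> u _; rewrite lee_fin mulr_ge0.
  - by rewrite lee_fin ltW.
have ig : (\int[@lebesgue_measure R]_u ((Num.sqrt pi)^-1 * gauss 1 u)%:E = 1)%E.
  under eq_integral do rewrite EFinM.
  rewrite integralZl//; last exact: integrable_gauss.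
  by rewrite integral_gauss// divr1 -EFinM mulVf// gt_eqF.
have igg : (@lebesgue_measure R).-integrable setT (EFin \o (fun u => (Num.sqrt pi)^-1 * gauss 1 u)).
  exact: (@integrableZl _ (measurableTypeR R) R _ _ measurableT (Num.sqrt pi)^-1 _ (integrable_gauss ltr01)).
have g10 u : 0 <= (Num.sqrt pi)^-1 * gauss 1 u :> R.
  by rewrite mulr_ge0 ?expR_ge0 ?invr_ge0 ?ltW.
have mgg : measurable_fun setT (fun u : R => (Num.sqrt pi)^-1 * gauss 1 u).
  by apply: measurable_funM => //; exact: measurable_gauss.
have mIc n y : measurable_fun [set: measurableTypeR R] (fun u => I1 (y + (c n)^-1 * u)).
  by apply: (measurableT_comp (f := I1)) => //; apply: measurable_funD => //; exact: measurable_funM.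
have h0 n y : (0 <= h n y)%E by apply: integral_ge0 => u _; rewrite lee_fin mulr_ge0.
have h1 n y : (h n y <= 1)%E.
  rewrite -ig; apply: ge0_le_integral => //.
  - by move=> u _; rewrite lee_fin mulr_ge0.
  - by apply/measurable_EFinP; exact: measurable_funM.
  - exact/measurable_EFinP.
  - by move=> u _; rewrite lee_fin ler_piMl.
have cc : (c n)^-1 @[n --> \oo] --> (0 : R) by exact: cvg_harmonic.
have hlim y : y != a -> y != b -> h n y @[n --> \oo] --> (I1 y)%:E.
  move=> ya yb.
  have -> : (I1 y)%:E = (\int[@lebesgue_measure R]_u (I1 y * ((Num.sqrt pi)^-1 * gauss 1 u))%:E)%E.
    under eq_integral do rewrite EFinM.
    by rewrite integralZl// ig mule1.
  apply: (@real_dominated_cvg _ (measurableTypeR R) R _ _ _ (fun u => (Num.sqrt pi)^-1 * gauss 1 u)) => //.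
  - by move=> n; exact: measurable_funM.
  - move=> u; apply: cvgM; last exact: cvg_cst.
    apply: cvg_near_cst.
    have yu : y + (c n)^-1 * u @[n --> \oo] --> y.
      rewrite -[X in _ --> X]addr0; apply: cvgD; first exact: cvg_cst.
      by rewrite -(mul0r u); apply: cvgM => //; exact: cvg_cst.
    have [/andP[ay yb']|nI] := boolP (a < y < b).
      near=> n; rewrite /I1 !indicE !mem_set//= in_itv/= ?ay ?yb'//.
      by apply/andP; split; near: n; [apply: (cvgr_gt _ yu)|apply: (cvgr_lt _ yu)].
    have Iy : I1 y = 0 by rewrite /I1 indicE memNset//= in_itv/=; exact/negP.
    rewrite Iy; have [ay|ay] := ltP a y.
      have by' : b < y by rewrite lt_neqAle eq_sym yb leNgt; move: nI; rewrite ay.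
      near=> n; rewrite /I1 indicE memNset//= in_itv/=; apply/negP; rewrite negb_and -!leNgt.
      by apply/orP; right; apply: ltW; near: n; apply: (cvgr_gt _ yu).
    have ya' : y < a by rewrite lt_neqAle ya.
    near=> n; rewrite /I1 indicE memNset//= in_itv/=; apply/negP; rewrite negb_and -!leNgt.
    by apply/orP; left; apply: ltW; near: n; apply: (cvgr_lt _ yu).
  - by move=> n u; rewrite normrM (ger0_norm (I10 _)) (ger0_norm (g10 _)) ler_piMl.
have hF n w : h n (Y w) = (\int[@lebesgue_measure R]_x (F n (w, x))%:E)%E by rewrite -hE.
have mhY n : measurable_fun setT (fun w => h n (Y w)).
  under eq_fun do rewrite hF.
  apply: (@measurable_fun_fubini_tonelli_F _ _ T (measurableTypeR R) R (@lebesgue_measure R) (EFin \o F n)).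
    exact/measurable_EFinP.
  by move=> p; rewrite lee_fin.
have L1 : (\int[P]_w h n (Y w))%E @[n --> \oo] --> (\int[P]_w (I1 (Y w))%:E)%E.
  have [|||||_ _] := @dominated_convergence _ T R P setT measurableT (fun n w => h n (Y w)) (fun w => (I1 (Y w))%:E) (cst 1%E).
  - exact: mhY.
  - by apply/measurable_EFinP; apply: measurableT_comp.
  - exists (Y @^-1` [set a] `|` Y @^-1` [set b]); split.
    + apply: measurableU.
        by rewrite -[X in measurable X]setTI; exact: mY.
      by rewrite -[X in measurable X]setTI; exact: mY.
    + apply: null_set_setU => //.
      * exact: stable_law_set1.
      * exact: stable_law_set1.
    + move=> w /= nc; apply: contrapT => /not_orP[/eqP ya /eqP yb].
      by apply: nc => _; exact: hlim.
  - exact: finite_measure_integrable_cst.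
  - by apply: aeW => w n _; rewrite gee0_abs.
  - by [].
(* Tonelli: integrating the same double integral over the law first produces the smoothed density.
   [L1] and [L3] are the limits of the two readings. *)
have L2 n : (\int[P]_w h n (Y w) = \int[@lebesgue_measure R]_x (I1 x * stable_dens_smooth alpha (v n) x)%:E)%E.
  under eq_integral => w _ do rewrite hF.
  rewrite (fubini_tonelli (m1 := P) (m2 := @lebesgue_measure R) (EFin \o F n)).
  - apply: eq_integral => x _; rewrite EFinM -stable_dens_smoothE// -ge0_integralZl//.
    + by apply: measurableT_comp => //; apply: (measurableT_comp (f := q n)) => //; exact: measurable_funB.
    + by move=> w _; rewrite lee_fin q0.
    + by rewrite lee_fin.
  - exact/measurable_EFinP.
  - by move=> p; rewrite lee_fin.
have msd n : measurable_fun setT (stable_dens_smooth alpha (v n)).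
  apply/measurable_EFinP.
  rewrite (_ : _ \o _ = (fun x => \int[P]_w (q n (x - Y w))%:E)%E); last first.
    by apply/funext => x; rewrite /= -stable_dens_smoothE.
  apply: (@measurable_fun_fubini_tonelli_F _ _ (measurableTypeR R) T R P (fun p => (q n (p.1 - Y p.2))%:E)).
    apply/measurable_EFinP; apply: (measurableT_comp (f := q n)) => //.
    apply: measurable_funB; first exact: measurable_fst.
    by apply: measurableT_comp; [exact: mY|exact: measurable_snd].
  by move=> p; rewrite lee_fin.
have vlim : v n @[n --> \oo] --> (0 : R).
  rewrite (_ : v = fun n => 4^-1 * ((c n)^-1 * (c n)^-1)); last first.
    by apply/funext => n; rewrite /v !invfM.
  rewrite -(mulr0 4^-1); apply: cvgM; first exact: cvg_cst.
  by rewrite -(mulr0 0); apply: cvgM.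
pose I := \int[@lebesgue_measure R]_t stable_cf alpha t.
have L3 : (\int[@lebesgue_measure R]_x (I1 x * stable_dens_smooth alpha (v n) x)%:E)%E @[n --> \oo] -->
   (\int[@lebesgue_measure R]_x (I1 x * stable_dens alpha x)%:E)%E.
  apply: (@real_dominated_cvg _ (measurableTypeR R) R _ _ _ (fun x => ((2 * pi)^-1 * I) * I1 x)).
  - by move=> n; apply: measurable_funM; [exact: mI1|exact: msd].
  - move=> x; apply: cvgM; first exact: cvg_cst.
    by apply: cvg_stable_dens_smooth => // n; exact: ltW.
  - apply: (@integrableZl _ (measurableTypeR R) R _ _ measurableT ((2 * pi)^-1 * I) (EFin \o I1)).
    exact: integrable_indic_itv.
  - move=> n x; rewrite normrM (ger0_norm (I10 x)) mulrC ler_wpM2r//.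
    rewrite normrM ger0_norm ?invr_ge0 ?mulr_ge0 ?pi_ge0// ler_wpM2l ?invr_ge0 ?mulr_ge0 ?pi_ge0//.
    by apply: norm_stable_dens_smooth_le => //; exact: ltW.
transitivity (\int[P]_w (I1 (Y w))%:E)%E.
  have mi : measurable (Y @^-1` `]a, b[%classic).
    by rewrite -[X in measurable X]setTI; apply: mY => //; exact: measurable_itv.
  transitivity (\int[P]_w (\1_(Y @^-1` `]a, b[%classic) w)%:E)%E.
    by rewrite integral_indic ?setIT.
  by apply: eq_integral => w _; rewrite /I1 !indicE.
transitivity (\int[@lebesgue_measure R]_x (I1 x * stable_dens alpha x)%:E)%E.
  rewrite -(cvg_lim _ L1)//; apply: cvg_lim => //.
  by under eq_fun do rewrite L2.
rewrite [RHS]integral_mkcond; apply: eq_integral => x _.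
by rewrite restrict_EFin patch_indic /= mulrC.
Unshelve. all: by end_near. Qed.

Lemma measurable_stable_dens : measurable_fun setT (stable_dens alpha).
Proof.
pose v (n : nat) : R := n.+1%:R^-1.
have v0 n : 0 < v n by rewrite invr_gt0.
have v1 : v n @[n --> \oo] --> (0 : R) by exact: cvg_harmonic.
apply: (@measurable_fun_cvg _ _ _ _ (fun n => stable_dens_smooth alpha (v n))); last first.
  by move=> x _; apply: cvg_stable_dens_smooth => // n; exact: ltW.
move=> n; apply/measurable_EFinP.
pose q z := (2 * pi)^-1 * (Num.sqrt (pi / v n) * gauss (4 * v n)^-1 z).
rewrite (_ : _ \o _ = (fun x => \int[P]_w (q (x - Y w))%:E)%E); last first.
  by apply/funext => x; rewrite /= -stable_dens_smoothE.
have mq : measurable_fun setT q.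
  by apply: measurable_funM => //; apply: measurable_funM => //; exact: measurable_gauss.
apply: (@measurable_fun_fubini_tonelli_F _ _ (measurableTypeR R) T R P (fun p => (q (p.1 - Y p.2))%:E)).
  apply/measurable_EFinP; apply: (measurableT_comp (f := q)) => //.
  apply: measurable_funB; first exact: measurable_fst.
  by apply: measurableT_comp; [exact: mY|exact: measurable_snd].
by move=> p; rewrite lee_fin /q mulr_ge0 ?invr_ge0 ?mulr_ge0 ?pi_ge0 ?sqrtr_ge0 ?expR_ge0.
Qed.

Lemma stable_dens_ge0 x : 0 <= stable_dens alpha x.
Proof.
pose v (n : nat) : R := n.+1%:R^-1.
have v0 n : 0 < v n by rewrite invr_gt0.
have v1 : v n @[n --> \oo] --> (0 : R) by exact: cvg_harmonic.
have H : stable_dens_smooth alpha (v n) x @[n --> \oo] --> stable_dens alpha x.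
  by apply: cvg_stable_dens_smooth => // n; exact: ltW.
rewrite -(cvg_lim _ H)//; apply: limr_ge; first by apply/cvg_ex; eexists; exact: H.
by apply: nearW => n; exact: stable_dens_smooth_ge0.
Qed.

End stable_law.

(** Monotonicity holds for every smoothed density and passes to the pointwise limit. *)
Lemma stable_dens_nonincreasing (R : realType) (alpha x y : R) : 0 < alpha -> alpha < 2 ->
  0 <= x -> x <= y -> stable_dens alpha y <= stable_dens alpha x.
Proof.
move=> a0 a2 x0 xy.
pose v (n : nat) : R := n.+1%:R^-1.
have v0 n : 0 < v n by rewrite invr_gt0.
have v1 : v n @[n --> \oo] --> (0 : R) by exact: cvg_harmonic.
have H z : stable_dens_smooth alpha (v n) z @[n --> \oo] --> stable_dens alpha z.
  by apply: cvg_stable_dens_smooth => // n; exact: ltW.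
rewrite -(cvg_lim _ (H x))// -(cvg_lim _ (H y))//.
apply: ler_lim; [by apply/cvg_ex; eexists; exact: H|by apply/cvg_ex; eexists; exact: H|].
apply: nearW => n; rewrite ler_wpM2l ?invr_ge0 ?mulr_ge0 ?pi_ge0//.
by apply: cos_transform_nonincreasing_stable.
Qed.

Lemma stable_densN (R : realType) (alpha x : R) : stable_dens alpha (- x) = stable_dens alpha x.
Proof. by congr (_ * _); apply: eq_Rintegral => t _; rewrite mulNr cosN. Qed.

(** * From intervals to Borel sets *)

Section density_measure.
Local Open Scope ereal_scope.
Context d (T : measurableType d) (R : realType) (mu : {measure set T -> \bar R}).

(** Registered as a measure so that uniqueness of measures on generating classes can identify it
    with the law of a variable or of a pair. *)
Definition density_measure (f : T -> \bar R) of measurable_fun setT f & (forall x, 0 <= f x) :=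
  fun A : set T => \int[mu]_(x in A) f x.

Context (f : T -> \bar R) (mf : measurable_fun setT f) (f0 : forall x, 0 <= f x).

Let density0 : density_measure mf f0 set0 = 0.
Proof. by rewrite /density_measure integral_set0. Qed.

Let density_ge0 A : 0 <= density_measure mf f0 A.
Proof. exact: integral_ge0. Qed.

Let density_sigma_additive : semi_sigma_additive (density_measure mf f0).
Proof.
move=> /= A mA tA mUA; rewrite /density_measure ge0_integral_bigcup//; last exact: measurable_funTS.
by apply: is_cvg_ereal_nneg_natsum_cond => n _ _; exact: integral_ge0.
Qed.

HB.instance Definition _ := isMeasure.Build _ _ _
  (density_measure mf f0) density0 density_ge0 density_sigma_additive.

End density_measure.

Section stable_law_borel.
Context (R : realType) d (T : measurableType d) (P : probability T R) (alpha : R).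
Context (Y : {RV P >-> R}).
Hypothesis alpha0 : 0 < alpha.
Hypothesis hY : has_law_stable P alpha Y.

Lemma measurable_stable_densE : measurable_fun [set: measurableTypeR R] (fun x => (stable_dens alpha x)%:E).
Proof. by apply/measurable_EFinP; exact: measurable_stable_dens hY. Qed.

Lemma stable_dens_ge0E (x : measurableTypeR R) : (0 <= (stable_dens alpha x)%:E)%E.
Proof. by rewrite lee_fin; exact: stable_dens_ge0 hY _. Qed.

(** The law of [Y] and the measure with density [stable_dens] agree on half-open intervals, the
    right end point being null for both, hence on all Borel sets. *)
Lemma stable_law A : measurable A ->
  P (Y @^-1` A) = (\int[@lebesgue_measure R]_(x in A) (stable_dens alpha x)%:E)%E.
Proof.
move=> mA.
have mY0 : measurable_fun setT (Y : T -> R) by exact: measurable_funPT.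
have mY : measurable_fun setT (Y : T -> measurableTypeR R) := mY0.
pose m2 := density_measure (@lebesgue_measure R) measurable_stable_densE stable_dens_ge0E.
have oc : forall X, ocitv X -> pushforward P (Y : T -> measurableTypeR R) X = m2 X.
  move=> X [[a b] _ <-] /=; rewrite /pushforward /m2 /density_measure.
  rewrite -integral_itv_bndo_bndc; last first.
    by apply: measurable_funTS; exact: measurable_stable_densE.
  rewrite -(stable_law_open_itv alpha0 hY).
  have [ab|ba] := ltP a b; last first.
    by rewrite !set_itv_ge// bnd_simp -leNgt.
  rewrite -(@setUitv1 _ _ (BRight a) b true)//= preimage_setU measureU//.
  - transitivity (P (Y @^-1` `]a, b[) + 0)%E; last exact: adde0.
    by congr (_ + _)%E; exact: (stable_law_set1 alpha0 hY b).
  - by rewrite -[X in measurable X]setTI; exact: mY.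
  - by apply/seteqP; split => w //= [] /=; rewrite in_itv/= => /andP[_ ?] E; move: E; apply/eqP; rewrite lt_eqF.
apply: (@measure_unique _ R (measurableTypeR R) (@ocitv R) (fun k => `](- k%:R)%R, k%:R]%classic) _ _ _ _ (pushforward P (Y : T -> measurableTypeR R)) m2 oc) => //.
- exact: ocitvI.
- by move=> k; exists (- k%:R, k%:R).
- exact: bigcup_itvT.
- by move=> k; rewrite /pushforward -ge0_fin_numE// fin_num_measure// -[X in measurable X]setTI; exact: mY.
Qed.
End stable_law_borel.

(** * Tail of the stable density *)

Lemma cvg_powR_slope_seq (R : realType) (p : R) :
  ((1 + n.+1%:R^-1) `^ p - 1) * n.+1%:R @[n --> \oo] --> p.
Proof.
have := @is_derive1_powR R p 1 ltr01.
rewrite powR1 mulr1 => -[dp Dp].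
have H : e^-1 *: ((e *: 1 + 1) `^ p - 1 `^ p) @[e --> 0^'] --> p.
  by rewrite -[X in _ --> X]Dp; exact: dp.
move/cvgr_dnbhsP : H => /(_ (fun n => n.+1%:R^-1)) H.
have {}H := H (conj (fun n => _) (@cvg_harmonic R)).
apply: cvg_trans (H _); last by move=> n; rewrite invr_eq0.
apply: near_eq_cvg; near=> n.
by rewrite invrK powR1 /GRing.scale/= mulr1 [_ + 1]addrC mulrC.
Unshelve. all: by end_near. Qed.

Lemma integral_cst_itvco (R : realType) (a b r : R) : a <= b ->
  (\int[@lebesgue_measure R]_(x in `[a, b[) (cst r%:E x) = (r * (b - a))%:E)%E.
Proof.
move=> ab; have E : @lebesgue_measure R `[a, b[%classic = (b - a)%:E.
  rewrite lebesgue_measure_itv/= lte_fin; case: ifPn; first by rewrite EFinB.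
  by rewrite -leNgt => ba; rewrite (le_anti (introT andP (conj ab ba))) subrr.
by rewrite integral_cst// EFinM -E.
Qed.

Section tail.
Context (R : realType) d (T : measurableType d) (P : probability T R) (alpha : R).
Context (Y : {RV P >-> R}) (C : R).
Hypothesis alpha0 : 0 < alpha.
Hypothesis alpha2 : alpha < 2.
Hypothesis hY : has_law_stable P alpha Y.
Hypothesis hC : tail_constant P alpha Y C.

Definition tail (h : R) : R := fine (P [set w | h <= Y w]).

Let mdens := measurable_stable_dens alpha0 hY.

Lemma tailE h : (tail h)%:E = (\int[@lebesgue_measure R]_(x in `[h, +oo[) (stable_dens alpha x)%:E)%E.
Proof.
rewrite -(stable_law alpha0 hY)//.
have -> : Y @^-1` `[h, +oo[ = [set w | h <= Y w].
  by apply/seteqP; split => w /=; rewrite in_itv/= andbT.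
rewrite fineK// fin_num_measure//.
have -> : [set w | h <= Y w] = Y @^-1` `[h, +oo[%classic.
  by apply/seteqP; split => w /=; rewrite in_itv/= andbT.
rewrite -[X in measurable X]setTI; apply: measurable_funPT => //; exact: measurable_itv.
Qed.

Lemma tail_ge0 h : 0 <= tail h.
Proof. by rewrite fine_ge0. Qed.

Lemma tail_le1 h : tail h <= 1.
Proof.
rewrite -lee_fin tailE -(stable_law alpha0 hY)//.
rewrite probability_le1// -[X in measurable X]setTI; apply: measurable_funPT => //; exact: measurable_itv.
Qed.

Lemma tailB a b : a <= b ->
  (tail a - tail b)%:E = (\int[@lebesgue_measure R]_(x in `[a, b[) (stable_dens alpha x)%:E)%E.
Proof.
move=> ab.
have : (tail a)%:E = ((\int[@lebesgue_measure R]_(x in `[a, b[) (stable_dens alpha x)%:E) + (tail b)%:E)%E.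
  rewrite !tailE -ge0_integral_setU//=.
  - by congr (integral _ _ _); rewrite -itv_bndbnd_setU ?bnd_simp.
  - by apply/measurable_EFinP/measurable_funTS.
  - by move=> x _; rewrite lee_fin; exact: (stable_dens_ge0 alpha0 hY).
  - apply/disj_setPS => x /= [] /=; rewrite !in_itv/= => /andP[_ xb]; rewrite andbT leNgt xb//.
rewrite EFinB => ->; rewrite addeK//.
Qed.

Lemma tailB_le a b : 0 <= a -> a <= b -> tail a - tail b <= stable_dens alpha a * (b - a).
Proof.
move=> a0 ab; rewrite -lee_fin tailB//.
apply: (@le_trans _ _ (\int[@lebesgue_measure R]_(x in `[a, b[) (stable_dens alpha a)%:E)%E).
  apply: ge0_le_integral => //.
  - by move=> x _; rewrite lee_fin; exact: (stable_dens_ge0 alpha0 hY).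
  - by apply/measurable_EFinP/measurable_funTS.
  - move=> x /=; rewrite in_itv/= => /andP[ax _].
    by rewrite lee_fin; exact: stable_dens_nonincreasing.
by rewrite integral_cst_itvco.
Qed.

Lemma tailB_ge a b : 0 <= a -> a <= b -> stable_dens alpha b * (b - a) <= tail a - tail b.
Proof.
move=> a0; rewrite le_eqVlt => /orP[/eqP <-|ab]; first by rewrite !subrr mulr0.
rewrite -lee_fin tailB ?(ltW ab)//.
apply: (@le_trans _ _ (\int[@lebesgue_measure R]_(x in `[a, b[) (stable_dens alpha b)%:E)%E).
  by rewrite integral_cst_itvco// ltW.
apply: ge0_le_integral => //.
- by move=> x _; rewrite lee_fin; exact: (stable_dens_ge0 alpha0 hY).
- by apply/measurable_EFinP/measurable_funTS.
- move=> x /=; rewrite in_itv/= => /andP[ax xb].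
  by rewrite lee_fin; apply: stable_dens_nonincreasing => //; [exact: le_trans ax|exact: ltW].
Qed.

Lemma tail_nonincreasing a b : a <= b -> tail b <= tail a.
Proof.
move=> ab; rewrite -subr_ge0 -lee_fin tailB//; apply: integral_ge0 => x _.
by rewrite lee_fin; exact: (stable_dens_ge0 alpha0 hY).
Qed.

Lemma cvg_tail : h `^ alpha * tail h @[h --> +oo] --> C / 2.
Proof.
have [C0 H] := hC.
have -> : C / 2 = C / 2 * 1 by rewrite mulr1.
have : (C / 2) * (tail h / (C * h `^ (- alpha) / 2)) @[h --> +oo] --> C / 2 * 1.
  by apply: cvgM H; exact: cvg_cst.
apply: cvg_trans; apply: near_eq_cvg; near=> h.
have h0 : 0 < h by near: h; apply: nbhs_pinfty_gt; exact: num_real.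
have ha := powR_gt0 alpha h0.
by rewrite powRN; field; rewrite !gt_eqF.
Unshelve. all: by end_near. Qed.

Lemma cvg_tail_scale l : 0 < l -> h `^ alpha * tail (l * h) @[h --> +oo] --> l `^ (- alpha) * (C / 2).
Proof.
move=> l0.
have lh : l * h @[h --> +oo] --> +oo.
  apply/cvgryPge => A.
  have : \forall h \near +oo, A / l <= h by apply: nbhs_pinfty_ge; exact: num_real.
  by apply: filterS => h; rewrite ler_pdivrMr// mulrC.
have H : l `^ (- alpha) * ((l * h) `^ alpha * tail (l * h)) @[h --> +oo] --> l `^ (- alpha) * (C / 2).
  apply: cvgM; first exact: cvg_cst.
  exact: (cvg_comp (fun h => l * h) (fun h => h `^ alpha * tail h) lh cvg_tail).
apply: cvg_trans H; apply: near_eq_cvg; near=> h.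
rewrite powRM ?(ltW l0)// powRN !mulrA mulVf ?mul1r// gt_eqF// powR_gt0//.
Unshelve. all: by end_near. Qed.

(* Monotone density theorem: the density is squeezed between difference
   quotients of the tail over [h, l h] and [h / l, h]. *)
Lemma cvg_stable_dens : h `^ (1 + alpha) * stable_dens alpha h @[h --> +oo] --> alpha * C / 2.
Proof.
pose f := stable_dens alpha.
pose l (n : nat) : R := 1 + n.+1%:R^-1.
have l1 n : 1 < l n by rewrite ltrDl invr_gt0.
have l0 n : 0 < l n by apply: lt_trans (l1 n).
have lB n : l n - 1 = n.+1%:R^-1 by rewrite /l addrAC subrr add0r.
have ll : l n @[n --> \oo] --> (1 : R).
  rewrite -[X in _ --> X]addr0; apply: cvgD; first exact: cvg_cst.
  exact: cvg_harmonic.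
(* [up n] and [lo n] are the limits, as [h] tends to infinity, of the upper and lower difference
   quotients with ratio [l n]. Both are built on slopes of a power at 1, so they share the limit
   alpha C / 2 as [l n] tends to 1. *)
pose up n := (C / 2) * ((l n `^ alpha - 1) * n.+1%:R * l n).
pose lo n := (C / 2) * (- ((l n `^ (- alpha) - 1) * n.+1%:R)).
have upl : up n @[n --> \oo] --> alpha * C / 2.
  have -> : alpha * C / 2 = (C / 2) * (alpha * 1) by ring.
  apply: cvgM; first exact: cvg_cst.
  by apply: cvgM => //; exact: cvg_powR_slope_seq.
have lol : lo n @[n --> \oo] --> alpha * C / 2.
  have -> : alpha * C / 2 = (C / 2) * (- (- alpha)) by ring.
  apply: cvgM; first exact: cvg_cst.
  by apply: cvgN; exact: cvg_powR_slope_seq.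
have U n : n.+1%:R * l n * (h `^ alpha * tail ((l n)^-1 * h) - h `^ alpha * tail (1 * h)) @[h --> +oo] --> up n.
  have -> : up n = n.+1%:R * l n * ((l n)^-1 `^ (- alpha) * (C / 2) - 1 `^ (- alpha) * (C / 2)).
    have -> : (l n)^-1 `^ (- alpha) = l n `^ alpha.
      by rewrite -[(l n)^-1]powR_inv1 ?(ltW (l0 n))// -powRrM mulrNN mul1r.
    by rewrite powR1 /up; move: (l n `^ alpha) (l n) => A B; ring.
  apply: cvgM; first exact: cvg_cst.
  by apply: cvgB; apply: cvg_tail_scale => //; rewrite invr_gt0.
have V n : n.+1%:R * (h `^ alpha * tail (1 * h) - h `^ alpha * tail (l n * h)) @[h --> +oo] --> lo n.
  have -> : lo n = n.+1%:R * (1 `^ (- alpha) * (C / 2) - l n `^ (- alpha) * (C / 2)).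
    by rewrite powR1 /lo; ring.
  apply: cvgM; first exact: cvg_cst.
  by apply: cvgB; exact: cvg_tail_scale.
have fU n h : 0 < h -> h `^ (1 + alpha) * f h <= n.+1%:R * l n * (h `^ alpha * tail ((l n)^-1 * h) - h `^ alpha * tail (1 * h)).
  move=> h0.
  have lh : (l n)^-1 * h <= h by rewrite ler_piMl ?(ltW h0)// invf_le1// ltW.
  have := tailB_ge _ lh; rewrite mulr_ge0 ?invr_ge0 ?(ltW h0) ?(ltW (l0 n))// => /(_ isT) H.
  rewrite mul1r -mulrBr powRD; last by rewrite (gt_eqF h0) implybT.
  rewrite powRr1 ?(ltW h0)//.
  have -> : h * h `^ alpha * f h = n.+1%:R * l n * (h `^ alpha * (f h * (h - (l n)^-1 * h))).
    have -> : f h * (h - (l n)^-1 * h) = f h * ((l n)^-1 * (l n - 1) * h).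
      by congr (_ * _); rewrite mulrBr mulVf ?gt_eqF// mulr1 mulrBl mul1r.
    rewrite lB; have ne : n.+1%:R != 0 :> R by [].
    have le : l n != 0 by rewrite gt_eqF.
    move: ne le; move: (n.+1%:R : R) (l n) (h `^ alpha) (f h) => p q u v p0 q0.
    by field; rewrite p0 q0.
  rewrite ler_wpM2l ?mulr_ge0 ?(ltW (l0 n))// ler_wpM2l ?powR_ge0//.
have fV n h : 0 < h -> n.+1%:R * (h `^ alpha * tail (1 * h) - h `^ alpha * tail (l n * h)) <= h `^ (1 + alpha) * f h.
  move=> h0.
  have lh : h <= l n * h by rewrite ler_peMl ?(ltW h0)// ltW.
  have := tailB_le (ltW h0) lh => H.
  rewrite mul1r -mulrBr powRD; last by rewrite (gt_eqF h0) implybT.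
  rewrite powRr1 ?(ltW h0)//.
  have -> : h * h `^ alpha * f h = n.+1%:R * (h `^ alpha * (f h * (l n * h - h))).
    have -> : l n * h - h = n.+1%:R^-1 * h by rewrite -lB mulrBl mul1r.
    have ne : n.+1%:R != 0 :> R by [].
    by move: ne; move: (n.+1%:R : R) (h `^ alpha) (f h) => p u v p0; field.
  rewrite ler_wpM2l// ler_wpM2l ?powR_ge0//.
apply/cvgrPdist_le => e e0.
have e2 : 0 < e / 2 by rewrite divr_gt0.
have [n [Hu Hl]] : exists n, `|alpha * C / 2 - up n| <= e / 2 /\ `|alpha * C / 2 - lo n| <= e / 2.
  have /cvgrPdist_le/(_ _ e2) A1 := upl.
  have /cvgrPdist_le/(_ _ e2) A2 := lol.
  have [N _ /(_ N (leqnn N)) HN] := filterI A1 A2.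
  by exists N.
have /cvgrPdist_le/(_ _ e2) A1 := U n.
have /cvgrPdist_le/(_ _ e2) A2 := V n.
near=> h.
have h0 : 0 < h by near: h; apply: nbhs_pinfty_gt; exact: num_real.
have B1 := fU n h h0; have B2 := fV n h h0.
have C1 : `|up n - n.+1%:R * l n * (h `^ alpha * tail ((l n)^-1 * h) - h `^ alpha * tail (1 * h))| <= e / 2.
  by near: h.
have C2 : `|lo n - n.+1%:R * (h `^ alpha * tail (1 * h) - h `^ alpha * tail (l n * h))| <= e / 2.
  by near: h.
move: Hu Hl C1 C2; rewrite !ler_norml => /andP[Hu1 Hu2] /andP[Hl1 Hl2] /andP[C11 C12] /andP[C21 C22].
rewrite -/f; lra.
Unshelve. all: by end_near. Qed.

(** Beyond a threshold [H] the bound comes from the limit of h^(1+alpha) f(h). Below [H] the density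
    is at most its value at 0 by monotonicity, and x^(1+alpha) is at most H^(1+alpha). *)
Lemma stable_dens_le : exists2 M, 0 < M & forall x, 0 < x -> stable_dens alpha x <= M * x `^ (- (1 + alpha)).
Proof.
have C0 : 0 < C by have [] := hC.
have [A [_ HA]] : \forall h \near +oo, h `^ (1 + alpha) * stable_dens alpha h < alpha * C / 2 + 1.
  by apply: (cvgr_lt _ cvg_stable_dens); rewrite ltrDl.
pose H := Num.max A 1 + 1.
have H0 : 0 < H by rewrite /H ltr_wpDl// le_max ler01 orbT.
pose M := Num.max (alpha * C / 2 + 1) (H `^ (1 + alpha) * stable_dens alpha 0).
have a1 : 0 < 1 + alpha by rewrite addr_gt0.
have M0 : 0 < M.
  by rewrite /M lt_max; apply/orP; left; rewrite ltr_wpDl// divr_ge0// mulr_ge0// ltW.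
exists M => // x x0.
rewrite powRN ler_pdivlMr ?powR_gt0// mulrC.
have [xH|Hx] := leP x H.
  rewrite le_max; apply/orP; right.
  apply: ler_pM; rewrite ?powR_ge0//; first exact: (stable_dens_ge0 alpha0 hY).
    by apply: ge0_ler_powR => //; rewrite ?nnegrE; exact: ltW.
  by apply: stable_dens_nonincreasing => //; exact: ltW.
rewrite le_max; apply/orP; left; apply: ltW; apply: HA.
by apply: le_lt_trans Hx; rewrite /H (le_trans (_ : A <= Num.max A 1))// ?lerDl// le_max lexx.
Qed.

Lemma tail_le : exists2 M, 0 < M & forall x, 0 < x -> tail x <= M * x `^ (- alpha).
Proof.
have C0 : 0 < C by have [] := hC.
have [A [_ HA]] : \forall h \near +oo, h `^ alpha * tail h < C / 2 + 1.
  by apply: (cvgr_lt _ cvg_tail); rewrite ltrDl.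
pose H := Num.max A 1 + 1.
have H0 : 0 < H by rewrite /H ltr_wpDl// le_max ler01 orbT.
pose M := Num.max (C / 2 + 1) (H `^ alpha).
have M0 : 0 < M.
  by rewrite /M lt_max; apply/orP; left; rewrite ltr_wpDl// divr_ge0// ltW.
exists M => // x x0.
rewrite powRN ler_pdivlMr ?powR_gt0// mulrC.
have [xH|Hx] := leP x H.
  rewrite le_max; apply/orP; right; rewrite -[X in _ <= X]mulr1.
  apply: ler_pM; rewrite ?powR_ge0 ?tail_ge0 ?tail_le1//.
  by apply: ge0_ler_powR => //; rewrite ?nnegrE; exact: ltW.
rewrite le_max; apply/orP; left; apply: ltW; apply: HA.
by apply: le_lt_trans Hx; rewrite /H (le_trans (_ : A <= Num.max A 1))// ?lerDl// le_max lexx.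
Qed.
End tail.

(** The joint law and the measure with the product density take the same values on rectangles, by
    independence and by Tonelli; both therefore equal the product of the marginal laws. *)
Lemma stable_law_joint (R : realType) d (T : measurableType d) (P : probability T R) (alpha : R)
  (Y Z : {RV P >-> R}) (alpha0 : 0 < alpha)
  (hY : has_law_stable P alpha Y) (hZ : has_law_stable P alpha Z) (hi : independent P Y Z)
  (D : set (measurableTypeR R * measurableTypeR R)) : measurable D ->
  P [set w | D (Y w, Z w)] =
  (\int[@lebesgue_measure R \x @lebesgue_measure R]_(p in D) (stable_dens alpha p.1 * stable_dens alpha p.2)%:E)%E.
Proof.
move=> mD.
have mf := measurable_stable_dens alpha0 hY.
have f0 := stable_dens_ge0 alpha0 hY.
pose F (p : measurableTypeR R * measurableTypeR R) := (stable_dens alpha p.1 * stable_dens alpha p.2)%:E.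
have mF : measurable_fun setT F.
  apply/measurable_EFinP; apply: measurable_funM.
    by apply: (measurableT_comp (f := stable_dens alpha)) => //; exact: measurable_fst.
  by apply: (measurableT_comp (f := stable_dens alpha)) => //; exact: measurable_snd.
have F0 p : (0 <= F p)%E by rewrite lee_fin mulr_ge0.
pose m' := density_measure (@lebesgue_measure R \x @lebesgue_measure R)%E mF F0.
have mY : measurable_fun setT (Y : T -> measurableTypeR R) by have h : measurable_fun setT (Y : T -> R) by exact: measurable_funPT.
have mZ : measurable_fun setT (Z : T -> measurableTypeR R) by have h : measurable_fun setT (Z : T -> R) by exact: measurable_funPT.
pose YZ : T -> measurableTypeR R * measurableTypeR R := fun w => (Y w, Z w).
have mYZ : measurable_fun setT YZ by exact: measurable_fun_pair.
pose mixY := isMeasurableFun.Build _ _ T (measurableTypeR R) Y mY.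
pose YY : {mfun T >-> measurableTypeR R} := HB.pack (Y : T -> measurableTypeR R) mixY.
pose mixZ := isMeasurableFun.Build _ _ T (measurableTypeR R) Z mZ.
pose ZZ : {mfun T >-> measurableTypeR R} := HB.pack (Z : T -> measurableTypeR R) mixZ.
have E1 (A B : set R) : measurable A -> measurable B ->
    pushforward P YZ (A `*` B) = (distribution P YY A * distribution P ZZ B)%E.
  by move=> mA mB; rewrite -hi.
have E2 (A B : set R) : measurable A -> measurable B ->
    m' (A `*` B) = (distribution P YY A * distribution P ZZ B)%E.
  move=> mA mB; rewrite /m' /density_measure integral_mkcond.
  pose g := stable_dens alpha.
  have mgA (A0 : set R) : measurable A0 -> measurable_fun [set: measurableTypeR R] (g \_ A0).
    by move=> mA0; apply/(measurable_restrictT _ mA0); exact: measurable_funTS.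
  have gA0 (A0 : set R) x : 0 <= (g \_ A0) x.
    by rewrite patchE; case: ifP => // _; exact: f0.
  have EY (W : {RV P >-> R}) (A0 : set R) : has_law_stable P alpha W -> measurable A0 -> P (W @^-1` A0) = (\int[@lebesgue_measure R]_x ((g \_ A0) x)%:E)%E.
    move=> hW mA0; rewrite (stable_law alpha0 hW)// integral_mkcond.
    by apply: eq_integral => x _; rewrite restrict_EFin.
  rewrite [distribution P YY A](EY Y A hY mA) [distribution P ZZ B](EY Z B hZ mB).
  transitivity (\int[@lebesgue_measure R \x @lebesgue_measure R]_p ((g \_ A) p.1 * (g \_ B) p.2)%:E)%E.
    apply: eq_integral => -[x y] _ /=; rewrite !patchE in_setX/=.
    by case: (x \in A); case: (y \in B); rewrite /= ?mulr0 ?mul0r.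
  have mAB : measurable_fun setT (fun p : measurableTypeR R * measurableTypeR R => ((g \_ A) p.1 * (g \_ B) p.2)%:E).
    apply/measurable_EFinP; apply: measurable_funM.
      by apply: (measurableT_comp (f := g \_ A)); [exact: mgA|exact: measurable_fst].
    by apply: (measurableT_comp (f := g \_ B)); [exact: mgA|exact: measurable_snd].
  rewrite fubini_tonelli1//; last by move=> p; rewrite lee_fin mulr_ge0.
  rewrite -ge0_integralZr//.
  - apply: eq_integral => x _; rewrite /fubini_F/= -ge0_integralZl//.
    + by apply/measurable_EFinP; exact: mgA.
    + by move=> y _; rewrite lee_fin.
    + by rewrite lee_fin.
  - by apply/measurable_EFinP; exact: mgA.
  - by move=> x _; rewrite lee_fin.
  - by apply: integral_ge0 => x _; rewrite lee_fin.
have U1 := @product_measure_unique _ _ (measurableTypeR R) (measurableTypeR R) R (distribution P YY) (distribution P ZZ)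
  (pushforward P YZ) E1 D mD.
have U2 := @product_measure_unique _ _ (measurableTypeR R) (measurableTypeR R) R (distribution P YY) (distribution P ZZ)
  (density_measure (@lebesgue_measure R \x @lebesgue_measure R)%E mF F0) E2 D mD.
by rewrite -[LHS](U1 mYZ) U2.
Qed.

(** * Joint tails of two independent variables *)

(** Normalised so that [[c, +oo[] has mass c^(-alpha) for c > 0. *)
Definition levy_dens (R : realType) (alpha s : R) : R :=
  \1_(`]0%R, +oo[%classic : set R) s * (alpha * s `^ (- (1 + alpha))).

Lemma measurable_levy_dens (R : realType) (alpha : R) : measurable_fun setT (levy_dens alpha).
Proof.
apply: measurable_funM; first exact: measurable_indic.
by apply: measurable_funM => //; exact: measurable_powR.
Qed.

Lemma levy_densE (R : realType) (alpha s : R) : 0 < s -> levy_dens alpha s = alpha * s `^ (- (1 + alpha)).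
Proof. by move=> s0; rewrite /levy_dens indicE mem_set ?mul1r//= in_itv/= s0. Qed.

Lemma levy_dens0 (R : realType) (alpha s : R) : s <= 0 -> levy_dens alpha s = 0.
Proof. by move=> s0; rewrite /levy_dens indicE memNset ?mul0r//= in_itv/= andbT; apply/negP; rewrite -leNgt. Qed.

Lemma levy_dens_ge0 (R : realType) (alpha s : R) : 0 <= alpha -> 0 <= levy_dens alpha s.
Proof. by move=> a0; rewrite /levy_dens !mulr_ge0 ?powR_ge0. Qed.

(** Extended-valued, since the wedge has infinite mass for alpha >= 1. *)
Definition levy2 (R : realType) (alpha : R) (D : set (R * R)) : \bar R :=
  (\int[@lebesgue_measure R \x @lebesgue_measure R]_p
     (\1_D p * (levy_dens alpha p.1 * levy_dens alpha p.2))%:E)%E.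

Lemma measurable_levy_dens2 (R : realType) (alpha : R) :
  measurable_fun setT (fun p : measurableTypeR R * measurableTypeR R => levy_dens alpha p.1 * levy_dens alpha p.2).
Proof.
apply: measurable_funM.
  by apply: (measurableT_comp (f := levy_dens alpha)); [exact: measurable_levy_dens|exact: measurable_fst].
by apply: (measurableT_comp (f := levy_dens alpha)); [exact: measurable_levy_dens|exact: measurable_snd].
Qed.

Lemma measurable_levy2_integrand (R : realType) (alpha : R) (D : set (measurableTypeR R * measurableTypeR R)) : measurable D ->
  measurable_fun setT (fun p : measurableTypeR R * measurableTypeR R => \1_D p * (levy_dens alpha p.1 * levy_dens alpha p.2)).
Proof.
move=> mD; apply: measurable_funM; last exact: measurable_levy_dens2.
exact: measurable_indic.
Qed.

Lemma ge0_integral_scale2 (R : realType) (c : R) (g : R * R -> R) : 0 < c ->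
  measurable_fun [set: measurableTypeR R * measurableTypeR R] g -> (forall p, 0 <= g p) ->
  (\int[@lebesgue_measure R \x @lebesgue_measure R]_p (g (c * p.1, c * p.2)%R)%:E =
   ((c^-1)%:E * ((c^-1)%:E * \int[@lebesgue_measure R \x @lebesgue_measure R]_p (g p)%:E))%E)%E.
Proof.
move=> c0 mg g0.
have mcc : measurable_fun [set: measurableTypeR R * measurableTypeR R] (fun p => (c * p.1, c * p.2)%R : measurableTypeR R * measurableTypeR R).
  apply: measurable_fun_pair.
    by apply: measurable_funM => //; exact: measurable_fst.
  by apply: measurable_funM => //; exact: measurable_snd.
have mgE : measurable_fun [set: measurableTypeR R * measurableTypeR R] (EFin \o g) by exact/measurable_EFinP.
have ci0 : 0 <= c^-1 by rewrite invr_ge0 ltW.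
rewrite fubini_tonelli1; last 2 first.
- by apply: (measurableT_comp mgE mcc).
- by move=> p; rewrite lee_fin.
rewrite fubini_tonelli1//.
have mF := @measurable_fun_fubini_tonelli_F _ _ (measurableTypeR R) (measurableTypeR R) R (@lebesgue_measure R) _ mgE (fun p => g0 p).
transitivity (\int[@lebesgue_measure R]_x ((c^-1)%:E * \int[@lebesgue_measure R]_y (g (c * x, y)%R)%:E))%E.
  apply: eq_integral => x _; rewrite /fubini_F/=.
  rewrite (@ge0_integral_scale R c (fun y => (g (c * x, y)%R)%:E) c0)//.
  - apply/measurable_EFinP; apply: (measurableT_comp (f := g)) => //.
  - by move=> y; rewrite lee_fin.
rewrite ge0_integralZl//.
- congr (_ * _)%E.
  rewrite (@ge0_integral_scale R c (fun x => \int[@lebesgue_measure R]_y (g (x, y)%R)%:E)%E c0)//.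
  by move=> x; apply: integral_ge0 => y _; rewrite lee_fin.
- by apply: (measurableT_comp mF (g := fun x : measurableTypeR R => c * x)); apply: measurable_funM.
- by move=> x _; apply: integral_ge0 => y _; rewrite lee_fin.
Qed.

Lemma cvg_scaled_stable_dens (R : realType) d (T : measurableType d) (P : probability T R) (alpha : R)
   (Y : {RV P >-> R}) (C : R) (alpha0 : 0 < alpha) (alpha2 : alpha < 2)
   (hY : has_law_stable P alpha Y) (hC : tail_constant P alpha Y C) (u : nat -> R) (s : R) :
  (forall n, 0 < u n) -> u n @[n --> \oo] --> +oo -> 0 < s ->
  u n `^ (1 + alpha) * stable_dens alpha (u n * s) @[n --> \oo] --> (C / 2) * levy_dens alpha s.
Proof.
move=> u0 uoo s0.
rewrite levy_densE//.
have -> : C / 2 * (alpha * s `^ (- (1 + alpha))) = s `^ (- (1 + alpha)) * (alpha * C / 2) by ring.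
have us : u n * s @[n --> \oo] --> +oo.
  apply/cvgryPge => A.
  have /cvgryPge/(_ (A / s)) := uoo.
  by apply: filterS => n; rewrite ler_pdivrMr.
have H := cvg_comp (fun n => u n * s) (fun h => h `^ (1 + alpha) * stable_dens alpha h) us (cvg_stable_dens alpha0 alpha2 hY hC).
have {}H : s `^ (- (1 + alpha)) * ((u n * s) `^ (1 + alpha) * stable_dens alpha (u n * s)) @[n --> \oo] --> s `^ (- (1 + alpha)) * (alpha * C / 2).
  by apply: cvgM; [exact: cvg_cst|exact: H].
apply: cvg_trans H; apply: near_eq_cvg; near=> n.
rewrite powRM ?(ltW (u0 n)) ?(ltW s0)// powRN.
have sa : s `^ (1 + alpha) != 0 by rewrite gt_eqF// powR_gt0.
by field.
Unshelve. all: by end_near. Qed.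

(** Rescaling both coordinates turns the probability into an integral over the fixed set [D] of two
    rescaled densities. Each of them tends to [C / 2] times [levy_dens], and positivity of the
    coordinates on [D] lets [stable_dens_le] dominate them. *)
Lemma joint_asymptotics (R : realType) d (T : measurableType d) (P : probability T R) (alpha : R)
   (Y Z : {RV P >-> R}) (C : R) (alpha0 : 0 < alpha) (alpha2 : alpha < 2)
   (hY : has_law_stable P alpha Y) (hZ : has_law_stable P alpha Z) (hi : independent P Y Z)
   (hC : tail_constant P alpha Y C) (D : set (measurableTypeR R * measurableTypeR R)) :
  measurable D -> (forall p, D p -> 0 < p.1 /\ 0 < p.2) ->
  (levy2 alpha D < +oo)%E ->
  ((h `^ (2 * alpha))%:E * P [set w | D (h^-1 * Y w, h^-1 * Z w)%R])%E @[h --> +oo] -->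
  ((C ^+ 2 / 4)%:E * levy2 alpha D)%E.
Proof.
move=> mD D0 Dfin.
have f0 := stable_dens_ge0 alpha0 hY.
have mf := measurable_stable_dens alpha0 hY.
have mL := measurable_levy2_integrand alpha mD.
have L0 p : 0 <= \1_D p * (levy_dens alpha p.1 * levy_dens alpha p.2).
  by apply: mulr_ge0 => //; apply: mulr_ge0; apply: levy_dens_ge0; exact: ltW.
have iL : (@lebesgue_measure R \x @lebesgue_measure R)%E.-integrable setT
    (EFin \o (fun p : measurableTypeR R * measurableTypeR R => \1_D p * (levy_dens alpha p.1 * levy_dens alpha p.2))).
  exact: integrable_ge0.
apply/cvge_pinftyP => u uoo.
(* Agrees with [u n] eventually and is positive for every [n], as the rescaling and the domination
   require. *)
pose v n := Num.max (u n) 1.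
have v1 n : 1 <= v n by rewrite le_max lexx orbT.
have v0 n : 0 < v n by apply: lt_le_trans (v1 n).
have voo : v n @[n --> \oo] --> +oo.
  apply/cvgryPge => A; have /cvgryPge/(_ A) := uoo.
  by apply: filterS => n H; rewrite le_max H.
pose F n (p : measurableTypeR R * measurableTypeR R) := \1_D p * ((v n `^ (1 + alpha) * stable_dens alpha (v n * p.1)) *
   (v n `^ (1 + alpha) * stable_dens alpha (v n * p.2))).
have F0 n p : 0 <= F n p.
  by apply: mulr_ge0 => //; apply: mulr_ge0; apply: mulr_ge0; rewrite ?powR_ge0 ?f0.
have E n : ((v n `^ (2 * alpha))%:E * P [set w | D ((v n)^-1 * Y w, (v n)^-1 * Z w)%R] =
   \int[@lebesgue_measure R \x @lebesgue_measure R]_p (F n p)%:E)%E.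
  pose D' : set (measurableTypeR R * measurableTypeR R) := [set p | D ((v n)^-1 * p.1, (v n)^-1 * p.2)].
  have mD' : measurable D'.
    rewrite -[X in measurable X]setTI.
    have : measurable_fun [set: measurableTypeR R * measurableTypeR R] (fun p => ((v n)^-1 * p.1, (v n)^-1 * p.2)%R : measurableTypeR R * measurableTypeR R).
      apply: measurable_fun_pair.
        by apply: measurable_funM => //; exact: measurable_fst.
      by apply: measurable_funM => //; exact: measurable_snd.
    by apply.
  rewrite [P _](stable_law_joint alpha0 hY hZ hi mD').
  rewrite integral_mkcond.
  pose g (p : measurableTypeR R * measurableTypeR R) := \1_D' p * (stable_dens alpha p.1 * stable_dens alpha p.2).
  have mg : measurable_fun setT g.
    apply: measurable_funM; first exact: measurable_indic.
    apply: measurable_funM.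
      by apply: (measurableT_comp (f := stable_dens alpha)) => //; exact: measurable_fst.
    by apply: (measurableT_comp (f := stable_dens alpha)) => //; exact: measurable_snd.
  have g0 p : 0 <= g p by apply: mulr_ge0 => //; apply: mulr_ge0.
  transitivity ((v n `^ (2 * alpha))%:E * \int[@lebesgue_measure R \x @lebesgue_measure R]_p (g p)%:E)%E.
    by congr (_ * _)%E; apply: eq_integral => p _; rewrite restrict_EFin patch_indic /= mulrC.
  have := @ge0_integral_scale2 R (v n) g (v0 n) mg g0 => H.
  have {}H : (\int[@lebesgue_measure R \x @lebesgue_measure R]_p (g p)%:E = (v n)%:E * ((v n)%:E * \int[@lebesgue_measure R \x @lebesgue_measure R]_p (g (v n * p.1, v n * p.2)%R)%:E))%E.
    rewrite H !muleA -!EFinM.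
    have -> : v n * v n / v n / v n = 1 by field; rewrite gt_eqF.
    by rewrite mul1e.
  rewrite H !muleA -!EFinM -ge0_integralZl//.
  - apply: eq_integral => p _; rewrite -EFinM; congr (_%:E).
    rewrite /g /F.
    have -> : \1_D' (v n * p.1, v n * p.2) = \1_D p :> R.
      rewrite !indicE; congr ((_ : bool)%:R); apply/idP/idP.
        by rewrite !inE /D'/= !mulrA mulVf ?gt_eqF// !mul1r; case: p.
      by rewrite !inE /D'/= !mulrA mulVf ?gt_eqF// !mul1r; case: p.
    have -> : v n `^ (1 + alpha) = v n * v n `^ alpha.
      by rewrite powRD ?(gt_eqF (v0 n)) ?implybT// powRr1// ltW.
    have -> : v n `^ (2 * alpha) = v n `^ alpha * v n `^ alpha.
      by rewrite -powRD ?(gt_eqF (v0 n)) ?implybT//; congr (_ `^ _); ring.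
    by ring.
  - apply/measurable_EFinP; apply: (measurableT_comp (f := g)) => //.
    apply: measurable_fun_pair.
      by apply: measurable_funM => //; exact: measurable_fst.
    by apply: measurable_funM => //; exact: measurable_snd.
  - by move=> p _; rewrite lee_fin.
  - by rewrite lee_fin; apply: mulr_ge0; [apply: mulr_ge0; [exact: powR_ge0|exact: ltW]|exact: ltW].
have [M M0 HM] := stable_dens_le alpha0 alpha2 hY hC.
have lim : (\int[@lebesgue_measure R \x @lebesgue_measure R]_p (F n p)%:E)%E @[n --> \oo] -->
  (\int[@lebesgue_measure R \x @lebesgue_measure R]_p ((C ^+ 2 / 4) * (\1_D p * (levy_dens alpha p.1 * levy_dens alpha p.2)))%:E)%E.
  (* The bound M s^(-1-alpha) on the density is [M / alpha] times [levy_dens], once for each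
     coordinate. *)
  apply: (@real_dominated_cvg _ _ R _ _ _ (fun p => (M / alpha) ^+ 2 * (\1_D p * (levy_dens alpha p.1 * levy_dens alpha p.2)))).
  - move=> n; apply: measurable_funM; first exact: measurable_indic.
    apply: measurable_funM; apply: measurable_funM => //.
      by apply: (measurableT_comp (f := stable_dens alpha)) => //; apply: measurable_funM => //; exact: measurable_fst.
    by apply: (measurableT_comp (f := stable_dens alpha)) => //; apply: measurable_funM => //; exact: measurable_snd.
  - move=> p; rewrite /F indicE; have [|_] := boolP (p \in D); last first.
      by under eq_fun do rewrite mul0r; rewrite mul0r mulr0; exact: cvg_cst.
    rewrite inE => /D0[p1 p2]; under eq_fun do rewrite mul1r.
    have -> : C ^+ 2 / 4 * (1%:R * (levy_dens alpha p.1 * levy_dens alpha p.2)) = (C / 2 * levy_dens alpha p.1) * (C / 2 * levy_dens alpha p.2) by field.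
    by apply: cvgM; exact: (cvg_scaled_stable_dens alpha0 alpha2 hY hC).
  - exact: (@integrableZl _ _ R _ _ measurableT ((M / alpha) ^+ 2) _ iL).
  - move=> n p; rewrite ger0_norm// /F indicE; have [|_] := boolP (p \in D); last by rewrite !mul0r mulr0.
    rewrite inE => /D0[p1 p2]; rewrite !mul1r.
    have B s : 0 < s -> v n `^ (1 + alpha) * stable_dens alpha (v n * s) <= M / alpha * levy_dens alpha s.
      move=> s0; rewrite levy_densE//.
      have -> : M / alpha * (alpha * s `^ (- (1 + alpha))) = M * s `^ (- (1 + alpha)).
        by rewrite mulrA divfK// gt_eqF.
      have := HM (v n * s) (mulr_gt0 (v0 n) s0).
      rewrite powRM ?(ltW (v0 n)) ?(ltW s0)// => h.
      have vp := powR_gt0 (1 + alpha) (v0 n).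
      rewrite mulrC -ler_pdivlMr//; apply: le_trans h _.
      by rewrite (powRN (v n)) mulrCA mulrC.
    apply: (@le_trans _ _ ((M / alpha * levy_dens alpha p.1) * (M / alpha * levy_dens alpha p.2))).
      by apply: ler_pM; rewrite ?B// mulr_ge0// powR_ge0.
    by rewrite le_eqVlt; apply/orP; left; apply/eqP; ring.
have {}lim : ((v n `^ (2 * alpha))%:E * P [set w | D ((v n)^-1 * Y w, (v n)^-1 * Z w)%R])%E @[n --> \oo] -->
  ((C ^+ 2 / 4)%:E * levy2 alpha D)%E.
  under eq_fun do rewrite E.
  rewrite /levy2 -ge0_integralZl//.
  - exact/measurable_EFinP.
  - by move=> p _; rewrite lee_fin.
  - by rewrite lee_fin divr_ge0// sqr_ge0.
apply: cvg_trans lim; apply: near_eq_cvg; near=> n.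
have -> // : v n = u n.
rewrite /v; apply/max_idPl; near: n.
by have /cvgryPge/(_ 1) := uoo.
Unshelve. all: by end_near. Qed.

(** * Probability of the dilated wedge *)

(** An open set is the countable union of the boxes with rational centres and radii 1/(n+1) that it
    contains. The index also ranges over the boxes not contained in [U], for which [F] is empty. *)
Lemma open_prod_measurable (R : realType) (U : set (measurableTypeR R * measurableTypeR R)) :
  @open (R * R)%type U -> measurable U.
Proof.
move=> oU.
pose bx (i : rat * rat * nat) : set (R * R) := ball (ratr i.1.1 : R, ratr i.1.2 : R) (i.2.+1%:R^-1).
pose F (i : rat * rat * nat) : set (measurableTypeR R * measurableTypeR R) := [set p | bx i `<=` U /\ bx i p].
have -> : U = \bigcup_i F i.
  apply/seteqP; split => p; last first.
    by move=> [i _] [sU bp]; exact: sU.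
  move=> Up; have := oU; rewrite openE => /(_ p Up) /nbhs_ballP[e /= e0 peU].
  pose n := Num.truncn (2 / e).
  have n2 : n.+1%:R^-1 < e / 2.
    rewrite -[e / 2]invrK ltf_pV2 ?posrE ?invr_gt0 ?divr_gt0//.
    by rewrite invf_div truncnS_gt.
  have rd (x : R) : exists q : rat, ball (ratr q : R) (n.+1%:R^-1) x.
    have [q] := @rat_in_itvoo R x (x + n.+1%:R^-1) (ltac:(by rewrite ltrDl)).
    rewrite in_itv/= => /andP[q1 q2]; exists q; rewrite /ball/= /ball_ ger0_norm ?subr_ge0 ?(ltW q1)//.
    by rewrite ltrBlDl.
  have [q qx] := rd p.1; have [r rx] := rd p.2.
  exists ((q, r), n) => //; split; last by split.
  rewrite /bx/= => y [/= y1 y2]; apply: peU; split => /=.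
  - apply: (@le_ball _ _ _ (n.+1%:R^-1 + n.+1%:R^-1)); first by rewrite [leRHS]splitr lerD// ltW.
    by apply: ball_triangle y1; apply: ball_sym.
  - apply: (@le_ball _ _ _ (n.+1%:R^-1 + n.+1%:R^-1)); first by rewrite [leRHS]splitr lerD// ltW.
    by apply: ball_triangle y2; apply: ball_sym.
apply: countable_bigcupT_measurable => //.
move=> i; rewrite /F; have [sU|nU] := pselect (bx i `<=` U); last first.
  rewrite [X in measurable X](_ : _ = set0)//.
  by apply/seteqP; split => p // -[].
rewrite [X in measurable X](_ : _ = bx i); last by apply/seteqP; split => p // -[].
have -> : bx i = ball (ratr i.1.1 : R) (i.2.+1%:R^-1) `*` ball (ratr i.1.2 : R) (i.2.+1%:R^-1).
  by apply/seteqP; split => y [].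
by apply: measurableX; exact: measurable_ball.
Qed.

Section wedge.
Context (R : realType) d (T : measurableType d) (P : probability T R) (alpha : R).
Context (Y Z : {RV P >-> R}) (C : R).
Hypothesis alpha0 : 0 < alpha.
Hypothesis alpha2 : alpha < 2.
Hypothesis hY : has_law_stable P alpha Y.
Hypothesis hZ : has_law_stable P alpha Z.
Hypothesis hi : independent P Y Z.
Hypothesis hC : tail_constant P alpha Y C.

Let f0 := stable_dens_ge0 alpha0 hY.
Let mf := measurable_stable_dens alpha0 hY.
Let t0 z : 0 <= tail Y z := @tail_ge0 R d T P Y z.

Let measurable_tail : measurable_fun setT (tail Y).
Proof.
apply: (@nonincreasing_measurable R setT (tail Y)) => //.
by move=> x y xy; apply: (tail_nonincreasing alpha0 hY).
Qed.

(* The probability of [h < Y, Y - Z < h], with [z = Y - h]. *)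
Definition wedge_int (h : R) : \bar R :=
  (\int[@lebesgue_measure R]_z (\1_(`]0%R, +oo[%classic : set R) z * (stable_dens alpha (h + z) * tail Y z))%:E)%E.

Let D (h : R) : set (measurableTypeR R * measurableTypeR R) := [set p | h < p.1 /\ p.1 - p.2 < h].

Lemma measurable_wedge h : measurable (D h).
Proof.
have -> : D h = ([set p | h < p.1] `&` [set p | p.1 - p.2 < h]) by [].
have m1 : measurable_fun [set: measurableTypeR R * measurableTypeR R] (fun p => p.1 - p.2 : measurableTypeR R).
  by apply: measurable_funB; [exact: measurable_fst|exact: measurable_snd].
apply: measurableI.
- have -> : [set p : measurableTypeR R * measurableTypeR R | h < p.1] = setT `&` (fst @^-1` `]h, +oo[).
    by rewrite setTI; apply/seteqP; split => p /=; rewrite in_itv/= andbT.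
  by apply: measurable_fst => //; exact: measurable_itv.
- have -> : [set p : measurableTypeR R * measurableTypeR R | p.1 - p.2 < h] = setT `&` ((fun p => p.1 - p.2) @^-1` `]-oo, h[).
    by rewrite setTI; apply/seteqP; split => p /=; rewrite in_itv/=.
  by apply: m1 => //; exact: measurable_itv.
Qed.

(** With the first variable fixed at [x > h], the second must exceed [x - h]. The tail of [Y] also
    serves for [Z], since both have the same density. *)
Lemma wedge_prob h : P [set w | h < Y w /\ Y w - Z w < h] = wedge_int h.
Proof.
have mD := measurable_wedge h.
rewrite [LHS](stable_law_joint alpha0 hY hZ hi mD) integral_mkcond.
pose g (p : measurableTypeR R * measurableTypeR R) := \1_(D h) p * (stable_dens alpha p.1 * stable_dens alpha p.2).
have mg : measurable_fun setT g.
  apply: measurable_funM; first exact: measurable_indic.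
  apply: measurable_funM.
    by apply: (measurableT_comp (f := stable_dens alpha)) => //; exact: measurable_fst.
  by apply: (measurableT_comp (f := stable_dens alpha)) => //; exact: measurable_snd.
have g0 p : 0 <= g p by apply: mulr_ge0 => //; apply: mulr_ge0.
pose k x := \1_(`]h, +oo[%classic : set R) x * (stable_dens alpha x * tail Y (x - h)).
have mk : measurable_fun setT k.
  apply: measurable_funM; first exact: measurable_indic.
  apply: measurable_funM => //.
  by apply: (measurableT_comp (f := tail Y)) => //; exact: measurable_funB.
transitivity (\int[@lebesgue_measure R \x @lebesgue_measure R]_p (g p)%:E)%E.
  by apply: eq_integral => p _; rewrite restrict_EFin patch_indic /= mulrC.
rewrite fubini_tonelli1; last 2 first.
- exact/measurable_EFinP.
- by move=> p; rewrite lee_fin.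
transitivity (\int[@lebesgue_measure R]_x (k x)%:E)%E; last first.
  rewrite -(@ge0_integral_shift R h (fun x => (k x)%:E)); first last.
  - by move=> x; rewrite lee_fin; apply: mulr_ge0 => //; apply: mulr_ge0.
  - exact/measurable_EFinP.
  apply: eq_integral => z _; rewrite /k; congr (_ * (_ * tail Y _))%:E; last by rewrite addrAC subrr add0r.
  by rewrite !indicE; congr ((_ : bool)%:R); apply/idP/idP; rewrite !inE/= !in_itv/= !andbT ltrDl.
apply: eq_integral => x _; rewrite /fubini_F /k.
have [hx|xh] := ltP h x; last first.
  rewrite indicE memNset/= ?in_itv/= ?ltNge ?xh// mul0r.
  apply: integral0_eq => y _.
  by rewrite /g indicE memNset ?mul0r// /D/= ltNge xh => -[].
rewrite indicE mem_set ?mul1r/= ?in_itv/= ?hx//.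
rewrite EFinM (tailE alpha0 hY) -integral_itv_obnd_cbnd; last exact/measurable_funTS/measurable_EFinP.
rewrite -ge0_integralZl//; last 3 first.
- exact/measurable_funTS/measurable_EFinP.
- by move=> y _; rewrite lee_fin.
- by rewrite lee_fin.
rewrite [RHS]integral_mkcond; apply: eq_integral => y _.
transitivity ((\1_(`]x - h, +oo[%classic : set R) y * (stable_dens alpha x * stable_dens alpha y))%:E); last first.
  by rewrite /patch indicE; case: (y \in _); rewrite ?mul1r ?mul0r// EFinM.
congr (_ * _)%:E.
rewrite !indicE; congr ((_ : bool)%:R); apply/idP/idP; rewrite !inE/= !in_itv/= !andbT /D/= hx.
  by move=> [_ ?]; rewrite ltrBlDr addrC -ltrBlDr.
by move=> ?; split => //; rewrite ltrBlDr addrC -ltrBlDr.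
Qed.

Lemma cvg_stable_dens_shift (z : R) : h `^ (1 + alpha) * stable_dens alpha (h + z) @[h --> +oo] --> alpha * C / 2.
Proof.
have hz : h + z @[h --> +oo] --> +oo.
  apply/cvgryPge => A; near=> h; rewrite -lerBlDr.
  by near: h; apply: nbhs_pinfty_ge; exact: num_real.
have H := cvg_comp (fun h => h + z) (fun h => h `^ (1 + alpha) * stable_dens alpha h) hz (cvg_stable_dens alpha0 alpha2 hY hC).
have q1 : (1 + z / h) `^ (- (1 + alpha)) @[h --> +oo] --> (1 : R).
  have c1 : 1 + z / h @[h --> +oo] --> (1 : R).
    rewrite -[X in _ --> X]addr0 -[X in _ + X](mulr0 z).
    apply: cvgD; first exact: cvg_cst.
    apply: cvgM; first exact: cvg_cst.
    have := @powRN_cvg_pinfty R 1 ltr01; apply: cvg_trans; apply: near_eq_cvg; near=> h.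
    by rewrite powR_inv1//; near: h; apply: nbhs_pinfty_ge; exact: num_real.
  have := @powR_continuous R (- (1 + alpha)) 1 ltr01 => cc.
  have e1 : (1 : R) `^ (- (1 + alpha)) = 1 by rewrite powR1.
  by have := cvg_comp _ _ c1 cc; rewrite /= e1.
rewrite -[X in _ --> X]mul1r.
have {}H : (1 + z / h) `^ (- (1 + alpha)) * ((h + z) `^ (1 + alpha) * stable_dens alpha (h + z)) @[h --> +oo] --> 1 * (alpha * C / 2).
  by apply: cvgM; [exact: q1|exact: H].
apply: cvg_trans H; apply: near_eq_cvg; near=> h.
rewrite /=.
have h0 : 0 < h by near: h; apply: nbhs_pinfty_gt; exact: num_real.
have h1 : 0 < h + z.
  have : - z < h by near: h; apply: nbhs_pinfty_gt; exact: num_real.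
  lra.
rewrite mulrA; congr (_ * _).
have -> : 1 + z / h = (h + z) / h by field; rewrite gt_eqF.
rewrite -powR_inv1 ?(ltW h0)// powRM ?(ltW h1) ?powR_ge0// -powRrM mulN1r opprK.
by rewrite powRN mulrAC mulVf ?mul1r// gt_eqF// powR_gt0.
Unshelve. all: by end_near. Qed.

Let tpos (z : R) := \1_(`]0%R, +oo[%classic : set R) z * tail Y z.

Let tpos_ge0 z : 0 <= tpos z. Proof. exact: mulr_ge0. Qed.

Let measurable_tpos : measurable_fun setT tpos.
Proof. by apply: measurable_funM => //; exact: measurable_indic. Qed.

(** The tail is at most 1 near 0 and of order z^(-alpha) at infinity; [pareto_dens 1 (alpha - 1)]
    has exactly this exponent and is integrable for alpha > 1. *)
Lemma integrable_tail : 1 < alpha ->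
  (@lebesgue_measure R).-integrable setT (EFin \o tpos).
Proof.
move=> a1; have [M M0 HM] := tail_le alpha0 hY hC.
apply: (@le_integrable _ (measurableTypeR R) R _ _ measurableT _
  (EFin \o (\1_(`[0%R, 1%R]%classic : set R) \+ (fun z => M * pareto_dens 1 (alpha - 1) z)))) => //.
- exact/measurable_EFinP.
- move=> z _ /=; rewrite ger0_norm// lee_fin ger0_norm; last first.
    by rewrite addr_ge0// mulr_ge0 ?pareto_dens_ge0// ltW.
  rewrite /tpos indicE; have [|_] := boolP (z \in _); last first.
    by rewrite mul0r addr_ge0//; apply: mulr_ge0; [exact: ltW|exact: pareto_dens_ge0].
  rewrite inE/= in_itv/= andbT mul1r => z0.
  have [z1|z1] := leP z 1.
    rewrite indicE mem_set/= ?in_itv/= ?(ltW z0)//.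
    apply: (le_trans (tail_le1 alpha0 hY z)).
    by rewrite lerDl; apply: mulr_ge0; [exact: ltW|exact: pareto_dens_ge0].
  rewrite /pareto_dens (_ : \1_(`[1, +oo[%classic) z = 1); last first.
    by rewrite indicE mem_set//= in_itv/= andbT ltW.
  rewrite mul1r (_ : 1 + (alpha - 1) = alpha); last ring.
  by apply: (le_trans (HM z z0)); rewrite lerDr.
- have i1 := integrable_indic_itvcc (0 : R) 1.
  have a10 : 0 < alpha - 1 by rewrite subr_gt0.
  have i2 := @integrableZl _ (measurableTypeR R) R _ _ measurableT M _ (@integrable_pareto_dens R 1 (alpha - 1) ltr01 a10).
  exact: (@integrableD _ (measurableTypeR R) R _ _ measurableT _ _ i1 i2).
Qed.

(** Layer-cake formula for |Y|; since the density is even, each of the two sides of the law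
    contributes the same tail. *)
Lemma expectation_abs_tail :
  ('E_P[fun w => (`|Y w|)%R] = 2%:E * \int[@lebesgue_measure R]_z (tpos z)%:E)%E.
Proof.
pose Y' (w : T) : R := `|Y w|.
have mY' : measurable_fun setT Y' by apply: measurableT_comp => //; exact: measurable_normr.
pose X := HB.pack_for {mfun T >-> R} Y' (isMeasurableFun.Build _ _ _ _ Y' mY').
have := @ge0_expectation_ccdf _ _ R P X (fun w => normr_ge0 _).
rewrite {1}/X/= => ->.
rewrite -integral_itv_obnd_cbnd; last first.
  apply: (@measurable_funTS _ _ (measurableTypeR R)); exact: (ccdf_measurable X).
rewrite -ge0_integralZl//; last 2 first.
- exact/measurable_EFinP.
- by move=> z _; rewrite lee_fin.
rewrite [LHS]integral_mkcond; apply: eq_integral => z _.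
rewrite /patch /tpos indicE; have [|_] := boolP (z \in _); last by rewrite mul0r mule0.
rewrite inE/= in_itv/= andbT mul1r => z0.
rewrite /ccdf /distribution /pushforward.
have -> : X @^-1` `]z, +oo[ = (Y @^-1` `]z, +oo[) `|` (Y @^-1` `]-oo, - z[).
  apply/seteqP; split => w /=; rewrite !in_itv/= !andbT /Y' ltr_normr [w in _ || w]ltrNr => /orP//.
rewrite measureU; last 3 first.
- rewrite -[X in measurable X]setTI; apply: measurable_funPT => //; exact: measurable_itv.
- rewrite -[X in measurable X]setTI; apply: measurable_funPT => //; exact: measurable_itv.
- apply/seteqP; split => w //= []; rewrite !in_itv/= andbT => h1 h2; lra.
transitivity (\int[@lebesgue_measure R]_(x in `]z, +oo[) (stable_dens alpha x)%:E + \int[@lebesgue_measure R]_(x in `]-oo, (- z)%R[) (stable_dens alpha x)%:E)%E.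
  by congr (_ + _)%E; apply: (stable_law alpha0 hY).
have -> : (\int[@lebesgue_measure R]_(x in `]-oo, (- z)%R[) (stable_dens alpha x)%:E = \int[@lebesgue_measure R]_(x in `]z, +oo[) (stable_dens alpha x)%:E)%E.
  rewrite [LHS]integral_mkcond [RHS]integral_mkcond.
  rewrite -(@ge0_integral_opp R ((fun x : R => (stable_dens alpha x)%:E) \_ `]-oo, (- z)%R[)); last 2 first.
  - apply: (@measurable_restrictT _ _ (measurableTypeR R) _ _ _ _).1 => //.
    exact/measurable_funTS/measurable_EFinP.
  - by move=> x; rewrite /patch; case: ifP => // _; rewrite lee_fin.
  apply: eq_integral => x _; rewrite /patch stable_densN.
  have -> // : (- x \in `]-oo, (- z)%R[%classic) = (x \in `]z, +oo[%classic).
  by apply/idP/idP; rewrite !inE/= !in_itv/= andbT ltrN2.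
rewrite integral_itv_obnd_cbnd; last exact/measurable_funTS/measurable_EFinP.
by rewrite -(tailE alpha0 hY) -EFinD -EFinM; congr (_%:E); ring.
Qed.

(** For fixed [z] the density at [h + z] is asymptotic to its value at [h], and the integrable tail
    dominates. The limit is alpha C / 2 times the integral of the tail, which is half of E|Y|. *)
Lemma wedge_gt1 : 1 < alpha ->
  ((h `^ (1 + alpha))%:E * P [set w | (h < Y w)%R /\ (Y w - Z w < h)%R])%E @[h --> +oo] -->
  ((C * alpha)%:E * 'E_P[fun w => (`|Y w|)%R] * (4^-1)%:E)%E.
Proof.
move=> a1; under eq_fun do rewrite wedge_prob.
apply/cvge_pinftyP => u uoo.
pose v n := Num.max (u n) 1.
have v1 n : 1 <= v n by rewrite le_max lexx orbT.
have v0 n : 0 < v n by apply: lt_le_trans (v1 n).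
have voo : v n @[n --> \oo] --> +oo.
  apply/cvgryPge => A; have /cvgryPge/(_ A) := uoo.
  by apply: filterS => n H; rewrite le_max H.
have [M M0 HM] := stable_dens_le alpha0 alpha2 hY hC.
pose F n z := tpos z * (v n `^ (1 + alpha) * stable_dens alpha (v n + z)).
have F0 n z : 0 <= F n z by apply: mulr_ge0 => //; apply: mulr_ge0; rewrite ?powR_ge0.
have ms n : measurable_fun setT (fun z => stable_dens alpha (v n + z)).
  by apply: (measurableT_comp (f := stable_dens alpha)) => //; exact: measurable_funD.
have mF n : measurable_fun setT (F n).
  by apply: measurable_funM => //; apply: measurable_funM.
have E n : ((v n `^ (1 + alpha))%:E * wedge_int (v n) = \int[@lebesgue_measure R]_z (F n z)%:E)%E.
  rewrite /wedge_int -ge0_integralZl//.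
  - by apply: eq_integral => z _; rewrite -EFinM /F /tpos; congr (_%:E); ring.
  - apply/measurable_EFinP; apply: (@measurable_funM _ (measurableTypeR R)); first exact: measurable_indic.
    exact: (@measurable_funM _ (measurableTypeR R) _ setT _ _ (ms n) measurable_tail).
  - by move=> z _; rewrite lee_fin; apply: mulr_ge0 => //; apply: mulr_ge0.
  - by rewrite lee_fin powR_ge0.
have lim : (\int[@lebesgue_measure R]_z (F n z)%:E)%E @[n --> \oo] -->
  (\int[@lebesgue_measure R]_z (tpos z * (alpha * C / 2))%:E)%E.
  apply: (@real_dominated_cvg _ (measurableTypeR R) R _ _ _ (fun z => M * tpos z)).
  - exact: mF.
  - move=> z; apply: cvgM; first exact: cvg_cst.
    exact: (cvg_comp _ (fun h => h `^ (1 + alpha) * stable_dens alpha (h + z)) voo (cvg_stable_dens_shift z)).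
  - exact: (@integrableZl _ (measurableTypeR R) R _ _ measurableT M _ (integrable_tail a1)).
  - move=> n z; rewrite ger0_norm// mulrC; rewrite /F /tpos indicE.
    have [|_] := boolP (z \in _); last by rewrite !(mul0r,mulr0).
    rewrite inE/= in_itv/= andbT !mul1r => z0.
    have hm (a b c : R) : 0 <= a -> b <= c -> a * b <= a * c by move=> *; exact: ler_wpM2l.
    apply: hm => //.
    have vz : 0 < v n + z by rewrite addr_gt0.
    rewrite mulrC -ler_pdivlMr ?powR_gt0// -powRN.
    apply: (le_trans (HM _ vz)); rewrite ler_pM2l// !powRN lef_pV2 ?posrE ?powR_gt0//.
    by rewrite ge0_ler_powR ?nnegrE ?lerDl ?(ltW (v0 n)) ?(ltW vz) ?(ltW z0)// addr_ge0// ltW.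
have {}lim : ((v n `^ (1 + alpha))%:E * wedge_int (v n))%E @[n --> \oo] -->
   ((C * alpha)%:E * 'E_P[fun w => (`|Y w|)%R] * (4^-1)%:E)%E.
  under eq_fun do rewrite E.
  have <- // : (\int[@lebesgue_measure R]_z (tpos z * (alpha * C / 2))%:E = ((C * alpha)%:E * 'E_P[fun w => (`|Y w|)%R] * (4^-1)%:E))%E.
  rewrite expectation_abs_tail.
  have C0 : 0 < C by have [] := hC.
  under eq_integral do rewrite mulrC EFinM.
  rewrite ge0_integralZl//; last 3 first.
  - exact/measurable_EFinP.
  - by move=> z _; rewrite lee_fin.
  - by rewrite lee_fin divr_ge0// ltW// mulr_gt0.
  by rewrite [RHS]muleC !muleA -!EFinM; congr (_%:E * _)%E; field.
apply: cvg_trans lim; apply: near_eq_cvg; near=> n.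
have -> // : v n = u n.
rewrite /v; apply/max_idPl; near: n.
by have /cvgryPge/(_ 1) := uoo.
Unshelve. all: by end_near. Qed.
End wedge.

(** * The critical index alpha = 1 *)

Lemma cvg_lnVy (R : realType) : (ln h)^-1 @[h --> +oo] --> (0 : R).
Proof.
apply/cvgrPdist_le => e e0; near=> h; rewrite sub0r normrN.
have h0 : 0 < h by near: h; apply: nbhs_pinfty_gt; exact: num_real.
have le : e^-1 <= ln h.
  rewrite -ler_expR lnK//; near: h; apply: nbhs_pinfty_ge; exact: num_real.
have l0 : 0 < ln h by apply: lt_le_trans le; rewrite invr_gt0.
by rewrite ger0_norm ?invr_ge0 ?(ltW l0)// -[leRHS]invrK lef_pV2 ?posrE ?invr_gt0.
Unshelve. all: by end_near. Qed.

Lemma integral_inv (R : realType) (a b : R) : 0 < a -> a < b ->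
  (\int[@lebesgue_measure R]_(x in `[a, b]) (x^-1)%:E = (ln b - ln a)%:E)%E.
Proof.
move=> a0 ab; rewrite EFinB; apply: continuous_FTC2 => //.
- apply: continuous_in_subspaceT => x; rewrite inE/= in_itv/= => /andP[ax _].
  by apply: inv_continuous; rewrite gt_eqF// (lt_le_trans a0).
- split.
  + move=> x; rewrite in_itv/= => /andP[ax _].
    have D := is_derive1_ln (lt_trans a0 ax); exact: ex_derive.
  + by apply: cvg_at_right_filter; exact: continuous_ln.
  + by apply: cvg_at_left_filter; apply: continuous_ln; exact: lt_trans ab.
- move=> x; rewrite in_itv/= => /andP[ax _]; rewrite derive1E.
  by have [_ ->] := is_derive1_ln (lt_trans a0 ax).
Qed.

Lemma integral_indicM (R : realType) (D : set (measurableTypeR R)) (g : R -> R) :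
  (\int[@lebesgue_measure R]_z (\1_D z * g z)%:E =
   \int[@lebesgue_measure R]_(z in D) (g z)%:E)%E.
Proof.
rewrite [RHS]integral_mkcond; apply: eq_integral => z _.
by rewrite /patch indicE; case: (z \in _); rewrite ?mul1r ?mul0r.
Qed.

Section wedge1.
Context (R : realType) d (T : measurableType d) (P : probability T R).
Context (Y Z : {RV P >-> R}) (C : R).
Hypothesis hY : has_law_stable P 1 Y.
Hypothesis hZ : has_law_stable P 1 Z.
Hypothesis hi : independent P Y Z.
Hypothesis hC : tail_constant P 1 Y C.

Let alpha0 : 0 < 1 :> R := ltr01.
Let alpha2 : 1 < 2 :> R. Proof. by rewrite ltr1n. Qed.
Let f0 := stable_dens_ge0 alpha0 hY.
Let mf := measurable_stable_dens alpha0 hY.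
Let t0 z : 0 <= tail Y z := @tail_ge0 R d T P Y z.
Let fle x y := @stable_dens_nonincreasing R 1 x y alpha0 alpha2.

Let measurable_tail : measurable_fun setT (tail Y).
Proof.
apply: (@nonincreasing_measurable R setT (tail Y)) => //.
by move=> x y xy; apply: (tail_nonincreasing alpha0 hY).
Qed.

Let K_ge0 (A K : R) : (forall x, A <= x -> tail Y x <= K / x) -> 0 <= K.
Proof.
move=> H; have := H (Num.max A 1); rewrite le_max lexx => /(_ isT) h.
have m0 : 0 < Num.max A 1 by rewrite lt_max ltr01 orbT.
by have := le_trans (t0 _) h; rewrite pmulr_lge0// invr_gt0.
Qed.

(** The integral is split at [A] and [h]. Below [A] the tail is at most 1; between them the tail K/z
    produces the logarithm; beyond [h] the tail is at most K/h and the density at most K/z^2. Only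
    the middle piece exceeds the order h^(-2). *)
Lemma wedge_int_le (A K h : R) : 0 < A -> A < h ->
  (forall x, A <= x -> tail Y x <= K / x) ->
  (forall x, A <= x -> stable_dens 1 x <= K / x ^+ 2) ->
  (wedge_int 1 Y h <= (K / h ^+ 2 * (A + K * (ln h - ln A) + K))%:E)%E.
Proof.
move=> A0 Ah HT Hf; have K0 := K_ge0 HT.
have h0 := lt_trans A0 Ah.
have h20 : 0 < h ^+ 2 by rewrite exprn_gt0.
pose g1 z : R := \1_(`[0%R, A[%classic : set R) z * (K / h ^+ 2).
pose g2 z : R := \1_(`[A, h]%classic : set R) z * (z^-1 * (K * (K / h ^+ 2))).
pose g3 z : R := (K / h * K) * pareto_dens h 1 z.
have KK : 0 <= K / h ^+ 2 by rewrite divr_ge0// ltW.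
have g10 z : 0 <= g1 z by apply: mulr_ge0.
have g20 z : 0 <= g2 z.
  rewrite /g2 indicE; have [|_] := boolP (z \in _); last by rewrite mul0r.
  rewrite inE/= in_itv/= => /andP[z0 _]; rewrite mul1r.
  by apply: mulr_ge0; [rewrite invr_ge0 (le_trans (ltW A0))|apply: mulr_ge0].
have g30 z : 0 <= g3 z.
  by apply: mulr_ge0; [apply: mulr_ge0 => //; rewrite divr_ge0// ltW|exact: pareto_dens_ge0].
have mg1 : measurable_fun [set: measurableTypeR R] (EFin \o g1).
  by apply/measurable_EFinP; apply: measurable_funM => //; exact: measurable_indic.
have mg2 : measurable_fun [set: measurableTypeR R] (EFin \o g2).
  apply/measurable_EFinP; have -> : g2 = (fun z => (\1_(`[A, h]%classic : set R) z * z `^ (-1)) * (K * (K / h ^+ 2))).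
    apply/funext => z; rewrite /g2.
    rewrite indicE; have [|_] := boolP (z \in _); last by rewrite !mul0r.
    rewrite inE/= in_itv/= => /andP[z0 _]; rewrite !mul1r powR_inv1//.
    exact: le_trans (ltW A0) z0.
  apply: measurable_funM => //; apply: (@measurable_funM _ (measurableTypeR R)); first exact: measurable_indic.
  exact: measurable_powR.
have mg3 : measurable_fun [set: measurableTypeR R] (EFin \o g3).
  by apply/measurable_EFinP; apply: measurable_funM => //; exact: measurable_pareto_dens.
apply: (@le_trans _ _ (\int[@lebesgue_measure R]_z ((g1 z)%:E + ((g2 z)%:E + (g3 z)%:E)))%E).
  apply: ge0_le_integral => //.
  - move=> z _; rewrite lee_fin; apply: mulr_ge0 => //; exact: mulr_ge0.
  - apply/measurable_EFinP; apply: (@measurable_funM _ (measurableTypeR R)); first exact: measurable_indic.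
    apply: (@measurable_funM _ (measurableTypeR R)) => //.
    by apply: (measurableT_comp (f := stable_dens 1)) => //; exact: measurable_funD.
  - by apply: emeasurable_funD => //; apply: emeasurable_funD.
  - move=> z _; rewrite -!EFinD lee_fin; rewrite {1}indicE; have [|_] := boolP (z \in _); last first.
      by rewrite mul0r !addr_ge0.
    rewrite inE/= in_itv/= andbT => z0; rewrite mul1r.
    have fh : stable_dens 1 (h + z) <= K / h ^+ 2.
      apply: (@le_trans _ _ (stable_dens 1 h)); last by apply: Hf; exact: ltW.
      by apply: fle; rewrite ?ltW// ltrDl.
    have [zA|Az] := ltP z A.
      apply: (@le_trans _ _ (g1 z)); last by rewrite lerDl addr_ge0.
      rewrite /g1 indicE mem_set/= ?in_itv/= ?zA ?(ltW z0)// mul1r -[leRHS]mulr1.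
      by apply: ler_pM => //; exact: (tail_le1 alpha0 hY).
    have [zh|hz] := leP z h.
      apply: (@le_trans _ _ (g2 z)); last by rewrite addrCA lerDl addr_ge0.
      rewrite /g2 indicE mem_set/= ?in_itv/= ?zh ?Az// mul1r.
      have -> : z^-1 * (K * (K / h ^+ 2)) = (K / h ^+ 2) * (K / z) by ring.
      by apply: ler_pM => //; exact: HT.
    apply: (@le_trans _ _ (g3 z)); last by rewrite addrA lerDr addr_ge0.
    rewrite /g3 /pareto_dens indicE mem_set/= ?in_itv/= ?(ltW hz)// mul1r.
    have -> : K / h * K * z `^ (- (1 + 1)) = (K / z ^+ 2) * (K / h).
      rewrite powRN (_ : 1 + 1 = 2%:R)// powR_mulrn ?(ltW z0)//; ring.
    apply: ler_pM => //.
      apply: (@le_trans _ _ (stable_dens 1 z)); last exact: Hf.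
      by apply: fle; rewrite ?ltW// ltrDr.
    apply: (@le_trans _ _ (tail Y h)); last by apply: HT; exact: ltW.
    by apply: (tail_nonincreasing alpha0 hY); exact: ltW.
rewrite ge0_integralD//; last 2 first.
- by move=> z _; rewrite -EFinD lee_fin addr_ge0.
- exact: emeasurable_funD.
have I1 : (\int[@lebesgue_measure R]_z (g1 z)%:E = (K / h ^+ 2 * A)%:E)%E.
  by rewrite /g1 integral_indicM (@integral_cst_itvco R 0 A (K / h ^+ 2) (ltW A0)) subr0.
have I2 : (\int[@lebesgue_measure R]_z (g2 z)%:E = ((ln h - ln A) * (K * (K / h ^+ 2)))%:E)%E.
  rewrite /g2 integral_indicM EFinM -(integral_inv A0 Ah) -ge0_integralZr//.
  - apply/measurable_EFinP.
    apply: (@eq_measurable_fun _ _ (measurableTypeR R) R _ (fun z => z `^ (-1))).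
      move=> z; rewrite inE/= in_itv/= => /andP[z0 _]; rewrite powR_inv1//.
      exact: le_trans (ltW A0) z0.
    by apply: measurable_funTS; exact: measurable_powR.
  - by move=> z /=; rewrite in_itv/= => /andP[z0 _]; rewrite lee_fin invr_ge0 (le_trans (ltW A0)).
  - by rewrite lee_fin mulr_ge0.
have I3 : (\int[@lebesgue_measure R]_z (g3 z)%:E = (K / h * K * h^-1)%:E)%E.
  rewrite /g3; under eq_integral do rewrite EFinM.
  rewrite ge0_integralZl//.
  - rewrite (@integral_pareto_dens R h 1 h0 ltr01) divr1 powR_inv1 ?ltW//.
  - by apply/measurable_EFinP; exact: measurable_pareto_dens.
  - by move=> z _; rewrite lee_fin pareto_dens_ge0.
  - by rewrite lee_fin mulr_ge0// divr_ge0// ltW.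
rewrite ge0_integralD//.
- by rewrite I1 I2 I3 -!EFinD lee_fin le_eqVlt; apply/orP; left; apply/eqP; field; rewrite gt_eqF.
all: by move=> z _; rewrite lee_fin.
Qed.

(** Only [z] between [A] and [eta * h] is kept: there the density is at least its value at
    [(1 + eta) * h], and the tail k/z still gives the full logarithm up to a constant. *)
Lemma wedge_int_ge (A k eta h : R) : 0 < A -> 0 < eta -> A < eta * h -> 0 <= k ->
  (forall x, A <= x -> k / x <= tail Y x) ->
  (forall x, A <= x -> k / x ^+ 2 <= stable_dens 1 x) ->
  ((k ^+ 2 / ((1 + eta) * h) ^+ 2 * (ln (eta * h) - ln A))%:E <= wedge_int 1 Y h)%E.
Proof.
move=> A0 e0 Ah k0 HT Hf.
have eh0 := lt_trans A0 Ah.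
have h0 : 0 < h by rewrite -(pmulr_rgt0 _ e0).
pose c := k ^+ 2 / ((1 + eta) * h) ^+ 2.
have c0 : 0 <= c by rewrite divr_ge0// sqr_ge0.
have mi : measurable_fun (`[A, eta * h] : set (measurableTypeR R)) (fun z : R => (z^-1)%:E).
  apply/measurable_EFinP.
  apply: (@eq_measurable_fun _ _ (measurableTypeR R) R _ (fun z => z `^ (-1))).
    move=> z; rewrite inE/= in_itv/= => /andP[z0 _]; rewrite powR_inv1//.
    exact: le_trans (ltW A0) z0.
  by apply: measurable_funTS; exact: measurable_powR.
rewrite EFinM -(integral_inv A0 Ah) -ge0_integralZl//; last first.
  by move=> z /=; rewrite in_itv/= => /andP[z0 _]; rewrite lee_fin invr_ge0 (le_trans (ltW A0)).
rewrite /wedge_int integral_indicM.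
have mI : measurable_fun [set: measurableTypeR R] (fun z : R => (stable_dens 1 (h + z) * tail Y z)%:E).
  apply/measurable_EFinP; apply: (@measurable_funM _ (measurableTypeR R)) => //.
  by apply: (measurableT_comp (f := stable_dens 1)) => //; exact: measurable_funD.
apply: (@le_trans _ _ (\int[@lebesgue_measure R]_(z in `[A, (eta * h)%R]) (stable_dens 1 (h + z) * tail Y z)%:E)%E).
  apply: ge0_le_integral => //.
  - move=> z /=; rewrite in_itv/= => /andP[z0 _]; rewrite -EFinM lee_fin mulr_ge0// invr_ge0.
    exact: le_trans (ltW A0) z0.
  - exact: measurable_funeM.
  - exact: (measurable_funTS mI).
  - move=> z /=; rewrite in_itv/= => /andP[Az zh]; rewrite -EFinM lee_fin.
    have z0 := lt_le_trans A0 Az.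
    have -> : k ^+ 2 / ((1 + eta) * h) ^+ 2 * z^-1 = (k / ((1 + eta) * h) ^+ 2) * (k / z) by ring.
    have sq : 0 <= ((1 + eta) * h) ^+ 2 by exact: sqr_ge0.
    apply: ler_pM; [by rewrite divr_ge0|by rewrite divr_ge0// ltW| |exact: HT].
    apply: (@le_trans _ _ (stable_dens 1 ((1 + eta) * h))).
      by apply: Hf; rewrite mulrDl mul1r (le_trans (ltW Ah))// lerDr ltW.
    by apply: fle; [rewrite addr_ge0 ?ltW|rewrite mulrDl mul1r lerD2l].
apply: ge0_subset_integral => //.
- exact: (measurable_funTS mI).
- by move=> z _; rewrite lee_fin; exact: mulr_ge0.
- move=> z /=; rewrite !in_itv/= andbT => /andP[Az _]; exact: lt_le_trans Az.
Qed.

Let pos_near (A : R) : \forall h \near +oo, A < h.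
Proof. by apply: nbhs_pinfty_gt; exact: num_real. Qed.

Lemma wedge_eq1 :
  ((h ^+ 2 / ln h)%:E * P [set w | (h < Y w)%R /\ (Y w - Z w < h)%R])%E @[h --> +oo] -->
  (C ^+ 2 / 4)%:E.
Proof.
have [C0 _] := hC.
under eq_fun do rewrite (wedge_prob alpha0 hY hZ hi).
have fin h : wedge_int 1 Y h \is a fin_num.
  rewrite -(wedge_prob alpha0 hY hZ hi) fin_num_measure//.
  pose p w : measurableTypeR R * measurableTypeR R := (Y w, Z w).
  have mp : measurable_fun setT p.
    have mY : measurable_fun setT (Y : T -> measurableTypeR R) by have h' : measurable_fun setT (Y : T -> R) by exact: measurable_funPT.
    have mZ : measurable_fun setT (Z : T -> measurableTypeR R) by have h' : measurable_fun setT (Z : T -> R) by exact: measurable_funPT.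
    exact: measurable_fun_pair.
  by have := mp measurableT _ (measurable_wedge h); rewrite setTI.
pose c := C / 2.
have c0 : 0 < c by rewrite divr_gt0.
have T1 : h `^ 1 * tail Y h @[h --> +oo] --> c := cvg_tail hC.
have F1 : h `^ (1 + 1) * stable_dens 1 h @[h --> +oo] --> c.
  by have := cvg_stable_dens alpha0 alpha2 hY hC; rewrite mul1r.
pose w h := fine (wedge_int 1 Y h).
apply/fine_cvgP; split; first by apply: nearW => h; rewrite fin_numM.
suff W : h ^+ 2 / ln h * w h @[h --> +oo] --> C ^+ 2 / 4.
  by apply: cvg_trans W; apply: near_eq_cvg; apply: nearW => h /=; rewrite fineM.
have -> : C ^+ 2 / 4 = c ^+ 2 by rewrite /c; field.
apply/cvgrPdist_le => delta delta0.
(* A single [e] plays two roles: the precision of the tail and density constants, and the fraction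
   [eta] at which the lower bound cuts the scales off. *)
have [e [e0 ec E1 E2]] : exists e, [/\ 0 < e, e < c, (c + e) ^+ 2 < c ^+ 2 + delta &
    c ^+ 2 - delta < (c - e) ^+ 2 / (1 + e) ^+ 2].
  have L1 : (c + e) ^+ 2 @[e --> 0^'+] --> c ^+ 2.
    have <- : (c + 0) * (c + 0) = c ^+ 2 by rewrite addr0 expr2.
    apply: cvgM;
      by apply: cvgD; [exact: cvg_cst|apply: cvg_at_right_filter; exact: cvg_id].
  have L2 : (c - e) ^+ 2 / (1 + e) ^+ 2 @[e --> 0^'+] --> c ^+ 2.
    have <- : (c - 0) * (c - 0) / ((1 + 0) * (1 + 0)) = c ^+ 2 by rewrite subr0 addr0 mulr1 divr1 expr2.
    apply: cvgM.
      apply: cvgM;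
      by apply: cvgB; [exact: cvg_cst|apply: cvg_at_right_filter; exact: cvg_id].
    apply: cvgV; first by rewrite addr0 mulr1 oner_eq0.
    apply: cvgM; by apply: cvgD; [exact: cvg_cst|apply: cvg_at_right_filter; exact: cvg_id].
  suff : \forall e \near 0^'+, [/\ 0 < e, e < c, (c + e) ^+ 2 < c ^+ 2 + delta &
    c ^+ 2 - delta < (c - e) ^+ 2 / (1 + e) ^+ 2] by move=> H; exact: (@filter_ex _ _ (at_right_proper_filter (0 : R)) _ H).
  near=> e; split.
  - by near: e; exact: nbhs_right_gt.
  - by near: e; exact: nbhs_right_lt.
  - by near: e; apply: (cvgr_lt _ L1); rewrite ltrDl.
  - by near: e; apply: (cvgr_gt _ L2); rewrite ltrBlDr ltrDl.
have [A [A0 HT1 HT2 HF1 HF2]] : exists A, [/\ 0 < A,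
   forall x, A <= x -> tail Y x <= (c + e) / x, forall x, A <= x -> (c - e) / x <= tail Y x,
   forall x, A <= x -> stable_dens 1 x <= (c + e) / x ^+ 2 &
   forall x, A <= x -> (c - e) / x ^+ 2 <= stable_dens 1 x].
  have : \forall x \near +oo, [/\ x `^ 1 * tail Y x < c + e, c - e < x `^ 1 * tail Y x,
     x `^ (1 + 1) * stable_dens 1 x < c + e & c - e < x `^ (1 + 1) * stable_dens 1 x].
    near=> x; split; near: x.
    - by apply: (cvgr_lt _ T1); rewrite ltrDl.
    - by apply: (cvgr_gt _ T1); rewrite ltrBlDr ltrDl.
    - by apply: (cvgr_lt _ F1); rewrite ltrDl.
    - by apply: (cvgr_gt _ F1); rewrite ltrBlDr ltrDl.
  move=> [A' [_ HA]]; exists (Num.max A' 0 + 1).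
  have A0 : 0 < Num.max A' 0 + 1 by rewrite ltr_wpDl// le_max lexx orbT.
  have X x : Num.max A' 0 + 1 <= x -> 0 < x /\ A' < x.
    move=> Ax; split; first exact: lt_le_trans Ax.
    by apply: lt_le_trans Ax; rewrite ltr_pwDr// le_max lexx.
  have p2 x : 0 < x -> x `^ (1 + 1) = x ^+ 2.
    by move=> x0; rewrite (_ : 1 + 1 = 2%:R)// powR_mulrn// ltW.
  split=> // x /X[x0 /HA[]]; rewrite powRr1 ?(ltW x0)// p2// => h1 h2 h3 h4.
  - by rewrite ler_pdivlMr// mulrC ltW.
  - by rewrite ler_pdivrMr// mulrC ltW.
  - by rewrite ler_pdivlMr ?exprn_gt0// mulrC ltW.
  - by rewrite ler_pdivrMr ?exprn_gt0// mulrC ltW.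
(* [U] and [V] are the two bounds on [wedge_int] multiplied by h^2 / ln h. The threshold [A] enters
   only through terms that [(ln h)^-1] sends to 0. *)
have U : (c + e) * (A + (c + e) - (c + e) * ln A) * (ln h)^-1 + (c + e) ^+ 2 @[h --> +oo] --> (c + e) ^+ 2.
  have E : (c + e) * (A + (c + e) - (c + e) * ln A) * 0 + (c + e) ^+ 2 = (c + e) ^+ 2 by rewrite mulr0 add0r.
  rewrite -[X in _ --> X]E.
  apply: cvgD; last exact: cvg_cst.
  by apply: cvgM; [exact: cvg_cst|exact: cvg_lnVy].
have V : (c - e) ^+ 2 / (1 + e) ^+ 2 * (1 + (ln e - ln A) * (ln h)^-1) @[h --> +oo] --> (c - e) ^+ 2 / (1 + e) ^+ 2.
  have E : (c - e) ^+ 2 / (1 + e) ^+ 2 * (1 + (ln e - ln A) * 0) = (c - e) ^+ 2 / (1 + e) ^+ 2 by rewrite mulr0 addr0 mulr1.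
  rewrite -[X in _ --> X]E.
  apply: cvgM; first exact: cvg_cst.
  apply: cvgD; first exact: cvg_cst.
  by apply: cvgM; [exact: cvg_cst|exact: cvg_lnVy].
near=> h.
have h1 : 1 < h by near: h; exact: pos_near.
have Ah : A < h by near: h; exact: pos_near.
have Aeh : A < e * h by rewrite mulrC -ltr_pdivrMr//; near: h; exact: pos_near.
have h0 := lt_trans ltr01 h1.
have lh := ln_gt0 h1.
have hl0 : 0 < h ^+ 2 / ln h by rewrite divr_gt0// exprn_gt0.
have ce0 : 0 <= c - e by rewrite subr_ge0 ltW.
have up := wedge_int_le A0 Ah HT1 HF1.
have lo := wedge_int_ge A0 e0 Aeh ce0 HT2 HF2.
rewrite -(fineK (fin h)) lee_fin -/(w h) in up.
rewrite -(fineK (fin h)) lee_fin -/(w h) in lo.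
rewrite -(ler_pM2l hl0) in up.
rewrite -(ler_pM2l hl0) in lo.
rewrite ler_distlC; apply/andP; split; apply: ltW.
  apply: lt_le_trans lo.
  have -> : h ^+ 2 / ln h * ((c - e) ^+ 2 / ((1 + e) * h) ^+ 2 * (ln (e * h) - ln A)) =
     (c - e) ^+ 2 / (1 + e) ^+ 2 * (1 + (ln e - ln A) * (ln h)^-1).
    rewrite lnM ?posrE//; field.
    by rewrite (gt_eqF lh) (gt_eqF h0)/= gt_eqF// addr_gt0.
  by near: h; exact: (cvgr_gt _ V).
apply: le_lt_trans up _.
have -> : h ^+ 2 / ln h * ((c + e) / h ^+ 2 * (A + (c + e) * (ln h - ln A) + (c + e))) =
   (c + e) * (A + (c + e) - (c + e) * ln A) * (ln h)^-1 + (c + e) ^+ 2.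
  by field; rewrite (gt_eqF lh) (gt_eqF h0).
by near: h; exact: (cvgr_lt _ U).
Unshelve. all: by end_near. Qed.
End wedge1.

(** * Beta and Gamma integrals *)

Definition pos_ind (R : realType) (x : R) : R := \1_(`]0%R, +oo[%classic : set R) x.

Lemma pos_ind1 (R : realType) (x : R) : 0 < x -> pos_ind x = 1.
Proof. by move=> x0; rewrite /pos_ind indicE mem_set//= in_itv/= x0. Qed.

Lemma pos_ind0 (R : realType) (x : R) : x <= 0 -> pos_ind x = 0.
Proof. by move=> x0; rewrite /pos_ind indicE memNset//= in_itv/= andbT; apply/negP; rewrite -leNgt. Qed.

Lemma pos_ind_ge0 (R : realType) (x : R) : 0 <= pos_ind x.
Proof. by rewrite /pos_ind. Qed.

Lemma measurable_pos_ind (R : realType) : measurable_fun [set: measurableTypeR R] (@pos_ind R).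
Proof. exact: measurable_indic. Qed.

(** Extended-valued, so that the Beta-Gamma identity follows from Tonelli alone, before any
    convergence is known. *)
Definition gammaE (R : realType) (a : R) : \bar R :=
  (\int[@lebesgue_measure R]_t (pos_ind t * (t `^ (a - 1) * expR (- t)))%:E)%E.

Lemma gammaE_ge0 (R : realType) (a : R) : (0 <= gammaE a)%E.
Proof.
apply: integral_ge0 => t _; rewrite lee_fin.
by apply: mulr_ge0; [exact: pos_ind_ge0|apply: mulr_ge0; [exact: powR_ge0|exact: expR_ge0]].
Qed.

Lemma measurable_expRM (R : realType) (c : R) : measurable_fun [set: measurableTypeR R] (fun t : R => expR (c * t)).
Proof. by apply: measurableT_comp; [exact: measurable_expR|exact: measurable_funM]. Qed.

Lemma measurable_gammaE (R : realType) (a c : R) :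
  measurable_fun [set: measurableTypeR R] (fun t : R => pos_ind t * (t `^ a * expR (c * t))).
Proof.
apply: measurable_funM; first exact: measurable_pos_ind.
by apply: measurable_funM; [exact: measurable_powR|exact: measurable_expRM].
Qed.

Lemma GammaE (R : realType) (a : R) : Gamma a = fine (gammaE a).
Proof. by rewrite /Gamma /Rintegral /gammaE; congr fine; rewrite -integral_indicM. Qed.

Lemma gammaE_scale (R : realType) (a u : R) : 0 < u ->
  (\int[@lebesgue_measure R]_t (pos_ind t * (t `^ (a - 1) * expR (- u * t)))%:E =
   (u `^ (- a))%:E * gammaE a)%E.
Proof.
move=> u0.
pose g (t : R) : \bar R := (pos_ind t * (t `^ (a - 1) * expR (- t)))%:E.
have mg : measurable_fun setT g.
  apply/measurable_EFinP; have := @measurable_gammaE R (a - 1) (-1).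
  by apply: eq_measurable_fun => t _; rewrite mulN1r.
have g0 t : (0 <= g t)%E.
  rewrite lee_fin; apply: mulr_ge0; first exact: pos_ind_ge0.
  by apply: mulr_ge0; [exact: powR_ge0|exact: expR_ge0].
have H := @ge0_integral_scale R u g u0 mg g0.
have -> : gammaE a = (u%:E * \int[@lebesgue_measure R]_x g (u * x)%R)%E.
  by rewrite H muleA -EFinM divff ?gt_eqF// mul1e.
rewrite muleA -EFinM -ge0_integralZl//; last 2 first.
- have := @measurable_funM _ (measurableTypeR R) R setT _ _ (@measurable_cst _ _ (measurableTypeR R) _ setT u) (@measurable_id _ (measurableTypeR R) setT).
  by move=> mu; exact: (measurableT_comp mg mu).
- by rewrite lee_fin; apply: mulr_ge0; [exact: powR_ge0|exact: ltW].
apply: eq_integral => t _; rewrite /g -EFinM; congr (_%:E).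
have [t0|t0] := ltP 0 t; last first.
  by rewrite !pos_ind0 ?mul0r ?mulr0// pmulr_rle0.
rewrite !pos_ind1// ?mulr_gt0// !mul1r powRM ?(ltW u0) ?(ltW t0)// mulNr.
have -> : u `^ (- a) * u * (u `^ (a - 1) * t `^ (a - 1) * expR (- (u * t))) =
   (u `^ (- a) * u `^ 1 * u `^ (a - 1)) * (t `^ (a - 1) * expR (- (u * t))).
  by rewrite powRr1 ?(ltW u0)//; ring.
rewrite -!powRD ?(gt_eqF u0) ?implybT//.
by rewrite (_ : - a + 1 + (a - 1) = 0) ?powRr0 ?mul1r//; ring.
Qed.

Lemma gammaE_fin (R : realType) (a : R) : 0 < a -> (gammaE a < +oo)%E.
Proof.
move=> a0.
(* Here n >= a + 1 gives t^(a+1) <= t^n for t >= 1, and the constant n^n comes from e^t =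
   (e^(t/n))^n >= (t/n)^n. *)
pose n := (Num.truncn (a + 1)).+1.
have na : a + 1 <= n%:R by apply: ltW; exact: truncnS_gt.
pose M : R := n%:R ^+ n.
have M0 : 0 <= M by apply: exprn_ge0.
have bound (t : R) : 1 <= t -> t `^ (a - 1) * expR (- t) <= M * t `^ (- (1 + 1)).
  move=> t1; have t0 := lt_le_trans ltr01 t1.
  rewrite expRN powRN.
  have p2 : 0 < t `^ (1 + 1) by rewrite powR_gt0.
  rewrite -[leRHS]/(_ / _) ler_pdivrMr ?expR_gt0// mulrAC ler_pdivlMr//.
  rewrite -powRD ?(gt_eqF t0) ?implybT// (_ : a - 1 + (1 + 1) = a + 1); last ring.
  apply: (@le_trans _ _ (t `^ n%:R)); first by rewrite ler_powR.
  rewrite powR_mulrn ?(ltW t0)//.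
  have -> : t ^+ n = M * (t / n%:R) ^+ n.
    by rewrite /M -exprMn mulrCA divff ?mulr1// gt_eqF.
  apply: ler_wpM2l => //.
  have -> : expR t = expR (t / n%:R) ^+ n.
    by rewrite -expRM_natl -mulr_natl mulrCA divff ?mulr1// gt_eqF.
  apply: lerXn2r; rewrite ?nnegrE ?expR_ge0 ?divr_ge0 ?(ltW t0)//.
  by apply: le_trans (expR_ge1Dx _); rewrite lerDr.
apply: (@le_lt_trans _ _ (\int[@lebesgue_measure R]_t ((\1_(`]0%R, 1%R]%classic : set R) t * t `^ (a - 1))%:E + (M * pareto_dens 1 1 t)%:E))%E).
  apply: ge0_le_integral => //.
  - move=> t _; rewrite lee_fin; apply: mulr_ge0; first exact: pos_ind_ge0.
    by apply: mulr_ge0; [exact: powR_ge0|exact: expR_ge0].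
  - apply/measurable_EFinP; have := @measurable_gammaE R (a - 1) (-1).
    by apply: eq_measurable_fun => t _; rewrite mulN1r.
  - apply: emeasurable_funD; apply/measurable_EFinP.
      apply: (@measurable_funM _ (measurableTypeR R)); first exact: measurable_indic.
      exact: measurable_powR.
    by apply: measurable_funM => //; exact: measurable_pareto_dens.
  - move=> t _; rewrite -EFinD lee_fin.
    have [t0|t0] := leP t 0.
      rewrite pos_ind0// mul0r addr_ge0//; apply: mulr_ge0 => //; [exact: powR_ge0|exact: pareto_dens_ge0].
    rewrite pos_ind1// mul1r; have [t1|t1] := leP t 1.
      rewrite indicE mem_set/= ?in_itv/= ?t0// mul1r.
      rewrite -[leLHS]addr0; apply: lerD; last by apply: mulr_ge0 => //; exact: pareto_dens_ge0.
      rewrite -[leRHS]mulr1; apply: ler_pM; rewrite ?powR_ge0 ?expR_ge0//.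
      by rewrite -expR0 ler_expR oppr_le0 ltW.
    rewrite -[leLHS]add0r; apply: lerD; first by apply: mulr_ge0 => //; exact: powR_ge0.
    rewrite /pareto_dens indicE mem_set/= ?in_itv/= ?(ltW t1)// mul1r.
    exact: bound (ltW t1).
rewrite ge0_integralD//; last 4 first.
- by move=> t _; rewrite lee_fin; apply: mulr_ge0 => //; exact: powR_ge0.
- apply/measurable_EFinP.
  apply: (@measurable_funM _ (measurableTypeR R)); first exact: measurable_indic.
  exact: measurable_powR.
- by move=> t _; rewrite lee_fin; apply: mulr_ge0 => //; exact: pareto_dens_ge0.
- by apply/measurable_EFinP; apply: measurable_funM => //; exact: measurable_pareto_dens.
rewrite integral_indicM integral_powR_head ?ltrBrDr ?ltrN10 ?addNr//.
under [X in (_ + X)%E]eq_integral do rewrite EFinM.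
rewrite ge0_integralZl//.
- by rewrite integral_pareto_dens// -EFinM -EFinD ltry.
- by apply/measurable_EFinP; exact: measurable_pareto_dens.
- by move=> t _; rewrite lee_fin pareto_dens_ge0.
Qed.

(** On [[1, 2[] the integrand is at least [expR (- 2)]. Positivity is what permits division by
    Gamma(1 + alpha) later. *)
Lemma gammaE_gt0 (R : realType) (a : R) : 1 <= a -> (0 < gammaE a)%E.
Proof.
move=> a1.
apply: (@lt_le_trans _ _ (\int[@lebesgue_measure R]_(t in `[1%R, 2%R[) (cst (expR (- 2))%:E t))%E).
  rewrite integral_cst_itvco; last by rewrite ler1n.
  by rewrite lte_fin mulr_gt0 ?expR_gt0// subr_gt0 ltr1n.
rewrite -integral_indicM; apply: ge0_le_integral => //.
- by apply/measurable_EFinP; apply: (@measurable_funM _ (measurableTypeR R)) => //; exact: measurable_indic.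
- apply/measurable_EFinP; have := @measurable_gammaE R (a - 1) (-1).
  by apply: eq_measurable_fun => t _; rewrite mulN1r.
- move=> t _; rewrite lee_fin indicE; have [|_] := boolP (t \in _); last first.
    rewrite mul0r; apply: mulr_ge0; first exact: pos_ind_ge0.
    by apply: mulr_ge0; [exact: powR_ge0|exact: expR_ge0].
  rewrite inE/= in_itv/= => /andP[t1 t2].
  rewrite pos_ind1 ?(lt_le_trans ltr01)// !mul1r -[leLHS]mul1r.
  apply: ler_pM => //.
    by rewrite -[leLHS](powRr0 t) ler_powR// subr_ge0.
  by rewrite ler_expR lerN2 ltW.
Qed.

(** The Beta integral over the half line, obtained from the usual one over the unit interval by x =
    1 / (1 + z). *)
Definition betaE (R : realType) (a b : R) : \bar R :=
  (\int[@lebesgue_measure R]_z (pos_ind z * (z `^ (b - 1) * (1 + z) `^ (- (a + b))))%:E)%E.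

Lemma measurable_betaE (R : realType) (a b : R) :
  measurable_fun [set: measurableTypeR R] (fun z : R => pos_ind z * (z `^ (b - 1) * (1 + z) `^ (- (a + b)))).
Proof.
apply: measurable_funM; first exact: measurable_pos_ind.
apply: measurable_funM; first exact: measurable_powR.
have h : measurable_fun [set: measurableTypeR R] (fun z : R => 1 + z) by exact: measurable_funD.
exact: (measurableT_comp (@measurable_powR R (- (a + b))) h).
Qed.

(** Tonelli for z^(b-1) t^(a+b-1) e^(-(1+z)t) on the positive quadrant: integrating [t] first yields
    the left side, [z] first the right. The product form stays meaningful when the Beta integral is
    infinite. *)
Lemma betaE_gammaE (R : realType) (a b : R) : (gammaE (a + b) * betaE a b = gammaE a * gammaE b)%E.
Proof.
pose g (p : measurableTypeR R * measurableTypeR R) : R :=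
  pos_ind p.1 * (pos_ind p.2 * (p.1 `^ (b - 1) * (p.2 `^ (a + b - 1) * expR (- ((1 + p.1) * p.2))))).
have m1 (h : R -> R) : measurable_fun [set: measurableTypeR R] h ->
    measurable_fun [set: measurableTypeR R * measurableTypeR R] (fun p => h p.1).
  by move=> mh; apply: (measurableT_comp mh); exact: measurable_fst.
have m2 (h : R -> R) : measurable_fun [set: measurableTypeR R] h ->
    measurable_fun [set: measurableTypeR R * measurableTypeR R] (fun p => h p.2).
  by move=> mh; apply: (measurableT_comp mh); exact: measurable_snd.
have mg : measurable_fun [set: measurableTypeR R * measurableTypeR R] (EFin \o g).
  apply/measurable_EFinP.
  apply: measurable_funM; first by apply: m1; exact: measurable_pos_ind.
  apply: measurable_funM; first by apply: m2; exact: measurable_pos_ind.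
  apply: measurable_funM; first by apply: (m1 (fun x => x `^ (b - 1))); exact: measurable_powR.
  apply: measurable_funM; first by apply: (m2 (fun x => x `^ (a + b - 1))); exact: measurable_powR.
  apply: measurableT_comp; first exact: measurable_expR.
  apply: measurableT_comp; first exact: oppr_measurable.
  apply: measurable_funM; last exact: measurable_snd.
  by apply: measurable_funD => //; exact: measurable_fst.
have g0 p : (0 <= (EFin \o g) p)%E.
  rewrite lee_fin; do 2! (apply: mulr_ge0; first exact: pos_ind_ge0).
  apply: mulr_ge0; first exact: powR_ge0.
  by apply: mulr_ge0; [exact: powR_ge0|exact: expR_ge0].
have := @fubini_tonelli _ _ (measurableTypeR R) (measurableTypeR R) R (@lebesgue_measure R) (@lebesgue_measure R) _ mg g0.
have mG c : measurable_fun [set: measurableTypeR R] (fun t : R => (pos_ind t * (t `^ (c - 1) * expR (- t)))%:E).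
  apply/measurable_EFinP; have := @measurable_gammaE R (c - 1) (-1).
  by apply: eq_measurable_fun => t _; rewrite mulN1r.
have G0 c (t : R) : (0%R <= (pos_ind t * (t `^ (c - 1) * expR (- t)))%:E)%E.
  rewrite lee_fin; apply: mulr_ge0; first exact: pos_ind_ge0.
  by apply: mulr_ge0; [exact: powR_ge0|exact: expR_ge0].
have mS c u : measurable_fun [set: measurableTypeR R] (fun t : R => (pos_ind t * (t `^ (c - 1) * expR (- u * t)))%:E).
  by apply/measurable_EFinP; exact: measurable_gammaE.
have S0 c u (t : R) : (0%R <= (pos_ind t * (t `^ (c - 1) * expR (- u * t)))%:E)%E.
  rewrite lee_fin; apply: mulr_ge0; first exact: pos_ind_ge0.
  by apply: mulr_ge0; [exact: powR_ge0|exact: expR_ge0].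
have -> : (\int[@lebesgue_measure R]_x \int[@lebesgue_measure R]_y (EFin \o g) (x, y) = gammaE (a + b) * betaE a b)%E.
  rewrite /betaE -ge0_integralZl//.
  - apply: eq_integral => z _; have [z0|z0] := leP z 0.
      by rewrite pos_ind0// mul0r mule0; apply: integral0_eq => t _; rewrite /g/= pos_ind0// mul0r.
    have z1 : 0 < 1 + z by rewrite addr_gt0.
    rewrite pos_ind1// mul1r EFinM muleCA.
    rewrite [(gammaE _ * _)%E]muleC -(gammaE_scale _ z1) -ge0_integralZl//; last by rewrite lee_fin powR_ge0.
    by apply: eq_integral => t _; rewrite /g/= pos_ind1// mul1r -EFinM mulNr; congr (_%:E); ring.
  - by apply/measurable_EFinP; exact: measurable_betaE.
  - move=> z _; rewrite lee_fin; apply: mulr_ge0; first exact: pos_ind_ge0.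
    by apply: mulr_ge0; exact: powR_ge0.
  - exact: gammaE_ge0.
have -> : (\int[@lebesgue_measure R]_y \int[@lebesgue_measure R]_x (EFin \o g) (x, y) = gammaE a * gammaE b)%E.
  rewrite muleC {2}/gammaE -ge0_integralZl//; last exact: gammaE_ge0.
  apply: eq_integral => t _; have [t0|t0] := leP t 0.
    by rewrite pos_ind0// mul0r mule0; apply: integral0_eq => z _; rewrite /g/= (pos_ind0 t0) mul0r mulr0.
  rewrite pos_ind1// mul1r.
  transitivity ((t `^ (a + b - 1) * expR (- t))%:E * ((t `^ (- b))%:E * gammaE b))%E.
    rewrite -(gammaE_scale _ t0) -ge0_integralZl//; last first.
      by rewrite lee_fin; apply: mulr_ge0; [exact: powR_ge0|exact: expR_ge0].
    apply: eq_integral => z _; rewrite /g/= (pos_ind1 t0) -EFinM; congr (_%:E).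
    have -> : expR (- ((1 + z) * t)) = expR (- t) * expR (- t * z) by rewrite -expRD; congr expR; ring.
    by ring.
  rewrite muleA -EFinM muleC; congr (_ * (_%:E))%E.
  by rewrite mulrAC -powRD ?(gt_eqF t0) ?implybT//; congr (_ `^ _ * _); ring.
by [].
Qed.

Lemma levy_ray (R : realType) (alpha c : R) : 0 < alpha -> 0 < c ->
  (\int[@lebesgue_measure R]_(y in `[c, +oo[) (levy_dens alpha y)%:E = (c `^ (- alpha))%:E)%E.
Proof.
move=> a0 c0; rewrite -(integral_powR_tail a0 c0); apply: eq_integral => y.
by rewrite inE/= in_itv/= andbT => cy; rewrite levy_densE// (lt_le_trans c0).
Qed.

(** Integrating out the second coordinate leaves alpha x^(-1-alpha) (x - 1)^(-alpha) on x > 1, which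
    the shift x = 1 + z turns into a Beta integrand. *)
Lemma levy2_wedge (R : realType) (alpha : R) : 0 < alpha ->
  (levy2 alpha [set p | (1 < p.1)%R /\ (p.1 - p.2 < 1)%R] = alpha%:E * betaE (2 * alpha) (1 - alpha))%E.
Proof.
move=> a0; have mW := measurable_wedge (1 : R).
have ml := @measurable_levy_dens R alpha.
have l0 y : 0 <= levy_dens alpha y by apply: levy_dens_ge0; exact: ltW.
pose g (x : R) : R := \1_(`]1%R, +oo[%classic : set R) x * (levy_dens alpha x * (x - 1) `^ (- alpha)).
have mg : measurable_fun [set: measurableTypeR R] (EFin \o g).
  apply/measurable_EFinP; apply: measurable_funM; first exact: measurable_indic.
  apply: measurable_funM => //.
  have h : measurable_fun [set: measurableTypeR R] (fun z : R => z - 1) by exact: measurable_funB.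
  exact: (measurableT_comp (@measurable_powR R (- alpha)) h).
have g0 x : (0 <= (EFin \o g) x)%E.
  by rewrite lee_fin; apply: mulr_ge0 => //; apply: mulr_ge0 => //; exact: powR_ge0.
transitivity (\int[@lebesgue_measure R]_x (EFin \o g) x)%E.
  rewrite /levy2 fubini_tonelli1; last 2 first.
  - by apply/measurable_EFinP; exact: measurable_levy2_integrand.
  - by move=> p; rewrite lee_fin; apply: mulr_ge0 => //; apply: mulr_ge0.
  apply: eq_integral => x _; rewrite /fubini_F /g/=.
  have [x1|x1] := leP x 1.
    rewrite (_ : \1_`]1, +oo[ x = 0) ?mul0r; last first.
      by rewrite indicE memNset//= in_itv/= andbT; apply/negP; rewrite -leNgt.
    apply: integral0_eq => y _; rewrite indicE memNset ?mul0r// => -[/= ?]; lra.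
  rewrite (_ : \1_`]1, +oo[ x = 1) ?mul1r; last by rewrite indicE mem_set//= in_itv/= andbT.
  have x10 : 0 < x - 1 by rewrite subr_gt0.
  rewrite EFinM -(levy_ray a0 x10) -integral_itv_obnd_cbnd; last exact/measurable_funTS/measurable_EFinP.
  rewrite -ge0_integralZl//; last 3 first.
  - exact/measurable_funTS/measurable_EFinP.
  - by move=> y _; rewrite lee_fin.
  - by rewrite lee_fin.
  under [RHS]eq_integral do rewrite -EFinM.
  transitivity (\int[@lebesgue_measure R]_y (\1_(`]x - 1, +oo[%classic : set (measurableTypeR R)) y * (levy_dens alpha x * levy_dens alpha y))%:E)%E; last by rewrite integral_indicM.
  apply: eq_integral => y _; congr (_ * _)%:E.
  rewrite !indicE; congr ((_ : bool)%:R); apply/idP/idP; rewrite !inE/= in_itv/= andbT.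
    by move=> [_ h]; rewrite ltrBlDr addrC -ltrBlDr.
  by move=> h; split => //; rewrite ltrBlDr addrC -ltrBlDr.
rewrite -(ge0_integral_shift 1 mg g0) /betaE -ge0_integralZl//; last 3 first.
- by apply/measurable_EFinP; exact: measurable_betaE.
- by move=> z _; rewrite lee_fin; apply: mulr_ge0; [exact: pos_ind_ge0|apply: mulr_ge0; exact: powR_ge0].
- by rewrite lee_fin ltW.
apply: eq_integral => z _; rewrite /g/= -EFinM; congr (_%:E).
have [z0|z0] := leP z 0.
  rewrite pos_ind0// (_ : \1_`]1, +oo[ (1 + z) = 0) ?mul0r ?mulr0//.
  by rewrite indicE memNset//= in_itv/= andbT; apply/negP; rewrite -leNgt gerDl.
rewrite pos_ind1// (_ : \1_`]1, +oo[ (1 + z) = 1); last by rewrite indicE mem_set//= in_itv/= andbT ltrDl.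
rewrite !mul1r levy_densE ?addr_gt0// addrAC subrr add0r.
rewrite (_ : 1 - alpha - 1 = - alpha); last ring.
rewrite (_ : 2 * alpha + (1 - alpha) = 1 + alpha); last ring.
by ring.
Qed.

Lemma betaE_infty (R : realType) (alpha : R) : 1 <= alpha -> betaE (2 * alpha) (1 - alpha) = +oo%E.
Proof.
move=> a1; apply/eqyP => A A0.
(* [k] bounds (1 + z)^(-(1+alpha)) from below for z <= 1, so the integrand is at least k/z there;
   [e] is chosen so that the integral of k/z over [[e, 1]] is exactly [A]. *)
pose k : R := 2 `^ (- (1 + alpha)).
have k0 : 0 < k by apply: powR_gt0; rewrite ltr0n.
pose e := expR (- (A / k)).
have e0 : 0 < e by exact: expR_gt0.
have e1 : e < 1 by rewrite -expR0 ltr_expR oppr_lt0 divr_gt0.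
apply: (@le_trans _ _ (\int[@lebesgue_measure R]_(z in `[e, 1%R]) (k%:E * (z^-1)%:E))%E).
  have mi : measurable_fun (`[e, 1] : set (measurableTypeR R)) (fun z : R => (z^-1)%:E).
    apply/measurable_EFinP.
    apply: (@eq_measurable_fun _ _ (measurableTypeR R) R _ (fun z => z `^ (-1))).
      move=> z; rewrite inE/= in_itv/= => /andP[z0 _]; rewrite powR_inv1//.
      exact: le_trans (ltW e0) z0.
    by apply: measurable_funTS; exact: measurable_powR.
  rewrite ge0_integralZl//; last 2 first.
  - by move=> z /=; rewrite in_itv/= => /andP[ez _]; rewrite lee_fin invr_ge0 (le_trans (ltW e0)).
  - by rewrite lee_fin ltW.
  rewrite integral_inv// ln1 sub0r expRK opprK -EFinM.
  by rewrite mulrCA divff ?mulr1// gt_eqF.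
under eq_integral do rewrite -EFinM.
rewrite -integral_indicM; apply: ge0_le_integral => //.
- move=> z _; rewrite lee_fin indicE; have [|_] := boolP (z \in _); last by rewrite mul0r.
  rewrite inE/= in_itv/= => /andP[ez _]; rewrite mul1r; apply: mulr_ge0; first exact: ltW.
  by rewrite invr_ge0 (le_trans (ltW e0)).
- apply/measurable_EFinP; have h : measurable_fun [set: measurableTypeR R] (fun z : R => \1_(`[e, 1]%classic : set R) z * (k * z `^ (-1))).
    apply: (@measurable_funM _ (measurableTypeR R)); first exact: measurable_indic.
    by apply: measurable_funM => //; exact: measurable_powR.
  apply: eq_measurable_fun h => z _; rewrite indicE; have [|_] := boolP (z \in _); last by rewrite !mul0r.
  rewrite inE/= in_itv/= => /andP[ez _]; rewrite powR_inv1//.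
  exact: le_trans (ltW e0) ez.
- by apply/measurable_EFinP; exact: measurable_betaE.
- move=> z _; rewrite lee_fin indicE; have [|_] := boolP (z \in _); last first.
    rewrite mul0r; apply: mulr_ge0; first exact: pos_ind_ge0.
    by apply: mulr_ge0; exact: powR_ge0.
  rewrite inE/= in_itv/= => /andP[ez z1]; have z0 := lt_le_trans e0 ez.
  rewrite pos_ind1// !mul1r mulrC; apply: ler_pM; [by rewrite invr_ge0 ltW|exact: ltW| |].
    rewrite -powR_inv1 ?(ltW z0)//; rewrite (_ : 1 - alpha - 1 = - alpha); last ring.
    rewrite !powRN lef_pV2 ?posrE ?powR_gt0//.
    have := @ger_powR R z; move=> /(_ _ _ _) H.
    by apply: H; rewrite ?z0//.
  rewrite (_ : 2 * alpha + (1 - alpha) = 1 + alpha); last ring.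
  rewrite /k !powRN lef_pV2 ?posrE ?powR_gt0 ?addr_gt0//.
  have a0 : 0 <= 1 + alpha by rewrite addr_ge0// (le_trans _ a1).
  have -> : 2 = 1 + 1 :> R by [].
  by apply: ge0_ler_powR => //; rewrite ?nnegrE ?addr_ge0 ?(ltW z0)// lerD2l.
Qed.

Lemma levy2_wedge_lt1 (R : realType) (alpha C : R) : 0 < alpha -> alpha < 1 ->
  ((C ^+ 2 / 4)%:E * levy2 alpha [set p | (1 < p.1)%R /\ (p.1 - p.2 < 1)%R] = (limit_constant C alpha)%:E)%E.
Proof.
move=> a0 a1; rewrite levy2_wedge// /limit_constant !GammaE.
have := @betaE_gammaE R (2 * alpha) (1 - alpha).
rewrite (_ : 2 * alpha + (1 - alpha) = 1 + alpha); last ring.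
have p0 : 0 < 1 + alpha by rewrite addr_gt0.
have b0 : (0 <= betaE (2 * alpha) (1 - alpha))%E.
  apply: integral_ge0 => z _; rewrite lee_fin; apply: mulr_ge0; first exact: pos_ind_ge0.
  by apply: mulr_ge0; exact: powR_ge0.
have fin (c : R) : 0 < c -> exists2 x, gammaE c = x%:E & 0 <= x.
  move=> c0; exists (fine (gammaE c)); last by rewrite fine_ge0// gammaE_ge0.
  by rewrite fineK// ge0_fin_numE ?gammaE_ge0// gammaE_fin.
have g1 : 1 <= 1 + alpha by rewrite lerDl ltW.
have := gammaE_gt0 g1.
have [x -> _] := fin _ p0.
have a2 : 0 < 2 * alpha by rewrite mulr_gt0.
have [y -> _] := fin _ a2.
have a1' : 0 < 1 - alpha by rewrite subr_gt0.
have [z -> _] := fin _ a1'.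
rewrite lte_fin => x0 /=.
move: b0; generalize (betaE (2 * alpha) (1 - alpha)) => -[b|//|//] _.
  rewrite -!EFinM => -[H]; congr (_%:E).
  have -> : b = y * z / x by rewrite -H mulrAC divff ?mul1r// gt_eqF.
  by field; rewrite gt_eqF.
(* An infinite Beta integral is excluded: times the positive Gamma(1 + alpha) it would be infinite,
   against the finite right side. *)
by rewrite gt0_muley ?lte_fin.
Qed.

(** Read off from the closed form with [C = 1], whose right side is a real number. *)
Lemma levy2_wedge_fin (R : realType) (alpha : R) : 0 < alpha -> alpha < 1 ->
  (levy2 alpha [set p | (1 < p.1)%R /\ (p.1 - p.2 < 1)%R] < +oo)%E.
Proof.
move=> a0 a1; have := levy2_wedge_lt1 1 a0 a1.
case: (levy2 _ _) => [r|//|//]; first by rewrite ltry.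
by rewrite gt0_muley// lte_fin expr1n divr_gt0.
Qed.

(** * The spectral measure *)

(** Independence identifies the joint law with the product of the two laws; boundedness of [u] and
    [v] makes Fubini applicable. *)
Lemma independent_expectation_prod (R : realType) d (T : measurableType d) (P : probability T R)
    (Y Z : {RV P >-> R}) (u v : R -> R) : independent P Y Z ->
  measurable_fun [set: measurableTypeR R] u -> measurable_fun [set: measurableTypeR R] v ->
  (forall x, `|u x| <= 1) -> (forall x, `|v x| <= 1) ->
  \int[P]_w (u (Y w) * v (Z w)) = (\int[P]_w u (Y w)) * (\int[P]_w v (Z w)).
Proof.
move=> hi mu mv u1 v1.
have mY : measurable_fun setT (Y : T -> measurableTypeR R) by have h : measurable_fun setT (Y : T -> R) by exact: measurable_funPT.
have mZ : measurable_fun setT (Z : T -> measurableTypeR R) by have h : measurable_fun setT (Z : T -> R) by exact: measurable_funPT.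
pose YZ : T -> measurableTypeR R * measurableTypeR R := fun w => (Y w, Z w).
have mYZ : measurable_fun setT YZ by exact: measurable_fun_pair.
pose YY : {mfun T >-> measurableTypeR R} := HB.pack (Y : T -> measurableTypeR R) (isMeasurableFun.Build _ _ T (measurableTypeR R) Y mY).
pose ZZ : {mfun T >-> measurableTypeR R} := HB.pack (Z : T -> measurableTypeR R) (isMeasurableFun.Build _ _ T (measurableTypeR R) Z mZ).
have E1 (A B : set R) : measurable A -> measurable B ->
    pushforward P YZ (A `*` B) = (distribution P YY A * distribution P ZZ B)%E.
  by move=> mA mB; rewrite -hi.
have U1 := @product_measure_unique _ _ (measurableTypeR R) (measurableTypeR R) R (distribution P YY) (distribution P ZZ)
  (pushforward P YZ) E1.
have bint d' (T' : measurableType d') (m : probability T' R) (f : T' -> R) : measurable_fun setT f -> (forall x, `|f x| <= 1) ->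
    m.-integrable setT (EFin \o f).
  move=> mf f1; apply: measurable_bounded_integrable => //.
  - exact: (@fin_num_fun_lty _ _ _ m (fin_num_measure m)).
  - by exists 1; split => // M M1 x _ /=; apply: le_trans (f1 x) _; exact: ltW.
have iu := @bint _ (measurableTypeR R) (distribution P YY) u mu u1.
have iv := @bint _ (measurableTypeR R) (distribution P ZZ) v mv v1.
have iuv := integrable_prodM iu iv.
have mp : measurable_fun [set: measurableTypeR R * measurableTypeR R] (EFin \o (fun p => u p.1 * v p.2)).
  by have /integrableP[] := iuv.
have muY : measurable_fun setT (fun w => u (Y w)) by exact: (measurableT_comp mu mY).
have mvZ : measurable_fun setT (fun w => v (Z w)) by exact: (measurableT_comp mv mZ).
have iP : P.-integrable setT (EFin \o (fun w => u (Y w) * v (Z w))).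
  apply: bint; first exact: measurable_funM.
  by move=> w; rewrite normrM mulr_ile1.
have EY : (\int[distribution P YY]_x (u x)%:E = \int[P]_w (u (Y w))%:E)%E.
  apply: integral_distribution; first exact/measurable_EFinP.
  exact: bint.
have EZ : (\int[distribution P ZZ]_x (v x)%:E = \int[P]_w (v (Z w))%:E)%E.
  apply: integral_distribution; first exact/measurable_EFinP.
  exact: bint.
have fZ : (\int[distribution P ZZ]_x (v x)%:E)%E \is a fin_num by exact: integrable_fin_num iv.
have fY : (\int[distribution P YY]_x (u x)%:E)%E \is a fin_num by exact: integrable_fin_num iu.
rewrite /Rintegral -fineM -?EY -?EZ//.
congr fine.
have <- := @integral_pushforward _ _ _ _ _ YZ mYZ P setT _ mp iP measurableT.
rewrite (eq_measure_integral (distribution P YY \x distribution P ZZ)%E); last by move=> A mA _; exact: esym (U1 mYZ A mA).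
rewrite -(integral12_prod_meas1 iuv) /fubini_F/=.
transitivity (\int[distribution P YY]_x ((u x)%:E * \int[distribution P ZZ]_y (v y)%:E))%E.
  by apply: eq_integral => x _; under eq_integral do rewrite EFinM; rewrite integralZl.
by rewrite -(fineK fZ) integralZr.
Qed.

(** * The parallelogram inequality for powers, with its equality case *)

Lemma gt_powR_lt1 (R : realType) (x p : R) : 0 < x -> x < 1 -> p < 1 -> x < x `^ p.
Proof.
move=> x0 x1 p1; rewrite /powR gt_eqF// -{1}(lnK x0) ltr_expR.
have l0 : ln x < 0 by exact: ln_lt0 (introT andP (conj x0 x1)).
by rewrite -subr_gt0 -[X in _ - X]mul1r -mulrBl nmulr_lgt0// subr_lt0.
Qed.

(** The fractions a/(a+b) and b/(a+b) lie strictly between 0 and 1, so each is less than its p-th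
    power, and they add up to 1. *)
Lemma powRD_lt (R : realType) (a b p : R) : 0 < a -> 0 < b -> p < 1 ->
  (a + b) `^ p < a `^ p + b `^ p.
Proof.
move=> a0 b0 p1; have ab0 : 0 < a + b by exact: addr_gt0.
have H c : 0 < c -> c < a + b -> c / (a + b) * (a + b) `^ p < c `^ p.
  move=> c0 cab.
  have := @gt_powR_lt1 R (c / (a + b)) p (divr_gt0 c0 ab0); rewrite ltr_pdivrMr// mul1r => /(_ cab p1) h.
  have -> : c `^ p = (c / (a + b)) `^ p * (a + b) `^ p.
    by rewrite -powRM ?divfK ?gt_eqF// ?divr_ge0 ?ltW.
  by rewrite ltr_pM2r ?powR_gt0.
have := ltrD (H a a0 _) (H b b0 _); rewrite ltrDl ltrDr => /(_ b0 a0).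
by rewrite -mulrDl -mulrDl divff ?gt_eqF// mul1r.
Qed.

(** Concavity of the power p, deduced from convexity of the power 1/p at the points s^p and t^p. *)
Lemma powR_mean_le (R : realType) (s t p : R) : 0 <= s -> 0 <= t -> 0 < p -> p <= 1 ->
  (s `^ p + t `^ p) / 2 <= ((s + t) / 2) `^ p.
Proof.
move=> s0 t0 p0 p1.
have q1 : 1 <= p^-1 by rewrite invf_ge1.
have H : ((s `^ p + t `^ p) / 2) `^ p^-1 <= (s + t) / 2.
  have c : 2^-1 * s `^ p + (1 - 2^-1) * t `^ p = (s `^ p + t `^ p) / 2 by field.
  rewrite -c.
  have -> : (s + t) / 2 = 2^-1 * (s `^ p) `^ p^-1 + (1 - 2^-1) * (t `^ p) `^ p^-1.
    by rewrite -!powRrM divff ?gt_eqF// !powRr1//; field.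
  by apply: (convex_powR q1 (Itv01 _ _)) => //=;
    rewrite ?inE/= ?in_itv/= ?powR_ge0// ?invr_ge0// invf_le1 ?ler1n.
have m0 : 0 <= (s `^ p + t `^ p) / 2 by rewrite divr_ge0// addr_ge0// powR_ge0.
move: H m0; set m := (_ + _ `^ _) / 2 => H m0.
have -> : m = (m `^ p^-1) `^ p by rewrite -powRrM mulVf ?gt_eqF// powRr1.
by apply: ge0_ler_powR; rewrite ?nnegrE ?powR_ge0 ?divr_ge0 ?addr_ge0// ltW.
Qed.

(** With p = alpha/2 and |x|^alpha = (x^2)^p: concavity bounds the mean by ((u+v)^2/2 +
    (u-v)^2/2)^p, which is (u^2 + v^2)^p by the parallelogram law. Strict subadditivity then
    finishes, and it is strict unless u or v vanishes. *)
Lemma powR_parallelogram (R : realType) (u v alpha : R) : 0 < alpha -> alpha < 2 ->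
  (`|u + v| `^ alpha + `|u - v| `^ alpha) / 2 <= `|u| `^ alpha + `|v| `^ alpha ?= iff ((u == 0) || (v == 0)).
Proof.
move=> a0 a2; pose p := alpha / 2.
have p0 : 0 < p by rewrite divr_gt0.
have p1 : p < 1 by rewrite ltr_pdivrMr// mul1r.
have E (x : R) : `|x| `^ alpha = (x ^+ 2) `^ p.
  rewrite -(real_normK (num_real x)) -powR_mulrn// -powRrM; by congr (_ `^ _); rewrite /p; field.
apply/leifP; case: ifPn.
  move=> /orP[/eqP ->|/eqP ->].
    by rewrite add0r sub0r normrN normr0 (@powR0 R alpha (lt0r_neq0 a0)); apply/eqP; field.
  by rewrite addr0 subr0 normr0 (@powR0 R alpha (lt0r_neq0 a0)); apply/eqP; field.
rewrite negb_or => /andP[u0 v0]; rewrite !E.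
apply: (@le_lt_trans _ _ ((((u + v) ^+ 2 + (u - v) ^+ 2) / 2) `^ p)).
  by apply: powR_mean_le; rewrite ?sqr_ge0// ltW.
have -> : ((u + v) ^+ 2 + (u - v) ^+ 2) / 2 = u ^+ 2 + v ^+ 2 by field.
by apply: powRD_lt => //; rewrite exprn_even_gt0.
Qed.

Lemma measurable_pair1 (R : realType) (a : R * R) : measurable [set a].
Proof.
case: a => a b; have -> : [set (a, b)] = [set a] `*` [set b].
  by apply/seteqP; split => -[x y] /= [-> ->].
by apply: measurableX; exact: measurable_set1.
Qed.

Section spectral.
Context (R : realType) (d : measure_display) (T : measurableType d) (P : probability T R).
Context (S1 S2 : {RV P >-> R}) (alpha : R) (X : T -> R * R).
Context (Lambda : {finite_measure set (R * R)%type -> \bar R}).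
Hypothesis alpha0 : 0 < alpha.
Hypothesis alpha2 : alpha < 2.
Hypothesis hS1 : has_law_stable P alpha S1.
Hypothesis hS2 : has_law_stable P alpha S2.
Hypothesis hind : independent P S1 S2.
Hypothesis hX : X = fun w => S1 w *: ((1, 1) : R * R) - S2 w *: ((0, 1) : R * R).
Hypothesis hLambda : spectral_measure P alpha X Lambda.

(** The cosine of a difference splits into products; the sine product has zero expectation because
    the characteristic function is real. *)
Lemma expect_cos_lincomb (a b : R) :
  \int[P]_w cos (a * S1 w - b * S2 w) = stable_cf alpha a * stable_cf alpha b.
Proof.
have mc (c : R) : measurable_fun [set: measurableTypeR R] (fun x => cos (c * x)) by exact: measurable_cosM.
have ms (c : R) : measurable_fun [set: measurableTypeR R] (fun x => sin (c * x)) by exact: measurable_sinM.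
have Ec := independent_expectation_prod hind (mc a) (mc b) (fun x => norm_cos_le1 _) (fun x => norm_cos_le1 _).
have Es := independent_expectation_prod hind (ms a) (ms b) (fun x => norm_sin_le1 _) (fun x => norm_sin_le1 _).
rewrite (stable_law_cos hS1) (stable_law_cos hS2) in Ec.
rewrite (stable_law_sin hS1) mul0r in Es.
under eq_Rintegral do rewrite cosB.
have bint (f g : R -> R) : measurable_fun [set: measurableTypeR R] f -> measurable_fun [set: measurableTypeR R] g ->
    (forall x, `|f x| <= 1) -> (forall x, `|g x| <= 1) -> P.-integrable setT (EFin \o (fun w => f (S1 w) * g (S2 w))).
  move=> mf mg f1 g1; apply: measurable_bounded_integrable => //.
  - exact: (@fin_num_fun_lty _ _ _ P (fin_num_measure P)).
  - have mY : measurable_fun setT (S1 : T -> measurableTypeR R) by have h : measurable_fun setT (S1 : T -> R) by exact: measurable_funPT.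
    have mZ : measurable_fun setT (S2 : T -> measurableTypeR R) by have h : measurable_fun setT (S2 : T -> R) by exact: measurable_funPT.
    apply: measurable_funM; [exact: (measurableT_comp mf mY)|exact: (measurableT_comp mg mZ)].
  - exists 1; split => // M M1 w _ /=; rewrite normrM; apply: le_trans (ltW M1).
    by rewrite mulr_ile1.
rewrite RintegralD//; first by rewrite Ec Es addr0.
- exact: (bint _ _ (mc a) (mc b) (fun x => norm_cos_le1 _) (fun x => norm_cos_le1 _)).
- exact: (bint _ _ (ms a) (ms b) (fun x => norm_sin_le1 _) (fun x => norm_sin_le1 _)).
Qed.

(** The product of [theta] with X is (theta1 + theta2) S1 - theta2 S2, so independence gives its
    characteristic function explicitly; comparing exponents with the spectral form yields the
    identity. *)
Lemma spectral_integral (theta : R * R) :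
  \int[Lambda]_(x in circle R) (`|dot theta x| `^ alpha) =
  `|theta.1 + theta.2| `^ alpha + `|theta.2| `^ alpha.
Proof.
have [_ _ /(_ theta)] := hLambda.
rewrite /expect_cis => -[+ _].
have -> : \int[P]_w cos (dot theta (X w)) = \int[P]_w cos ((theta.1 + theta.2) * S1 w - theta.2 * S2 w).
  by apply: eq_Rintegral => w _; congr cos; rewrite hX /dot/= /GRing.scale/=; ring.
rewrite expect_cos_lincomb /stable_cf -expRD => /expR_inj h.
by apply/eqP; rewrite -eqr_opp; apply/eqP; rewrite -h opprD.
Qed.

Let r : R := (Num.sqrt 2)^-1.

Lemma measurable_circle : measurable (circle R).
Proof.
have m : measurable_fun setT (fun x : R * R => x.1 ^+ 2 + x.2 ^+ 2 : R).
  by apply: measurable_funD; apply: measurable_funX; [exact: measurable_fst|exact: measurable_snd].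
have -> : circle R = setT `&` (fun x : R * R => x.1 ^+ 2 + x.2 ^+ 2) @^-1` [set 1] by rewrite setTI.
exact: m.
Qed.

Let measurable_dot theta : measurable_fun setT (fun x : R * R => `|dot theta x| `^ alpha).
Proof.
apply: (measurableT_comp (measurable_powR alpha)).
apply: measurableT_comp; first exact: normr_measurable.
by apply: measurable_funD; apply: measurable_funM => //.
Qed.

Let integrable_dot theta : Lambda.-integrable (circle R) (EFin \o (fun x : R * R => `|dot theta x| `^ alpha)).
Proof.
apply: measurable_bounded_integrable.
- exact: measurable_circle.
- by rewrite -ge0_fin_numE// fin_num_measure//; exact: measurable_circle.
- exact: (measurable_funTS (measurable_dot theta)).
- exists ((`|theta.1| + `|theta.2|) `^ alpha); split => // M M1 x cx /=.
  apply: le_trans (ltW M1); rewrite ger0_norm ?powR_ge0//.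
  apply: ge0_ler_powR; rewrite ?nnegrE ?addr_ge0 ?(ltW alpha0)//.
  have H (y z : R) : y ^+ 2 + z ^+ 2 = 1 -> `|y| <= 1.
    move=> yz; rewrite -(@ler_pXn2r _ 2)// ?nnegrE// expr1n real_normK ?num_real// -yz.
    by rewrite lerDl sqr_ge0.
  apply: le_trans (ler_normD _ _) _; rewrite !normrM; apply: lerD.
    by rewrite -[leRHS]mulr1; apply: ler_pM => //; exact: H cx.
  by rewrite -[leRHS]mulr1; apply: ler_pM => //; apply: (H _ x.1); rewrite addrC.
Qed.

Lemma circle_diagonal (x : R * R) : circle R x -> x.1 = x.2 -> x = (r, r) \/ x = (- r, - r).
Proof.
case: x => y z; rewrite /circle/= => yz e; rewrite -e in yz *.
have : (y - r) * (y + r) = 0.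
  rewrite -subr_sqr /r exprVn sqr_sqrtr//; lra.
move/eqP; rewrite mulf_eq0 subr_eq0 addr_eq0 => /orP[/eqP ->|/eqP ->]; [by left|by right].
Qed.

Lemma circle_vertical (x : R * R) : circle R x -> x.1 = 0 -> x = (0, 1) \/ x = (0, -1).
Proof.
case: x => y z; rewrite /circle/= => yz e; rewrite e in yz *.
have : (z - 1) * (z + 1) = 0 by rewrite -subr_sqr expr1n; lra.
move/eqP; rewrite mulf_eq0 subr_eq0 addr_eq0 => /orP[/eqP ->|/eqP ->]; [by left|by right].
Qed.

Lemma spectral_support : Lambda (~` [set x | [\/ x = (r, r), x = (- r, - r), x = (0, 1) | x = (0, -1)]]) = 0%E.
Proof.
have [Lc _ _] := hLambda.
(* The defect of [powR_parallelogram] at [u = x.1 - x.2], [v = x.1]. *)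
pose N (x : R * R) : R := `|dot (1, -1) x| `^ alpha + `|dot (1, 0) x| `^ alpha -
   2^-1 * (`|dot (2, -1) x| `^ alpha + `|dot (0, 1) x| `^ alpha).
have NE x : N x = `|x.1 - x.2| `^ alpha + `|x.1| `^ alpha -
  (`|x.1 - x.2 + x.1| `^ alpha + `|x.1 - x.2 - x.1| `^ alpha) / 2.
  rewrite /N.
  have -> : dot (1, -1) x = x.1 - x.2 by rewrite /dot/=; ring.
  have -> : dot (1, 0) x = x.1 by rewrite /dot/=; ring.
  have -> : dot (2, -1) x = x.1 - x.2 + x.1 by rewrite /dot/=; ring.
  have -> : dot (0, 1) x = - (x.1 - x.2 - x.1) by rewrite /dot/=; ring.
  by rewrite normrN mulrC.
have N0 x : 0 <= N x.
  by rewrite NE subr_ge0; exact: (powR_parallelogram _ _ alpha0 alpha2).1.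
(* The equality cases u = 0 and v = 0 are the diagonal and the vertical axis, which meet the circle
   in the four points. *)
have Neq x : N x = 0 -> x.1 = x.2 \/ x.1 = 0.
  rewrite NE => /eqP; rewrite subr_eq0 eq_sym (powR_parallelogram _ _ alpha0 alpha2).2 subr_eq0.
  by move=> /orP[/eqP ->|/eqP ->]; [left|right].
have i1 := integrable_dot (1, -1); have i2 := integrable_dot (1, 0).
have i3 := integrable_dot (2, -1); have i4 := integrable_dot (0, 1).
have mc := measurable_circle.
have i12 := @integrableD _ _ _ _ _ mc _ _ i1 i2.
have i34 := @integrableZl _ _ _ _ _ mc 2^-1 _ (@integrableD _ _ _ _ _ mc _ _ i3 i4).
(* By [spectral_integral] the four terms contribute 1 + 1 - (2 + 2)/2. *)
have IN : (\int[Lambda]_(x in circle R) (N x) = 0)%R.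
  rewrite RintegralB// RintegralD// RintegralZl//; last exact: (@integrableD _ _ _ _ _ mc _ _ i3 i4).
  rewrite RintegralD// !spectral_integral/=.
  rewrite !(addr0, add0r, subrr, normrN, normr1, powR1, normr0).
  rewrite (_ : 2 - 1 = 1); last ring.
  by rewrite normr1 powR1 (powR0 (lt0r_neq0 alpha0)); field.
have iN : Lambda.-integrable (circle R) (EFin \o N) by exact: (@integrableB _ _ _ _ _ mc _ _ i12 i34).
have INE : (\int[Lambda]_(x in circle R) (N x)%:E = 0)%E.
  by rewrite -[LHS]fineK ?integrable_fin_num// -[fine _]/(Rintegral Lambda (circle R) N) IN.
have mN : measurable_fun (circle R) (EFin \o N) by have /integrableP[] := iN.
have : (\int[Lambda]_(x in circle R) `|(EFin \o N) x| = 0)%E.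
  by rewrite -[RHS]INE; apply: eq_integral => x _ /=; rewrite ger0_norm.
move=> /(ae_eq_integral_abs Lambda mc mN) [A [mA A0 HA]].
apply/eqP; rewrite eq_le measure_ge0 andbT.
have msup : measurable [set x : R * R | [\/ x = (r, r), x = (- r, - r), x = (0, 1) | x = (0, -1)]].
  have -> : [set x | [\/ x = (r, r), x = (- r, - r), x = (0, 1) | x = (0, -1)]] =
     [set (r, r)] `|` [set (- r, - r)] `|` [set (0, 1)] `|` [set (0, -1)].
    apply/seteqP; split => x /=; first by move=> [] ->; tauto.
    by move=> [[[]|]|] ->; [constructor 1|constructor 2|constructor 3|constructor 4].
  by do 3 (apply: measurableU; last exact: measurable_pair1); exact: measurable_pair1.
apply: (@le_trans _ _ (Lambda (~` circle R `|` A))).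
  apply: le_measure; rewrite ?inE//; first exact: measurableC.
    by apply: measurableU => //; exact: measurableC.
  move=> x nx; have [cx|] := pselect (circle R x); last by left.
  right; apply: HA => /= h; apply: nx.
  have := h cx => -[] /Neq[/(circle_diagonal cx)[]|/(circle_vertical cx)[]] ->;
    by [constructor 1|constructor 2|constructor 3|constructor 4].
apply: le_trans (measureU2 _ _ _) _ => //; first exact: measurableC.
have e1 : (Lambda (~` circle R) <= 0)%E by rewrite Lc.
have e2 : (Lambda A <= 0)%E by rewrite [X in (X <= _)%E](A0).
by have := leeD e1 e2; rewrite adde0.
Qed.

Lemma integral_set1_measure (a : R * R) (f : R * R -> \bar R) :
  (\int[Lambda]_(x in [set a]) f x = f a * Lambda [set a])%E.
Proof.
transitivity (\int[Lambda]_(x in [set a]) (cst (f a)) x)%E.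
  by apply: eq_integral => x; rewrite inE => ->.
by rewrite integral_cst//; exact: measurable_pair1.
Qed.

Let r0 : 0 < r. Proof. by rewrite invr_gt0 sqrtr_gt0. Qed.

Lemma spectral_atoms (f : R * R -> \bar R) : measurable_fun setT f -> (forall x, 0 <= f x)%E ->
  (\int[Lambda]_x f x = f (r, r) * Lambda [set (r, r)] + f (- r, - r)%R * Lambda [set (- r, - r)%R] +
    f (0%R, 1%R) * Lambda [set (0%R, 1%R)] + f (0, -1)%R * Lambda [set (0, -1)%R])%E.
Proof.
move=> mf f0.
pose A := [set (r, r)] `|` [set (- r, - r)] `|` [set (0, 1)] `|` [set (0, -1)] : set (R * R).
have EA : [set x | [\/ x = (r, r), x = (- r, - r), x = (0, 1) | x = (0, -1)]] = A.
  apply/seteqP; split => x /=; first by move=> [] ->; rewrite /A/=; tauto.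
  by move=> [[[]|]|] ->; [constructor 1|constructor 2|constructor 3|constructor 4].
have mA : measurable A by do 3 (apply: measurableU; last exact: measurable_pair1); exact: measurable_pair1.
have LA : Lambda (~` A) = 0%E by rewrite -EA; exact: spectral_support.
rewrite -(setUv A) ge0_integral_setU//; last 3 first.
- exact: measurableC.
- exact: measurable_funTS.
- exact/disj_setPCl.
have -> : (\int[Lambda]_(x in ~` A) f x = 0)%E.
    transitivity (\int[Lambda]_(x in ~` A) `|f x|)%E.
      by apply: eq_integral => x _; rewrite gee0_abs.
    by apply: integral_abs_eq0 => //; [exact: measurableC|exact: measurable_funTS].
rewrite adde0 /A.
have ne (a b c e : R) : (a != c) || (b != e) -> (a, b) <> (c, e).
  by move=> + [ac be]; rewrite ac be !eqxx.
have U (B : set (R * R)) a : measurable B -> ~ B a ->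
   (\int[Lambda]_(x in B `|` [set a]) f x = \int[Lambda]_(x in B) f x + f a * Lambda [set a])%E.
  move=> mB nB; rewrite ge0_integral_setU ?integral_set1_measure//.
  - exact: measurable_pair1.
  - exact: measurable_funTS.
  - by apply/disj_setPRL => x /= ->.
rewrite !U ?integral_set1_measure//; do ?(apply: measurableU => //); try exact: measurable_pair1.
- by move=> /= [h _]; have := r0; rewrite -oppr_lt0 h => /(lt_trans r0); rewrite ltxx.
- move=> /= [] [h _]; first by have := r0; rewrite h ltxx.
  by have := r0; rewrite -oppr_lt0 h ltxx.
- move=> /= [[|]|].
  + by move=> [h _]; have := r0; rewrite h ltxx.
  + by move=> [h _]; have := r0; rewrite -oppr_lt0 h ltxx.
  + by move=> [h]; have := ltrN10 R; rewrite h ltNge ler01.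
Qed.

Let circle_r : circle R (r, r).
Proof. by rewrite /circle/= /r exprVn sqr_sqrtr//; field. Qed.

Lemma spectral_sym (a b : R) : Lambda [set (- a, - b)] = Lambda [set (a, b)].
Proof.
have [_ Ls _] := hLambda.
rewrite -(Ls _ (measurable_pair1 (- a, - b))); congr (Lambda _).
apply/seteqP; split => -[x y] /=; last by move=> [-> ->].
by move=> [/oppr_inj -> /oppr_inj ->].
Qed.

(** Linear equations for the two unknown masses: [theta = (1, -1)] isolates the mass on the axis and
    [theta = (1, 0)] the one on the diagonal. *)
Lemma spectral_integral_atoms (theta : R * R) :
  ((`|theta.1 + theta.2| `^ alpha + `|theta.2| `^ alpha)%:E =
   (2 * `|(theta.1 + theta.2) * r| `^ alpha)%:E * Lambda [set (r, r)] +
   (2 * `|theta.2| `^ alpha)%:E * Lambda [set (0%R, 1%R)])%E.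
Proof.
rewrite -spectral_integral fineK; last by apply: integrable_fin_num; [exact: measurable_circle|exact: integrable_dot].
rewrite integral_mkcond spectral_atoms; last 2 first.
- by apply/(measurable_restrictT _ measurable_circle)/measurable_EFinP; exact: measurable_funTS.
- by move=> x; rewrite /patch; case: ifP => // _; rewrite lee_fin powR_ge0.
have cN (x : R * R) : circle R (- x.1, - x.2) = circle R x by rewrite /circle/= !sqrrN.
have c01 : circle R (0, 1) by rewrite /circle/= expr0n expr1n add0r.
rewrite /patch !mem_set//; last 2 first.
- by rewrite -[0]oppr0; rewrite (cN (0, 1)).
- by rewrite (cN (r, r)).
have := spectral_sym r r; rewrite /= => ->.
have := spectral_sym 0 1; rewrite oppr0 /= => ->.
have fr : Lambda [set (r, r)] \is a fin_num by apply: fin_num_measure; exact: measurable_pair1.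
have fs : Lambda [set (0, 1)] \is a fin_num by apply: fin_num_measure; exact: measurable_pair1.
rewrite -(fineK fr) -(fineK fs) -!EFinM -!EFinD; congr (_%:E).
have -> : dot theta (- r, - r) = - ((theta.1 + theta.2) * r) by rewrite /dot/=; ring.
have -> : dot theta (r, r) = (theta.1 + theta.2) * r by rewrite /dot/=; ring.
have -> : dot theta (0, 1) = theta.2 by rewrite /dot/=; ring.
have -> : dot theta (0, -1) = - theta.2 by rewrite /dot/=; ring.
by rewrite !normrN; ring.
Qed.

Lemma spectral_mass01 : Lambda [set (0, 1)] = (1 / 2)%:E.
Proof.
have := spectral_integral_atoms (1, -1); rewrite /= subrr mul0r normr0 (powR0 (lt0r_neq0 alpha0)).
rewrite normrN normr1 powR1 mulr0 mul0e !add0r mulr1.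
have fs : Lambda [set (0, 1)] \is a fin_num by apply: fin_num_measure; exact: measurable_pair1.
rewrite -(fineK fs) -EFinM => -[]; move: (fine _) => y h; congr (_%:E); lra.
Qed.

Lemma spectral_massrr : Lambda [set (r, r)] = (2 `^ (alpha / 2) / 2)%:E.
Proof.
have := spectral_integral_atoms (1, 0); rewrite /= !addr0 normr0 (powR0 (lt0r_neq0 alpha0)).
rewrite normr1 powR1 mul1r mulr0 mul0e !addr0.
have fs : Lambda [set (r, r)] \is a fin_num by apply: fin_num_measure; exact: measurable_pair1.
rewrite -(fineK fs) -EFinM => -[h]; congr (_%:E).
rewrite ger0_norm ?(ltW r0)// in h.
have k : r `^ alpha * 2 `^ (alpha / 2) = 1.
  have -> : r = 2 `^ (- 2^-1) by rewrite powRN powR12_sqrt.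
  rewrite -!powRrM -powRD ?pnatr_eq0 ?implybT//.
  by rewrite (_ : _ + _ = 0) ?powRr0//; field.
rewrite -[LHS]mulr1 [X in _ * X](_ : 1 = r `^ alpha * 2 `^ (alpha / 2))//.
transitivity ((2 * r `^ alpha * fine (Lambda [set (r, r)])) * 2 `^ (alpha / 2) / 2); first by field.
by rewrite -h mul1r.
Qed.
End spectral.

(** * Evaluation of L on the atoms *)

(* A pair [(c, v)] stands for the atom [c *: v] of the spectral measure. *)
Definition atom_dirs (R : realType) : seq (R * (R * R)) :=
  [:: ((Num.sqrt 2)^-1, (1, 1)); ((Num.sqrt 2)^-1, (-1, -1)); (1, (0, 1)); (1, (0, -1))].

(** One formula for all masses: c^(-alpha) is 2^(alpha/2) for the diagonal atoms and 1 for the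
    vertical ones. *)
Definition atom_weight (R : realType) (alpha c : R) : R := c `^ (- alpha) / 2.

(** The direction [v] will be the unnormalised one, such as [(1, 1)], so that no power of the square
    root of 2 appears. *)
Definition ray (R : realType) (alpha : R) (F : set (R * R)) (v : R * R) : \bar R :=
  (\int[@lebesgue_measure R]_s (levy_dens alpha s * \1_F (s *: v))%:E)%E.

Definition ray2 (R : realType) (alpha : R) (F : set (R * R)) (v w : R * R) : \bar R :=
  (\int[@lebesgue_measure R]_s \int[@lebesgue_measure R]_t
     (levy_dens alpha s * (levy_dens alpha t * \1_F (s *: v + t *: w)))%:E)%E.

Lemma ge0_lebesgueZl (R : realType) (k : R) (f : R -> \bar R) :
  measurable_fun [set: measurableTypeR R] f -> (forall x, 0 <= f x)%E -> 0 <= k ->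
  (\int[@lebesgue_measure R]_x (k%:E * f x) = k%:E * \int[@lebesgue_measure R]_x f x)%E.
Proof. by move=> mf f0 k0; rewrite ge0_integralZl. Qed.

Section Lformula.
Context (R : realType) (Lambda : {finite_measure set (R * R)%type -> \bar R}) (alpha C : R).
Hypothesis alpha0 : 0 < alpha.
Hypothesis HL : forall f, measurable_fun setT f -> (forall x, 0 <= f x)%E ->
  (\int[Lambda]_x f x = \sum_(i <- atom_dirs R) (atom_weight alpha i.1)%:E * f (i.1 *: i.2))%E.

Let ml := @measurable_levy_dens R alpha.
Let l0 s : 0 <= levy_dens alpha s. Proof. by apply: levy_dens_ge0; exact: ltW. Qed.
Let w0 c : 0 <= atom_weight alpha c. Proof. by rewrite divr_ge0// powR_ge0. Qed.

Lemma circle_atom (i : R * (R * R)) : i \in atom_dirs R -> circle R (i.1 *: i.2) /\ 0 < i.1.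
Proof.
have r2 : ((Num.sqrt 2)^-1) ^+ 2 = 2^-1 :> R by rewrite exprVn sqr_sqrtr.
rewrite !inE => /or4P[] /eqP ->; rewrite /circle/= /GRing.scale/= ?invr_gt0; split => //.
- by rewrite !mulr1 r2; field.
- by rewrite !mulrN1 !sqrrN r2; field.
- by rewrite !mul1r expr0n expr1n add0r.
- by rewrite !mul1r expr0n sqrrN expr1n add0r.
Qed.

Lemma measurable_affine (a v : R * R) : measurable_fun [set: measurableTypeR R] (fun s : R => a + s *: v).
Proof.
apply: measurable_fun_pair.
  by apply: measurable_funD => //; apply: measurable_funM.
by apply: measurable_funD => //; apply: measurable_funM.
Qed.

Lemma measurable_scale_point (a : R * R) (s : R) : measurable_fun [set: R * R] (fun x : R * R => a + s *: x).
Proof.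
apply: measurable_fun_pair.
  by apply: measurable_funD => //; apply: measurable_funM => //; exact: measurable_fst.
by apply: measurable_funD => //; apply: measurable_funM => //; exact: measurable_snd.
Qed.

(* Moving the radius of an atom from the direction to the Levy variable absorbs
   its weight. *)
Lemma levy_scale (c : R) (G : R -> \bar R) : 0 < c ->
  measurable_fun [set: measurableTypeR R] G -> (forall s, 0 <= G s)%E ->
  ((atom_weight alpha c)%:E * \int[@lebesgue_measure R]_s ((levy_dens alpha s)%:E * G (s * c)%R) =
   (2^-1)%:E * \int[@lebesgue_measure R]_s ((levy_dens alpha s)%:E * G s))%E.
Proof.
move=> c0 mG G0.
pose g s := ((levy_dens alpha s)%:E * G s)%E.
have mg : measurable_fun [set: measurableTypeR R] g.
  by apply: emeasurable_funM => //; apply/measurable_EFinP.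
have g0 s : (0 <= g s)%E by apply: mule_ge0; rewrite ?lee_fin.
have H := @ge0_integral_scale R c g c0 mg g0.
have -> : (\int[@lebesgue_measure R]_s ((levy_dens alpha s)%:E * G s) = c%:E * \int[@lebesgue_measure R]_x g (c * x)%R)%E.
  by rewrite H muleA -EFinM divff ?gt_eqF// mul1e.
have mG' : measurable_fun [set: measurableTypeR R] (fun s => G (s * c)).
  have h : measurable_fun [set: measurableTypeR R] (fun s : R => s * c) by exact: measurable_funM.
  exact: (measurableT_comp mG h).
have mg' : measurable_fun [set: measurableTypeR R] (fun s => g (c * s)).
  have h : measurable_fun [set: measurableTypeR R] (fun s : R => c * s) by exact: measurable_funM.
  exact: (measurableT_comp mg h).
have mG2 : measurable_fun [set: measurableTypeR R] (fun s => (levy_dens alpha s)%:E * G (s * c)%R)%E.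
  by apply: emeasurable_funM => //; apply/measurable_EFinP.
have L1 := @ge0_integralZl _ (measurableTypeR R) R (@lebesgue_measure R) setT measurableT _ mG2 (atom_weight alpha c)%:E.
rewrite -L1; last 2 first.
- by move=> s _; apply: mule_ge0; rewrite ?lee_fin.
- by rewrite lee_fin.
have c2 : (0 <= (2^-1 * c)%:E)%E by rewrite lee_fin; apply: mulr_ge0; [rewrite invr_ge0|exact: ltW].
have L2 := @ge0_integralZl _ (measurableTypeR R) R (@lebesgue_measure R) setT measurableT _ mg' (2^-1 * c)%:E (fun s _ => g0 _) c2.
rewrite muleA -EFinM -L2.
apply: eq_integral => s _; rewrite /g [c * s]mulrC !muleA -!EFinM; congr (_%:E * _)%E.
have [s0|s0] := leP s 0; first by rewrite !levy_dens0 ?mulr0// pmulr_lle0.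
rewrite !levy_densE ?mulr_gt0// powRM ?(ltW c0) ?(ltW s0)// /atom_weight.
have -> : c `^ (- alpha) = c * c `^ (- (1 + alpha)).
  by rewrite -{2}(powRr1 (ltW c0)) -powRD ?(gt_eqF c0) ?implybT//; congr (_ `^ _); ring.
by ring.
Qed.

Lemma power_measure1 (F : set (R * R)) (s : R) : measurable F ->
  (power_measure Lambda (directions_into F (cons_tuple s [tuple])) =
   \sum_(i <- atom_dirs R) (atom_weight alpha i.1)%:E * (\1_F (s *: (i.1 *: i.2)))%:E)%E.
Proof.
move=> mF.
transitivity (\int[Lambda]_x (\1_(circle R `&` [set x | F (s *: x)]) x)%:E)%E.
  rewrite /=; apply: eq_integral => x _; congr (_%:E); rewrite !indicE; congr ((_ : bool)%:R).
  apply/idP/idP; rewrite !inE /directions_into /= big_ord_recl big_ord0 !tnth0 addr0.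
    by move=> [H ?]; split => //; have := H ord0; rewrite tnth0.
  by move=> [H ?]; split => // i; rewrite (ord1 i) tnth0.
have mA : measurable (circle R `&` [set x | F (s *: x)]).
  apply: measurableI; first exact: measurable_circle.
  rewrite -[X in measurable X]setTI.
  have h : measurable_fun [set: R * R] (fun x : R * R => s *: x).
    by have := measurable_scale_point 0 s; apply: eq_measurable_fun => x _; rewrite add0r.
  exact: h.
rewrite HL//; last first.
  by apply/measurable_EFinP; exact: measurable_indic.
apply: eq_big_seq => i /circle_atom[ci _]; congr (_ * _%:E)%E.
rewrite !indicE; congr ((_ : bool)%:R); apply/idP/idP; rewrite !inE//=; first by case.
Qed.

(** By [levy_scale] every atom, whatever its mass, counts as one half of the Levy mass along its
    unnormalised direction; hence the factor [C / 2]. *)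
Lemma L1E (F : set (R * R)) : measurable F ->
  (L C Lambda F 1 alpha = (C / 2)%:E * \sum_(i <- atom_dirs R) ray alpha F i.2)%E.
Proof.
move=> mF; rewrite /L (_ : C ^+ 1 / _ = C); last by rewrite expr1 divr1.
rewrite [RHS](_ : _ = C%:E * ((2^-1)%:E * \sum_(i <- atom_dirs R) ray alpha F i.2))%E; last by rewrite muleA -EFinM.
congr (_ * _)%E.
have mI i : measurable_fun [set: measurableTypeR R] (fun s : R => \1_F (s *: i) : R).
  have h : measurable_fun [set: measurableTypeR R] (fun s : R => s *: i).
    by have := measurable_affine 0 i; apply: eq_measurable_fun => x _; rewrite add0r.
  exact: (measurableT_comp (measurable_indic mF) h).
transitivity (\int[@lebesgue_measure R]_s (\sum_(i <- atom_dirs R)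
   ((atom_weight alpha i.1)%:E * ((levy_dens alpha s)%:E * (\1_F (s *: (i.1 *: i.2)))%:E))))%E.
  rewrite /iterated_integral integral_mkcond; apply: eq_integral => s _.
  rewrite /patch; have [|] := boolP (s \in _).
    rewrite inE/= in_itv/= andbT => s0.
    have := power_measure1 s mF; rewrite /= => ->.
    rewrite ge0_sume_distrl; last first.
      by move=> i _; apply: mule_ge0; rewrite lee_fin.
    rewrite big_ord_recl big_ord0 mulr1 tnth0 -levy_densE//.
    by apply: eq_bigr => i _; rewrite -muleA [X in (_ * X)%E]muleC.
  rewrite notin_setE/= in_itv/= andbT => /negP; rewrite -leNgt => s0.
  by rewrite big1// => i _; rewrite levy_dens0// mul0e mule0.
rewrite ge0_integral_sum//; last 2 first.
- move=> i; apply: emeasurable_funM => //; apply: emeasurable_funM; apply/measurable_EFinP => //.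
- move=> i s _; apply: mule_ge0; first by rewrite lee_fin.
  by apply: mule_ge0; rewrite lee_fin.
rewrite ge0_sume_distrr; last first.
  move=> i _; apply: integral_ge0 => s _; rewrite lee_fin; exact: mulr_ge0.
apply: eq_big_seq => i /circle_atom[_ i0].
rewrite ge0_integralZl//; last 3 first.
- by apply: emeasurable_funM; apply/measurable_EFinP => //; exact: mI.
- by move=> s _; apply: mule_ge0; rewrite lee_fin.
- by rewrite lee_fin.
under eq_integral do rewrite scalerA.
rewrite (levy_scale (G := fun s => (\1_F (s *: i.2))%:E))//.
by apply/measurable_EFinP; exact: mI.
Qed.

Let measurable_comb (v w : R * R) :
  measurable_fun [set: measurableTypeR R * measurableTypeR R] (fun p => p.1 *: v + p.2 *: w).
Proof.
have m1 (a : R) : measurable_fun [set: measurableTypeR R * measurableTypeR R] (fun p => p.1 * a).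
  by apply: measurable_funM => //; exact: measurable_fst.
have m2 (a : R) : measurable_fun [set: measurableTypeR R * measurableTypeR R] (fun p => p.2 * a).
  by apply: measurable_funM => //; exact: measurable_snd.
by apply: measurable_fun_pair; apply: measurable_funD; [exact: m1|exact: m2|exact: m1|exact: m2].
Qed.

Let measurable_indic_comb (F : set (R * R)) (v w : R * R) : measurable F ->
  measurable_fun [set: measurableTypeR R * measurableTypeR R] (fun p => \1_F (p.1 *: v + p.2 *: w) : R).
Proof. by move=> mF; exact: (measurableT_comp (measurable_indic mF) (measurable_comb v w)). Qed.

Let pairs := [seq (i, j) | i <- atom_dirs R, j <- atom_dirs R].

Lemma power_measure2 (F : set (R * R)) (s t : R) : measurable F ->
  (power_measure Lambda (directions_into F (cons_tuple s (cons_tuple t [tuple]))) =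
   \sum_(p <- pairs) (atom_weight alpha p.1.1 * atom_weight alpha p.2.1)%:E *
     (\1_F (s *: (p.1.1 *: p.1.2) + t *: (p.2.1 *: p.2.2)))%:E)%E.
Proof.
move=> mF.
pose g x : \bar R := (\sum_(j <- atom_dirs R) (atom_weight alpha j.1)%:E * (\1_F (s *: x + t *: (j.1 *: j.2)))%:E)%E.
have g0 x : (0 <= g x)%E by apply: sume_ge0 => j _; apply: mule_ge0; rewrite lee_fin.
have mg : measurable_fun [set: R * R] g.
  apply: emeasurable_sum => j; apply: emeasurable_funM => //; apply/measurable_EFinP.
  have h : measurable_fun [set: R * R] (fun x : R * R => s *: x + t *: (j.1 *: j.2)).
    by have := measurable_scale_point (t *: (j.1 *: j.2)) s; apply: eq_measurable_fun => x _; rewrite addrC.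
  exact: (measurableT_comp (measurable_indic mF) h).
transitivity (\int[Lambda]_x ((\1_(circle R) x)%:E * g x))%E.
  rewrite /=; apply: eq_integral => x _.
  transitivity (\int[Lambda]_y (\1_(circle R) x * \1_(circle R `&` [set y | F (s *: x + t *: y)]) y)%:E)%E.
    apply: eq_integral => y _; congr (_%:E); rewrite !indicE -natrM mulnb; congr ((_ : bool)%:R).
    apply/idP/idP; rewrite ?inE /directions_into /= !big_ord_recl big_ord0 !tnth0 !tnthS !tnth0 addr0.
      move=> [H K]; have := H ord0; have := H (lift ord0 ord0); rewrite tnthS !tnth0 => cy cx.
      by rewrite !mem_set.
    move=> /andP[]; rewrite !inE => cx [/= cy K]; split => // i.
    by case: (unliftP ord0 i) => [j ->|->]; rewrite ?tnthS ?tnth0// (ord1 j) tnth0.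
  under eq_integral do rewrite EFinM.
  have mA : measurable (circle R `&` [set y | F (s *: x + t *: y)]).
    apply: measurableI; first exact: measurable_circle.
    by rewrite -[X in measurable X]setTI; exact: measurable_scale_point.
  rewrite ge0_integralZl//; last first.
    by apply/measurable_EFinP; exact: measurable_indic.
  congr (_ * _)%E; rewrite HL//; last first.
    by apply/measurable_EFinP; exact: measurable_indic.
  apply: eq_big_seq => j /circle_atom[cj _]; congr (_ * _%:E)%E.
  by rewrite !indicE; congr ((_ : bool)%:R); apply/idP/idP; rewrite !inE//=; case.
rewrite HL; last 2 first.
- by apply: emeasurable_funM => //; apply/measurable_EFinP; apply: measurable_indic; exact: measurable_circle.
- by move=> x; apply: mule_ge0 => //; rewrite lee_fin.
rewrite big_allpairs; apply: eq_big_seq => i /circle_atom[ci _].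
rewrite indicE mem_set// mul1e /g ge0_sume_distrr; last first.
  by move=> j _; apply: mule_ge0; rewrite lee_fin.
by apply: eq_bigr => j _; rewrite muleA -EFinM.
Qed.

Let ray2_scale (F : set (R * R)) (c c' : R) (v w : R * R) : measurable F -> 0 < c -> 0 < c' ->
  ((atom_weight alpha c)%:E * ((atom_weight alpha c')%:E * ray2 alpha F (c *: v) (c' *: w)) =
   (4^-1)%:E * ray2 alpha F v w)%E.
Proof.
move=> mF c0 c'0.
pose H v w s : \bar R := (\int[@lebesgue_measure R]_t ((levy_dens alpha t)%:E * (\1_F (s *: v + t *: w))%:E))%E.
have mi v' w' : measurable_fun [set: measurableTypeR R * measurableTypeR R]
    (fun p => (levy_dens alpha p.2)%:E * (\1_F (p.1 *: v' + p.2 *: w'))%:E)%E.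
  apply: emeasurable_funM; apply/measurable_EFinP; last exact: measurable_indic_comb.
  by apply: (measurableT_comp (f := levy_dens alpha)); [exact: ml|exact: measurable_snd].
have mH v' w' : measurable_fun [set: measurableTypeR R] (H v' w').
  by apply: (@measurable_fun_fubini_tonelli_F _ _ (measurableTypeR R) (measurableTypeR R) R (@lebesgue_measure R) _ (mi v' w')) => p; apply: mule_ge0; rewrite lee_fin.
have H0 v' w' s : (0 <= H v' w' s)%E by apply: integral_ge0 => t _; apply: mule_ge0; rewrite lee_fin.
have ms (s : R) (u u' : R * R) : measurable_fun [set: measurableTypeR R] (fun t : R => (\1_F (s *: u' + t *: u) : R)%:E).
  by apply/measurable_EFinP; exact: (measurableT_comp (measurable_indic mF) (measurable_affine _ _)).
have mlE : measurable_fun [set: measurableTypeR R] (fun s => (levy_dens alpha s)%:E) by exact/measurable_EFinP.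
have E v' w' : (ray2 alpha F v' w' = \int[@lebesgue_measure R]_s ((levy_dens alpha s)%:E * H v' w' s))%E.
  apply: eq_integral => s _; rewrite /H -ge0_lebesgueZl//.
  - by apply: emeasurable_funM => //; exact: ms.
  - by move=> t; apply: mule_ge0; rewrite lee_fin.
have E1 : ((atom_weight alpha c')%:E * ray2 alpha F (c *: v) (c' *: w) =
   \int[@lebesgue_measure R]_s ((levy_dens alpha s)%:E * ((2^-1)%:E * H v w (s * c)%R)))%E.
  have mK : measurable_fun [set: measurableTypeR R] (fun s => (levy_dens alpha s)%:E * H (c *: v) (c' *: w) s)%E by exact: emeasurable_funM.
  have K0 s : (0 <= (levy_dens alpha s)%:E * H (c *: v) (c' *: w) s)%E by apply: mule_ge0; rewrite ?lee_fin.
  transitivity (\int[@lebesgue_measure R]_s ((atom_weight alpha c')%:E * ((levy_dens alpha s)%:E * H (c *: v) (c' *: w) s)))%E.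
    by rewrite (ge0_lebesgueZl mK K0 (w0 c')) -E.
  apply: eq_integral => s _; rewrite muleCA; congr (_ * _)%E.
  have := @levy_scale c' (fun t => (\1_F ((s * c) *: v + t *: w))%:E) c'0 (ms _ _ _).
  rewrite /H => <-; last by move=> t; rewrite lee_fin.
  by congr (_ * _)%E; apply: eq_integral => t _; rewrite !scalerA.
rewrite E1 (@levy_scale c (fun s => (2^-1)%:E * H v w s)%E c0); last 2 first.
- exact: measurable_funeM.
- by move=> s; apply: mule_ge0.
rewrite E; under eq_integral do rewrite muleCA.
rewrite ge0_integralZl//; last 2 first.
- exact: emeasurable_funM.
- by move=> s _; apply: mule_ge0; rewrite ?lee_fin.
by rewrite muleA -EFinM -invfM -natrM.
Qed.

(** The factor is C^2/2! times one half for each of the two atoms of a pair; the sum runs over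
    ordered pairs. *)
Lemma L2E (F : set (R * R)) : measurable F ->
  (L C Lambda F 2 alpha = (C ^+ 2 / 8)%:E * \sum_(i <- atom_dirs R) \sum_(j <- atom_dirs R) ray2 alpha F i.2 j.2)%E.
Proof.
move=> mF; rewrite /L (_ : C ^+ 2 / (2`!)%:R = C ^+ 2 / 2)//.
rewrite [RHS](_ : _ = (C ^+ 2 / 2)%:E * ((4^-1)%:E * \sum_(p <- pairs) ray2 alpha F p.1.2 p.2.2))%E; last first.
  by rewrite big_allpairs muleA -EFinM; congr (_%:E * _)%E; field.
congr (_ * _)%E.
pose g p s t := (atom_weight alpha p.1.1 * (atom_weight alpha p.2.1 * (levy_dens alpha s * (levy_dens alpha t *
     \1_F (s *: (p.1.1 *: p.1.2) + t *: (p.2.1 *: p.2.2)))))).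
have g0 p s t : 0 <= g p s t by do 4 apply: mulr_ge0 => //.
have mg p : measurable_fun [set: measurableTypeR R * measurableTypeR R] (fun x => (g p x.1 x.2)%:E).
  apply/measurable_EFinP; apply: measurable_funM => //; apply: measurable_funM => //.
  apply: measurable_funM; first by apply: (measurableT_comp (f := levy_dens alpha)); [exact: ml|exact: measurable_fst].
  apply: measurable_funM; first by apply: (measurableT_comp (f := levy_dens alpha)); [exact: ml|exact: measurable_snd].
  exact: measurable_indic_comb.
transitivity (\int[@lebesgue_measure R]_s \int[@lebesgue_measure R]_t (\sum_(p <- pairs) (g p s t)%:E))%E.
  have gs s t p : s <= 0 -> g p s t = 0 by move=> s0; rewrite /g levy_dens0// !(mul0r, mulr0).
  have gt s t p : t <= 0 -> g p s t = 0 by move=> t0; rewrite /g (levy_dens0 _ t0) !(mul0r, mulr0).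
  rewrite /iterated_integral integral_mkcond; apply: eq_integral => s _.
  rewrite /patch; have [|] := boolP (s \in _); last first.
    rewrite notin_setE/= in_itv/= andbT => /negP; rewrite -leNgt => s0.
    by rewrite integral0_eq// => t _; rewrite big1// => p _; rewrite gs.
  rewrite inE/= in_itv/= andbT => s0.
  rewrite integral_mkcond; apply: eq_integral => t _.
  rewrite /patch; have [|] := boolP (t \in _); last first.
    rewrite notin_setE/= in_itv/= andbT => /negP; rewrite -leNgt => t0.
    by rewrite big1// => p _; rewrite gt.
  rewrite inE/= in_itv/= andbT => t0.
  have := power_measure2 s t mF; rewrite /= => ->.
  rewrite ge0_sume_distrl; last first.
    by move=> i _; apply: mule_ge0; rewrite lee_fin// mulr_ge0.
  rewrite !big_ord_recl big_ord0 mulr1 !tnth0 tnthS tnth0 -!levy_densE//.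
  by apply: eq_bigr => i _; rewrite -!EFinM /g; congr (_%:E); ring.
under eq_integral => s _.
  rewrite ge0_integral_sum//; last 2 first.
  - by move=> p; have := measurableT_comp (mg p) (@pair1_measurable _ _ (measurableTypeR R) (measurableTypeR R) s).
  - by move=> p t _; rewrite lee_fin.
  over.
rewrite ge0_integral_sum//; last 2 first.
- move=> p; apply: (@measurable_fun_fubini_tonelli_F _ _ (measurableTypeR R) (measurableTypeR R) R (@lebesgue_measure R) _ (mg p)) => x.
  by rewrite lee_fin.
- by move=> p s _; apply: integral_ge0 => t _; rewrite lee_fin.
rewrite ge0_sume_distrr; last first.
  move=> p _; apply: integral_ge0 => s _; apply: integral_ge0 => t _.
  by rewrite lee_fin; apply: mulr_ge0 => //; apply: mulr_ge0.
rewrite !big_allpairs; apply: eq_big_seq => i /circle_atom[_ i0]; apply: eq_big_seq => j /circle_atom[_ j0].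
rewrite -(@ray2_scale F i.1 j.1)// /ray2/=.
pose k s t : R := levy_dens alpha s * (levy_dens alpha t * \1_F (s *: (i.1 *: i.2) + t *: (j.1 *: j.2))).
have k0 s t : 0 <= k s t by do 2 apply: mulr_ge0 => //.
have mk : measurable_fun [set: measurableTypeR R * measurableTypeR R] (fun x => (k x.1 x.2)%:E).
  apply/measurable_EFinP.
  apply: measurable_funM; first by apply: (measurableT_comp (f := levy_dens alpha)); [exact: ml|exact: measurable_fst].
  apply: measurable_funM; first by apply: (measurableT_comp (f := levy_dens alpha)); [exact: ml|exact: measurable_snd].
  exact: measurable_indic_comb.
have mks s : measurable_fun [set: measurableTypeR R] (fun t => (k s t)%:E).
  exact: (measurableT_comp mk (@pair1_measurable _ _ (measurableTypeR R) (measurableTypeR R) s)).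
have mK : measurable_fun [set: measurableTypeR R] (fun s => \int[@lebesgue_measure R]_t (k s t)%:E)%E.
  by apply: (@measurable_fun_fubini_tonelli_F _ _ (measurableTypeR R) (measurableTypeR R) R (@lebesgue_measure R) _ mk) => x; rewrite lee_fin.
have K0 s : (0 <= \int[@lebesgue_measure R]_t (k s t)%:E)%E by apply: integral_ge0 => t _; rewrite lee_fin.
transitivity (\int[@lebesgue_measure R]_s ((atom_weight alpha i.1 * atom_weight alpha j.1)%:E * \int[@lebesgue_measure R]_t (k s t)%:E))%E.
  apply: eq_integral => s _.
  rewrite -(ge0_lebesgueZl (mks s) _ (mulr_ge0 (w0 i.1) (w0 j.1))); last by move=> t; rewrite lee_fin.
  by apply: eq_integral => t _; rewrite -EFinM; congr (_%:E); rewrite /g /k/=; ring.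
by rewrite (ge0_lebesgueZl mK K0 (mulr_ge0 (w0 i.1) (w0 j.1))) EFinM muleA.
Qed.
End Lformula.

(** Puts the spectral measure in the atomic form from which [L] is evaluated. *)
Lemma spectral_sum (R : realType) (d : measure_display) (T : measurableType d) (P : probability T R)
  (S1 S2 : {RV P >-> R}) (alpha : R) (X : T -> R * R)
  (Lambda : {finite_measure set (R * R)%type -> \bar R})
  (alpha0 : 0 < alpha) (alpha2 : alpha < 2)
  (hS1 : has_law_stable P alpha S1) (hS2 : has_law_stable P alpha S2) (hind : independent P S1 S2)
  (hX : X = fun w => S1 w *: ((1, 1) : R * R) - S2 w *: ((0, 1) : R * R))
  (hLambda : spectral_measure P alpha X Lambda) (f : R * R -> \bar R) :
  measurable_fun setT f -> (forall x, 0 <= f x)%E ->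
  (\int[Lambda]_x f x = \sum_(i <- atom_dirs R) (atom_weight alpha i.1)%:E * f (i.1 *: i.2))%E.
Proof.
move=> mf f0; rewrite (spectral_atoms alpha0 alpha2 hS1 hS2 hind hX hLambda mf f0).
rewrite (spectral_sym hLambda).
have := spectral_sym hLambda 0 1; rewrite oppr0 => ->.
rewrite (spectral_massrr alpha0 alpha2 hS1 hS2 hind hX hLambda).
rewrite (spectral_mass01 alpha0 alpha2 hS1 hS2 hind hX hLambda).
have w1 : atom_weight alpha (1 : R) = 1 / 2 by rewrite /atom_weight powR1.
have wr : atom_weight alpha (Num.sqrt 2)^-1 = 2 `^ (alpha / 2) / 2 :> R.
  congr (_ / _); have -> : (Num.sqrt 2)^-1 = 2 `^ (- 2^-1) :> R by rewrite powRN powR12_sqrt.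
  by rewrite -powRrM; congr (_ `^ _); rewrite mulrNN mulrC.
rewrite /atom_dirs !big_cons big_nil /= w1 wr adde0 !addeA.
have sc (c x y : R) : c *: (x, y) = (c * x, c * y) by [].
by rewrite !sc !(mulr1, mulrN1, mulr0); congr (_ + _ + _ + _)%E; rewrite muleC.
Qed.

Section rays.
Context (R : realType) (alpha : R).
Hypothesis alpha0 : 0 < alpha.

Let ml := @measurable_levy_dens R alpha.
Let l0 s : 0 <= levy_dens alpha s. Proof. by apply: levy_dens_ge0; exact: ltW. Qed.

Lemma ray2_ge0 (F : set (R * R)) v w : (0 <= ray2 alpha F v w)%E.
Proof.
apply: integral_ge0 => s _; apply: integral_ge0 => t _.
by rewrite lee_fin; do 2 apply: mulr_ge0 => //.
Qed.

Lemma ray_eq0 (F : set (R * R)) v : (forall s, 0 < s -> ~ F (s *: v)) -> ray alpha F v = 0%E.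
Proof.
move=> H; apply: integral0_eq => s _; have [s0|s0] := leP s 0; first by rewrite levy_dens0// mul0r.
by rewrite indicE memNset ?mulr0//; exact: H.
Qed.

(** For every [s] the section in [t] is at most one point of the half line, hence null. This
    discards the pairs of directions that span no area inside [F]. *)
Lemma ray2_eq0 (F : set (R * R)) (v w : R * R) :
  (forall s, 0 < s -> exists c, forall t, 0 < t -> F (s *: v + t *: w) -> t = c) -> ray2 alpha F v w = 0%E.
Proof.
move=> H; apply: integral0_eq => s _; have [s0|s0] := leP s 0.
  by apply: integral0_eq => t _; rewrite levy_dens0// mul0r.
have [c Hc] := H s s0.
rewrite -(integral_set1 (fun t => (levy_dens alpha s * (levy_dens alpha t * \1_F (s *: v + t *: w)))%:E) c).
rewrite [RHS]integral_mkcond; apply: eq_integral => t _; rewrite /patch.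
case: ifPn => //; rewrite notin_setE/= => tc.
have [t0|t0] := leP t 0; first by rewrite (levy_dens0 _ t0) mul0r mulr0.
by rewrite indicE memNset ?mulr0// => /(Hc t t0).
Qed.

Lemma ray_le (F G : set (R * R)) v : measurable F -> measurable G -> F `<=` G -> (ray alpha F v <= ray alpha G v)%E.
Proof.
move=> mF mG FG.
have mI (A : set (R * R)) : measurable A -> measurable_fun [set: measurableTypeR R] (fun s : R => (levy_dens alpha s * \1_A (s *: v))%:E).
  move=> mA; apply/measurable_EFinP; apply: measurable_funM => //.
  have h : measurable_fun [set: measurableTypeR R] (fun s : R => s *: v).
    by have := measurable_affine 0 v; apply: eq_measurable_fun => x _; rewrite add0r.
  exact: (measurableT_comp (measurable_indic mA) h).
apply: ge0_le_integral => //.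
- by move=> s _; rewrite lee_fin; exact: mulr_ge0.
- exact: mI.
- exact: mI.
- move=> s _; rewrite lee_fin; apply: ler_wpM2l => //.
  by rewrite !indicE ler_nat; case: (boolP (_ \in F)) => // h; rewrite mem_set//; apply: FG; rewrite -inE.
Qed.

Lemma ray2E (F : set (R * R)) (v w : R * R) : measurable F ->
  ray2 alpha F v w = levy2 alpha [set p | F (p.1 *: v + p.2 *: w)].
Proof.
move=> mF.
have mc : measurable_fun [set: measurableTypeR R * measurableTypeR R] (fun p => p.1 *: v + p.2 *: w).
  have m1 (a : R) : measurable_fun [set: measurableTypeR R * measurableTypeR R] (fun p => p.1 * a).
    by apply: measurable_funM => //; exact: measurable_fst.
  have m2 (a : R) : measurable_fun [set: measurableTypeR R * measurableTypeR R] (fun p => p.2 * a).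
    by apply: measurable_funM => //; exact: measurable_snd.
  by apply: measurable_fun_pair; apply: measurable_funD; [exact: m1|exact: m2|exact: m1|exact: m2].
rewrite /levy2 fubini_tonelli1; last 2 first.
- apply/measurable_EFinP; apply: measurable_levy2_integrand.
  by rewrite -[X in measurable X]setTI; exact: mc.
- by move=> p; rewrite lee_fin; do 2 apply: mulr_ge0 => //.
apply: eq_integral => s _; apply: eq_integral => t _; congr (_%:E); rewrite !indicE/=.
rewrite mulrA mulrC; congr (_ %:R * _); congr nat_of_bool.
Qed.

Lemma levy2_le (D1 D2 : set (measurableTypeR R * measurableTypeR R)) :
  measurable D1 -> measurable D2 -> (forall p, 0 < p.1 -> 0 < p.2 -> D1 p -> D2 p) -> (levy2 alpha D1 <= levy2 alpha D2)%E.
Proof.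
move=> m1 m2 H; apply: ge0_le_integral => //.
- by move=> p _; rewrite lee_fin; do 2 apply: mulr_ge0 => //.
- by apply/measurable_EFinP; exact: measurable_levy2_integrand.
- by apply/measurable_EFinP; exact: measurable_levy2_integrand.
- move=> -[s t] _/=; rewrite lee_fin.
  have [s0|s0] := leP s 0; first by rewrite levy_dens0// mul0r !mulr0.
  have [t0|t0] := leP t 0; first by rewrite (levy_dens0 _ t0) !mulr0.
  apply: ler_wpM2r; first exact: mulr_ge0.
  by rewrite !indicE ler_nat; case: (boolP (_ \in D1)) => // h; rewrite mem_set//; apply: H => //; rewrite -inE.
Qed.

Lemma levy_itv (a b : R) : 0 < a -> a < b ->
  (\int[@lebesgue_measure R]_(s in `]a, b[) (levy_dens alpha s)%:E = (a `^ (- alpha) - b `^ (- alpha))%:E)%E.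
Proof.
move=> a0 ab.
have b0 := lt_trans a0 ab.
have H : ((a `^ (- alpha))%:E = (\int[@lebesgue_measure R]_(s in `]a, b[) (levy_dens alpha s)%:E) + (b `^ (- alpha))%:E)%E.
  rewrite -(levy_ray alpha0 a0) -(levy_ray alpha0 b0) -integral_itv_obnd_cbnd; last exact/measurable_funTS/measurable_EFinP.
  have -> : `]a, +oo[%classic = `]a, b[ `|` `[b, +oo[ :> set R.
    apply/seteqP; split => s /=; rewrite !in_itv/= !andbT.
      by move=> as_; have [sb|bs] := ltP s b; [left; rewrite as_|right].
    by move=> [/andP[]//|bs]; exact: lt_le_trans bs.
  rewrite ge0_integral_setU//.
  - exact/measurable_funTS/measurable_EFinP.
  - by move=> s _; rewrite lee_fin.
  - by apply/disj_setPRL => s /=; rewrite !in_itv/= andbT => bs /andP[_]; rewrite ltNge bs.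
move: H; case: (integral _ _ _) => [r||]//; first by rewrite -EFinD => -[->]; rewrite addrK.
Qed.

Lemma levy2_swap (D : set (measurableTypeR R * measurableTypeR R)) : measurable D ->
  levy2 alpha [set p | D (p.2, p.1)] = levy2 alpha D.
Proof.
move=> mD.
have msw : measurable_fun [set: measurableTypeR R * measurableTypeR R] (fun p => (p.2, p.1)).
  by apply: measurable_fun_pair; [exact: measurable_snd|exact: measurable_fst].
have p0 (A : set (measurableTypeR R * measurableTypeR R)) (p : R * R) : (0 <= (\1_A p * (levy_dens alpha p.1 * levy_dens alpha p.2))%:E)%E.
  by rewrite lee_fin; do 2 apply: mulr_ge0 => //.
rewrite /levy2 fubini_tonelli1//; last first.
  apply/measurable_EFinP; apply: measurable_levy2_integrand.
  by rewrite -[X in measurable X]setTI; exact: msw.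
have mi : measurable_fun [set: measurableTypeR R * measurableTypeR R] (EFin \o (fun p : R * R => \1_D p * (levy_dens alpha p.1 * levy_dens alpha p.2))).
  by apply/measurable_EFinP; exact: measurable_levy2_integrand.
have := @fubini_tonelli2 _ _ (measurableTypeR R) (measurableTypeR R) R (@lebesgue_measure R) (@lebesgue_measure R) _ mi (p0 D).
rewrite /comp => ->; rewrite /fubini_F /fubini_G.
apply: eq_integral => s _; apply: eq_integral => t _; congr (_%:E); rewrite /= [levy_dens alpha s * _]mulrC.
by congr (_ * _); rewrite !indicE; congr ((_ : bool)%:R); apply/idP/idP; rewrite !inE.
Qed.
End rays.

(** * Limiting measures of sets close to the wedge *)

Lemma pair_ext (U V : Type) (a b : U * V) : a.1 = b.1 -> a.2 = b.2 -> a = b.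
Proof. by case: a b => a1 a2 [b1 b2] /= -> ->. Qed.

Lemma sum_atom_dirs (R : realType) (h : R * R -> \bar R) :
  (\sum_(i <- atom_dirs R) h i.2 = h (1, 1)%R + (h (-1, -1)%R + (h (0, 1)%R + h (0, -1)%R)))%E.
Proof. by rewrite /atom_dirs !big_cons big_nil adde0. Qed.

(** The four directions are variables tied by equations, so that the sixteen terms stay opaque and
    can be rewritten one at a time. *)
Lemma sum_atom_dirs2 (R : realType) (h : R * R -> R * R -> \bar R) (p m u d : R * R)
  (hp : p = (1, 1)) (hm : m = (-1, -1)) (hu : u = (0, 1)) (hd : d = (0, -1)) :
  (\sum_(i <- atom_dirs R) \sum_(j <- atom_dirs R) h i.2 j.2 =
   ((h p p + (h p m + (h p u + h p d))) + ((h m p + (h m m + (h m u + h m d))) + ((h u p + (h u m + (h u u + h u d))) + (h d p + (h d m + (h d u + h d d)))))))%E.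
Proof.
rewrite (sum_atom_dirs (fun v => \sum_(j <- atom_dirs R) h v j.2)%E) -hp -hm -hu -hd.
have S v : (\sum_(j <- atom_dirs R) h v j.2 = h v p + (h v m + (h v u + h v d)))%E.
  by rewrite (sum_atom_dirs (h v)) -hp -hm -hu -hd.
by rewrite !S.
Qed.

Section Lsets.
Context (R : realType) (Lambda : {finite_measure set (R * R)%type -> \bar R}) (alpha C : R).
Hypothesis alpha0 : 0 < alpha.
Hypothesis HL : forall f, measurable_fun setT f -> (forall x, 0 <= f x)%E ->
  (\int[Lambda]_x f x = \sum_(i <- atom_dirs R) (atom_weight alpha i.1)%:E * f (i.1 *: i.2))%E.

Let l0 s : 0 <= levy_dens alpha s. Proof. by apply: levy_dens_ge0; exact: ltW. Qed.

(* [F] in the coordinates [(s, t)] of the point [s *: (1, 1) - t *: (0, 1)]. *)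
Definition wedge_coord (F : set (R * R)) : set (measurableTypeR R * measurableTypeR R) :=
  [set p | F (p.1, p.1 - p.2)].

Lemma measurable_wedge_coord (F : set (R * R)) : measurable F -> measurable (wedge_coord F).
Proof.
move=> mF.
have mc : measurable_fun [set: measurableTypeR R * measurableTypeR R] (fun p => (p.1, p.1 - p.2)).
  apply: measurable_fun_pair; first exact: measurable_fst.
  by apply: measurable_funB; [exact: measurable_fst|exact: measurable_snd].
by rewrite -[X in measurable X]setTI; exact: (mc measurableT F mF).
Qed.

Lemma ray2_wedge (F : set (R * R)) : measurable F ->
  ray2 alpha F (1, 1) (0, -1) = levy2 alpha (wedge_coord F).
Proof.
move=> mF; rewrite ray2E//; congr (levy2 _ _); apply/seteqP.
have E (p : R * R) : p.1 *: (1, 1) + p.2 *: (0, -1) = (p.1, p.1 - p.2) :> R * R.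
  by apply: pair_ext; rewrite /= /GRing.scale/=; ring.
by split => p; rewrite /wedge_coord/= E.
Qed.

Lemma ray2_wedgeC (F : set (R * R)) : measurable F ->
  ray2 alpha F (0, -1) (1, 1) = levy2 alpha (wedge_coord F).
Proof.
move=> mF; rewrite ray2E// -(levy2_swap alpha0 (measurable_wedge_coord mF)).
congr (levy2 _ _); apply/seteqP.
have E (p : R * R) : p.1 *: (0, -1) + p.2 *: (1, 1) = (p.2, p.2 - p.1) :> R * R.
  by apply: pair_ext; rewrite /= /GRing.scale/=; ring.
by split => p; rewrite /wedge_coord/= E.
Qed.

Lemma L2_wedge (F : set (R * R)) : measurable F ->
  (forall x, F x -> 0 < x.1 /\ (x.2 < x.1 \/ x = (1, 1))) ->
  L C Lambda F 2 alpha = ((C ^+ 2 / 4)%:E * levy2 alpha (wedge_coord F))%E.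
Proof.
move=> mF HF.
have Z (v w : R * R) (c : R -> R) : (forall s t, 0 < s -> 0 < t -> F (s *: v + t *: w) -> t = c s) ->
    ray2 alpha F v w = 0%E.
  by move=> H; apply: ray2_eq0 => s s0; exists (c s) => t t0; exact: H.
have HF' (x y a b c e : R) (u : R) : (0 < x * a + y * c -> (x * b + y * e < x * a + y * c) \/ (x * a + y * c = 1 /\ x * b + y * e = 1) -> y = u) ->
    F (x *: (a, b) + y *: (c, e)) -> y = u.
  by move=> H /HF/= [h1 h2]; apply: H => //; case: h2 => [?|[? ?]]; [left|right].
have [p pE] : exists p : R * R, p = (1, 1) by exists (1, 1).
have [m mE] : exists p : R * R, p = (-1, -1) by exists (-1, -1).
have [u uE] : exists p : R * R, p = (0, 1) by exists (0, 1).
have [d dE] : exists p : R * R, p = (0, -1) by exists (0, -1).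
(* On the diagonal only (1, 1) can belong to [F], which determines [t] from [s] for the pairs among
   the two diagonal directions. Wherever the witness is 0, no combination lies in [F] at all. *)
have pp : ray2 alpha F p p = 0%E by rewrite pE; apply: (Z _ _ (fun s => 1 - s)) => s t s0 t0; apply: HF'; lra.
have pm : ray2 alpha F p m = 0%E by rewrite pE mE; apply: (Z _ _ (fun s => s - 1)) => s t s0 t0; apply: HF'; lra.
have pu : ray2 alpha F p u = 0%E by rewrite pE uE; apply: (Z _ _ (fun _ => 0)) => s t s0 t0; apply: HF'; lra.
have mp : ray2 alpha F m p = 0%E by rewrite mE pE; apply: (Z _ _ (fun s => 1 + s)) => s t s0 t0; apply: HF'; lra.
have mm : ray2 alpha F m m = 0%E by rewrite mE; apply: (Z _ _ (fun _ => 0)) => s t s0 t0; apply: HF'; lra.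
have mu : ray2 alpha F m u = 0%E by rewrite mE uE; apply: (Z _ _ (fun _ => 0)) => s t s0 t0; apply: HF'; lra.
have md : ray2 alpha F m d = 0%E by rewrite mE dE; apply: (Z _ _ (fun _ => 0)) => s t s0 t0; apply: HF'; lra.
have up : ray2 alpha F u p = 0%E by rewrite uE pE; apply: (Z _ _ (fun _ => 0)) => s t s0 t0; apply: HF'; lra.
have um : ray2 alpha F u m = 0%E by rewrite uE mE; apply: (Z _ _ (fun _ => 0)) => s t s0 t0; apply: HF'; lra.
have uu : ray2 alpha F u u = 0%E by rewrite uE; apply: (Z _ _ (fun _ => 0)) => s t s0 t0; apply: HF'; lra.
have ud : ray2 alpha F u d = 0%E by rewrite uE dE; apply: (Z _ _ (fun _ => 0)) => s t s0 t0; apply: HF'; lra.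
have dm : ray2 alpha F d m = 0%E by rewrite dE mE; apply: (Z _ _ (fun _ => 0)) => s t s0 t0; apply: HF'; lra.
have du : ray2 alpha F d u = 0%E by rewrite dE uE; apply: (Z _ _ (fun _ => 0)) => s t s0 t0; apply: HF'; lra.
have dd : ray2 alpha F d d = 0%E by rewrite dE; apply: (Z _ _ (fun _ => 0)) => s t s0 t0; apply: HF'; lra.
have pd := ray2_wedge mF; rewrite -pE -dE in pd.
have dp := ray2_wedgeC mF; rewrite -pE -dE in dp.
rewrite (L2E C alpha0 HL mF) (sum_atom_dirs2 (ray2 alpha F) pE mE uE dE).
rewrite pp pm pu mp mm mu md up um uu ud dm du dd pd dp !(adde0, add0e).
have : (0 <= levy2 alpha (wedge_coord F))%E by rewrite -ray2_wedge//; exact: ray2_ge0.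
generalize (levy2 alpha (wedge_coord F)) => y y0.
have -> : C ^+ 2 / 4 = C ^+ 2 / 8 + C ^+ 2 / 8 by field.
have c0 : 0 <= C ^+ 2 / 8 by rewrite divr_ge0// sqr_ge0.
by rewrite EFinD ge0_muleDl ?lee_fin// ge0_muleDr.
Qed.

(** Keeps a single ordered pair and drops the other fifteen. It serves for the enlargements of the
    wedge, which leave the region of [L2_wedge] but have infinite mass already in this pair. *)
Lemma L2_ge (F : set (R * R)) : measurable F ->
  ((C ^+ 2 / 8)%:E * levy2 alpha (wedge_coord F) <= L C Lambda F 2 alpha)%E.
Proof.
move=> mF.
have r0 v w := ray2_ge0 alpha0 F v w.
rewrite (L2E C alpha0 HL mF) (sum_atom_dirs2 (ray2 alpha F) erefl erefl erefl erefl) -ray2_wedge//.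
apply: lee_wpmul2l; first by rewrite lee_fin divr_ge0// sqr_ge0.
apply: lee_paddr; last by do 3 (apply: lee_paddl => //).
by repeat first [exact: r0 | apply: adde_ge0].
Qed.

Lemma L1_le (F G : set (R * R)) : 0 <= C -> measurable F -> measurable G -> F `<=` G ->
  (L C Lambda F 1 alpha <= L C Lambda G 1 alpha)%E.
Proof.
move=> C0 mF mG FG; rewrite !(L1E C alpha0 HL)//; apply: lee_wpmul2l; first by rewrite lee_fin divr_ge0.
by apply: lee_sum => i _; exact: ray_le.
Qed.

Lemma L1_diag (F : set (R * R)) (a b : R) : measurable F -> 0 < a -> a < b ->
  (forall s, 0 < s -> ~ F (- s, - s)) -> (forall s, ~ F (0, s)) ->
  (forall s, 0 < s -> F (s, s) <-> a < s < b) ->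
  L C Lambda F 1 alpha = ((C / 2) * (a `^ (- alpha) - b `^ (- alpha)))%:E.
Proof.
move=> mF a0 ab Fm F0 Fd; rewrite (L1E C alpha0 HL mF) (sum_atom_dirs (ray alpha F)).
have sc (c x y : R) : c *: (x, y) = (c * x, c * y) by [].
rewrite [ray _ _ (-1, -1)]ray_eq0; last by move=> s s0; rewrite sc mulrN1; exact: Fm.
rewrite [ray _ _ (0, 1)]ray_eq0; last by move=> s s0; rewrite sc mulr0; exact: F0.
rewrite [ray _ _ (0, -1)]ray_eq0; last by move=> s s0; rewrite sc mulr0; exact: F0.
rewrite !adde0 [RHS]EFinM; congr (_ * _)%E.
have -> : ray alpha F (1, 1) = (\int[@lebesgue_measure R]_(s in `]a, b[) (levy_dens alpha s)%:E)%E.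
  rewrite -integral_indicM; apply: eq_integral => s _; congr (_%:E); rewrite mulrC.
  have [s0|s0] := leP s 0; first by rewrite levy_dens0 ?mulr0.
  congr (_ * _); rewrite !indicE sc mulr1; congr ((_ : bool)%:R); apply/idP/idP; rewrite !inE/= in_itv/=.
    by move=> /(Fd _ s0).
  by move=> /(Fd _ s0).
exact: levy_itv.
Qed.
End Lsets.

(** * The planar sets *)

Section halfplanes.
Context (R : realType) (c : R).

Lemma open_fst_gt : open [set x : R * R | c < x.1].
Proof.
have -> : [set x : R * R | c < x.1] = fst @^-1` `]c, +oo[ by apply/seteqP; split => x /=; rewrite in_itv/= andbT.
by apply: open_comp => [x _|]; [exact: cvg_fst|exact: interval_open].
Qed.

Lemma open_snd_lt : open [set x : R * R | x.2 < c].
Proof.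
have -> : [set x : R * R | x.2 < c] = snd @^-1` `]-oo, c[ by apply/seteqP; split => x /=; rewrite in_itv.
by apply: open_comp => [x _|]; [exact: cvg_snd|exact: interval_open].
Qed.

Lemma closed_fst_ge : closed [set x : R * R | c <= x.1].
Proof.
have -> : [set x : R * R | c <= x.1] = fst @^-1` `[c, +oo[ by apply/seteqP; split => x /=; rewrite in_itv/= andbT.
by apply: closed_comp => [x _|]; [exact: cvg_fst|exact: interval_closed].
Qed.

Lemma closed_snd_le : closed [set x : R * R | x.2 <= c].
Proof.
have -> : [set x : R * R | x.2 <= c] = snd @^-1` `]-oo, c] by apply/seteqP; split => x /=; rewrite in_itv.
by apply: closed_comp => [x _|]; [exact: cvg_snd|exact: interval_closed].
Qed.
End halfplanes.

Section plane_sets.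
Context (R : realType).

Lemma closed_prod_measurable (F : set (R * R)) : closed F -> measurable F.
Proof. by move=> cF; rewrite -(setCK F); apply: measurableC; apply: open_prod_measurable; exact: closed_openC. Qed.

Lemma eucl_dist_fst (x y : R * R) : `|x.1 - y.1| <= eucl_dist x y.
Proof.
rewrite /eucl_dist -sqrtr_sqr; apply: ler_wsqrtr.
by rewrite lerDl sqr_ge0.
Qed.

Lemma eucl_dist_snd (x y : R * R) : `|x.2 - y.2| <= eucl_dist x y.
Proof.
rewrite /eucl_dist -sqrtr_sqr; apply: ler_wsqrtr.
by rewrite lerDr sqr_ge0.
Qed.

Lemma eucl_dist_le (x y : R * R) : eucl_dist x y <= `|x.1 - y.1| + `|x.2 - y.2|.
Proof.
have n0 : 0 <= `|x.1 - y.1| + `|x.2 - y.2| by rewrite addr_ge0.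
rewrite /eucl_dist -(ger0_norm n0) -sqrtr_sqr; apply: ler_wsqrtr.
rewrite [leRHS]sqrrD !real_normK ?num_real//.
by rewrite -addrA lerD2l lerDr mulrn_wge0// mulr_ge0.
Qed.

Lemma enlargeP (F : set (R * R)) (delta : R) (x : R * R) :
  enlarge F delta x <-> exists2 y, F y & eucl_dist x y < delta.
Proof.
split; first by move=> /ereal_inf_lt[_ [y Fy <-]]; rewrite lte_fin => h; exists y.
move=> [y Fy h]; apply: le_lt_trans (_ : (eucl_dist x y)%:E < delta%:E)%E; last by rewrite lte_fin.
by apply: ereal_inf_lbound; exists y.
Qed.

Lemma sub_enlarge (F : set (R * R)) (delta : R) : 0 < delta -> F `<=` enlarge F delta.
Proof.
move=> d0 x Fx; apply/enlargeP; exists x => //.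
by rewrite /eucl_dist !subrr expr0n addr0 sqrtr0.
Qed.

Lemma open_enlarge (F : set (R * R)) (delta : R) : 0 < delta -> open (enlarge F delta).
Proof.
move=> d0.
pose q (y z : R * R) : R := (z.1 - y.1) * (z.1 - y.1) + (z.2 - y.2) * (z.2 - y.2).
have -> : enlarge F delta = \bigcup_(y in F) (q y @^-1` `]-oo, delta ^+ 2[).
  have H y z : (eucl_dist z y < delta) = (q y z < delta ^+ 2).
    rewrite /eucl_dist /q -!expr2 -{1}(ger0_norm (ltW d0)) -sqrtr_sqr ltr_sqrt//.
    by rewrite exprn_gt0.
  apply/seteqP; split => z; first by move=> /enlargeP[y Fy]; rewrite H => h; exists y => //=; rewrite in_itv.
  by move=> [y Fy] /=; rewrite in_itv/= -H => h; apply/enlargeP; exists y.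
apply: bigcup_open => y _; apply: open_comp; last exact: interval_open.
move=> z _; apply: cvgD; apply: cvgM; apply: cvgB; (exact: cvg_cst || exact: cvg_fst || exact: cvg_snd).
Qed.

Lemma measurable_enlarge (F : set (R * R)) (delta : R) : 0 < delta -> measurable (enlarge F delta).
Proof. by move=> d0; apply: open_prod_measurable; exact: open_enlarge. Qed.

Lemma enlarge_near (F : set (R * R)) (delta : R) (x : R * R) :
  enlarge F delta x -> exists2 y, F y & `|x.1 - y.1| < delta /\ `|x.2 - y.2| < delta.
Proof.
move=> /enlargeP[y Fy h]; exists y => //.
by split; [exact: le_lt_trans (eucl_dist_fst _ _) h|exact: le_lt_trans (eucl_dist_snd _ _) h].
Qed.

Lemma open_E : open (E R).
Proof.
have -> : E R = [set x : R * R | 1 < x.1] `&` [set x : R * R | x.2 < 1] by [].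
by apply: openI; [exact: open_fst_gt|exact: open_snd_lt].
Qed.

Lemma interior_E : (E R)° = E R.
Proof. by apply/interior_id; exact: open_E. Qed.

Lemma closure_E_sub : closure (E R) `<=` [set x | 1 <= x.1 /\ x.2 <= 1].
Proof.
rewrite (_ : [set x | 1 <= x.1 /\ x.2 <= 1] = [set x : R * R | 1 <= x.1] `&` [set x : R * R | x.2 <= 1])//.
have /closure_id -> : closed ([set x : R * R | 1 <= x.1] `&` [set x : R * R | x.2 <= 1]).
  by apply: closedI; [exact: closed_fst_ge|exact: closed_snd_le].
apply: closure_subset; by move=> x [/ltW ? /ltW ?].
Qed.

Lemma BP (eps : R) (x : R * R) : B eps x <-> `|1 - x.1| < eps /\ `|1 - x.2| < eps.
Proof. by []. Qed.

Lemma measurable_E : measurable (E R).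
Proof. by apply: open_prod_measurable; exact: open_E. Qed.

Lemma measurable_B (eps : R) : measurable (B eps : set (R * R)).
Proof.
have -> : B eps = ball (1 : R) eps `*` ball (1 : R) eps by apply/seteqP; split => x [].
by apply: measurableX; exact: measurable_ball.
Qed.

(* [EmB_open eps 0] is the interior of the wedge minus the ball; the extra parameter
   moves all the sides outwards. *)
Definition EmB_open (eps delta : R) : set (R * R) :=
  [set x | [/\ 1 - delta < x.1, x.2 < 1 + delta & 1 + eps - delta < x.1 \/ x.2 < 1 - eps + delta]].

Definition EmB_closed (eps : R) : set (R * R) :=
  [set x | [/\ 1 <= x.1, x.2 <= 1 & 1 + eps <= x.1 \/ x.2 <= 1 - eps]].

Lemma open_EmB (eps delta : R) : open (EmB_open eps delta).
Proof.
have -> : EmB_open eps delta = [set x : R * R | 1 - delta < x.1] `&` [set x : R * R | x.2 < 1 + delta] `&`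
   ([set x : R * R | 1 + eps - delta < x.1] `|` [set x : R * R | x.2 < 1 - eps + delta]).
  by apply/seteqP; split => x [] => [? ? ?|[? ?] ?]; split.
apply: openI; first by apply: openI; [exact: open_fst_gt|exact: open_snd_lt].
by apply: openU; [exact: open_fst_gt|exact: open_snd_lt].
Qed.

Lemma measurable_EmB_open (eps delta : R) : measurable (EmB_open eps delta).
Proof. by apply: open_prod_measurable; exact: open_EmB. Qed.

Lemma measurable_EmB_closed (eps : R) : measurable (EmB_closed eps).
Proof.
apply: closed_prod_measurable.
have -> : EmB_closed eps = [set x : R * R | 1 <= x.1] `&` [set x : R * R | x.2 <= 1] `&`
   ([set x : R * R | 1 + eps <= x.1] `|` [set x : R * R | x.2 <= 1 - eps]).
  by apply/seteqP; split => x [] => [? ? ?|[? ?] ?]; split.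
apply: closedI; first by apply: closedI; [exact: closed_fst_ge|exact: closed_snd_le].
by apply: closedU; [exact: closed_fst_ge|exact: closed_snd_le].
Qed.

Lemma EmBP (eps : R) (x : R * R) : (E R `\` B eps) x <->
  [/\ 1 < x.1, x.2 < 1 & 1 + eps <= x.1 \/ x.2 <= 1 - eps].
Proof.
split.
  move=> [[x1 x2] /BP nB]; split => //.
  have [h|h] := leP (1 + eps) x.1; first by left.
  have [k|k] := leP x.2 (1 - eps); first by right.
  by exfalso; apply: nB; rewrite !ltr_distl; split; apply/andP; split; lra.
move=> [x1 x2 h]; split; first by split.
by move=> /BP; rewrite !ltr_distl => -[/andP[? ?] /andP[? ?]]; case: h => ?; lra.
Qed.

Lemma EmB_open_sub (eps : R) : 0 < eps -> EmB_open eps 0 `<=` (E R `\` B eps)°.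
Proof.
move=> e0; rewrite -open_subsetE; last exact: open_EmB.
move=> x [h1 h2 h3]; apply/EmBP; split; [lra|lra|].
by case: h3 => ?; [left|right]; lra.
Qed.

Lemma EmB_sub_closed (eps : R) : E R `\` B eps `<=` EmB_closed eps.
Proof. by move=> x /EmBP[/ltW ? /ltW ? ?]. Qed.

Lemma enlarge_EmB_sub (eps delta : R) : enlarge (E R `\` B eps) delta `<=` EmB_open eps delta.
Proof.
move=> x /enlarge_near[y /EmBP[y1 y2 y3]]; rewrite !ltr_distl => -[/andP[? ?] /andP[? ?]].
by split; [lra|lra|case: y3 => ?; [left|right]; lra].
Qed.

(** In wedge coordinates the set stays in a quadrant away from both axes, where the product Levy
    measure is finite; the bounds on [delta] keep half of each margin. *)
Lemma EmB_open_region (eps delta : R) (x : R * R) : delta <= 2^-1 -> delta <= eps / 4 -> 0 < eps -> EmB_open eps delta x ->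
  2^-1 < x.1 /\ eps / 2 < x.1 - x.2.
Proof. by move=> d1 d2 e0 [h1 h2 h3]; split; [|case: h3 => ?]; lra. Qed.

Lemma EmB_closed_region (eps : R) (x : R * R) : 0 < eps -> EmB_closed eps x -> 1 <= x.1 /\ eps <= x.1 - x.2.
Proof. by move=> e0 [h1 h2 h3]; split; [|case: h3 => ?]; lra. Qed.
End plane_sets.

(** * Product Levy mass of the wedge and of its variants *)

Section levy2_null.
Context (R : realType) (alpha : R).
Hypothesis alpha0 : 0 < alpha.
Let l0 s : 0 <= levy_dens alpha s. Proof. by apply: levy_dens_ge0; exact: ltW. Qed.

Lemma eq_integral_off2 (f g : R -> \bar R) (c1 c2 : R) :
  measurable_fun [set: measurableTypeR R] f -> measurable_fun [set: measurableTypeR R] g ->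
  (forall x, 0 <= f x)%E -> (forall x, 0 <= g x)%E -> (forall x, x <> c1 -> x <> c2 -> f x = g x) ->
  (\int[@lebesgue_measure R]_x f x = \int[@lebesgue_measure R]_x g x)%E.
Proof.
move=> mf mg f0 g0 fg; apply: ge0_ae_eq_integral => //.
exists [set c1; c2]; split.
- by apply: measurableU; exact: measurable_set1.
- apply/eqP; rewrite eq_le measure_ge0 andbT.
  apply: le_trans (measureU2 _ _ _) _; [exact: measurable_set1|exact: measurable_set1|].
  have e1 : (@lebesgue_measure R [set c1] <= 0)%E by rewrite lebesgue_measure_set1.
  have e2 : (@lebesgue_measure R [set c2] <= 0)%E by rewrite lebesgue_measure_set1.
  by have := leeD e1 e2; rewrite adde0.
- move=> x /= h; apply: contrapT => n; apply: h => _; apply: fg => e; apply: n; [left|right]; exact: e.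
Qed.

(** The vertical lines are null for the outer integral, and each slanted line meets every section in
    one point, null for the inner one. Boundaries of all the sets at hand consist of such lines. *)
Lemma levy2_eq_off_lines (D1 D2 : set (measurableTypeR R * measurableTypeR R)) (c1 c2 e1 e2 : R) :
  measurable D1 -> measurable D2 -> D1 `<=` D2 ->
  (forall p, D2 p -> ~ D1 p -> [\/ p.1 = c1, p.1 = c2, p.1 - p.2 = e1 | p.1 - p.2 = e2]) ->
  levy2 alpha D1 = levy2 alpha D2.
Proof.
move=> m1 m2 D12 H.
have i0 (D : set (R * R)) (p : R * R) : (0 <= (\1_D p * (levy_dens alpha p.1 * levy_dens alpha p.2))%:E)%E.
  by rewrite lee_fin; do 2 apply: mulr_ge0 => //.
have mi (D : set (measurableTypeR R * measurableTypeR R)) : measurable D -> measurable_fun [set: measurableTypeR R * measurableTypeR R] (fun p => (\1_D p * (levy_dens alpha p.1 * levy_dens alpha p.2))%:E).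
  by move=> mD; apply/measurable_EFinP; exact: measurable_levy2_integrand.
have F (D : set (measurableTypeR R * measurableTypeR R)) (mD : measurable D) := @fubini_tonelli1 _ _ (measurableTypeR R) (measurableTypeR R) R (@lebesgue_measure R) (@lebesgue_measure R) _ (mi D mD) (i0 D).
rewrite /levy2 (F D1 m1) (F D2 m2).
apply: (@eq_integral_off2 _ _ c1 c2).
- exact: measurable_fun_fubini_tonelli_F (mi D1 m1) (i0 D1).
- exact: measurable_fun_fubini_tonelli_F (mi D2 m2) (i0 D2).
- by move=> x; apply: integral_ge0 => y _; exact: i0.
- by move=> x; apply: integral_ge0 => y _; exact: i0.
move=> x x1 x2; rewrite /fubini_F.
have ms (D : set (measurableTypeR R * measurableTypeR R)) : measurable D -> measurable_fun [set: measurableTypeR R] (fun y => (\1_D (x, y) * (levy_dens alpha x * levy_dens alpha y))%:E).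
  by move=> mD; exact: (measurableT_comp (mi D mD) (@pair1_measurable _ _ (measurableTypeR R) (measurableTypeR R) x)).
apply: (@eq_integral_off2 _ _ (x - e1) (x - e2)).
- exact: ms.
- exact: ms.
- by move=> y; exact: i0.
- by move=> y; exact: i0.
move=> y y1 y2; congr (_ * _)%:E; rewrite !indicE; congr ((_ : bool)%:R); apply/idP/idP; rewrite !inE; first exact: D12.
move=> h; apply: contrapT => n; case: (H _ h n) => //= k; [apply: y1|apply: y2]; lra.
Qed.
End levy2_null.

Section levy2_sets.
Context (R : realType) (alpha : R).
Hypothesis alpha0 : 0 < alpha.
Let ml := @measurable_levy_dens R alpha.
Let l0 s : 0 <= levy_dens alpha s. Proof. by apply: levy_dens_ge0; exact: ltW. Qed.

Lemma levy2_prod (A B : set (measurableTypeR R)) : measurable A -> measurable B ->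
  levy2 alpha (A `*` B) = ((\int[@lebesgue_measure R]_(x in A) (levy_dens alpha x)%:E) *
    (\int[@lebesgue_measure R]_(y in B) (levy_dens alpha y)%:E))%E.
Proof.
move=> mA mB; have mAB := measurableX mA mB.
rewrite /levy2 fubini_tonelli1; last 2 first.
- by apply/measurable_EFinP; exact: measurable_levy2_integrand.
- by move=> p; rewrite lee_fin; do 2 apply: mulr_ge0 => //.
have mI (D : set (measurableTypeR R)) : measurable D -> measurable_fun [set: measurableTypeR R] (fun x => (\1_D x * levy_dens alpha x)%:E).
  by move=> mD; apply/measurable_EFinP; apply: measurable_funM => //; exact: measurable_indic.
have I0 (D : set R) x : (0 <= (\1_D x * levy_dens alpha x)%:E)%E by rewrite lee_fin; apply: mulr_ge0.
rewrite -(@integral_indicM R A (levy_dens alpha)) -(@integral_indicM R B (levy_dens alpha)).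
set IB := (X in (_ = _ * X)%E).
have IB0 : (0 <= IB)%E by apply: integral_ge0 => y _; exact: I0.
have Z := @ge0_integralZl _ (measurableTypeR R) R (@lebesgue_measure R) setT measurableT _ (mI A mA) IB (fun x _ => I0 A x) IB0.
rewrite muleC -Z; apply: eq_integral => x _; rewrite /fubini_F muleC /IB.
have x0 : 0 <= \1_A x * levy_dens alpha x by apply: mulr_ge0.
rewrite -(ge0_lebesgueZl (mI B mB) (I0 B) x0).
apply: eq_integral => y _; rewrite -EFinM; congr (_%:E).
rewrite (_ : \1_(A `*` B) (x, y) = \1_A x * \1_B y) /=; first ring.
by rewrite !indicE in_setX/= -natrM mulnb.
Qed.

Lemma levy_infty : (\int[@lebesgue_measure R]_(x in `]0%R, +oo[) (levy_dens alpha x)%:E = +oo)%E.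
Proof.
apply/eqyP => A A0; pose c := A `^ (- alpha^-1).
have c0 : 0 < c by exact: powR_gt0.
have cA : c `^ (- alpha) = A.
  by rewrite /c -powRrM mulrNN mulVf ?gt_eqF// powRr1// ltW.
rewrite -cA -(levy_ray alpha0 c0); apply: ge0_subset_integral => //.
- by apply: measurable_funTS; exact/measurable_EFinP.
- by move=> x _; rewrite lee_fin.
- by move=> x /=; rewrite !in_itv/= !andbT => /(lt_le_trans c0).
Qed.

Definition wedge_levy (D : set (R * R)) : \bar R := levy2 alpha (wedge_coord D).

Lemma wedge_levy_ge0 (D : set (R * R)) : (0 <= wedge_levy D)%E.
Proof. by apply: integral_ge0 => p _; rewrite lee_fin; do 2 apply: mulr_ge0 => //. Qed.

Lemma wedge_levy_le (D1 D2 : set (R * R)) : measurable D1 -> measurable D2 -> D1 `<=` D2 -> (wedge_levy D1 <= wedge_levy D2)%E.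
Proof.
move=> m1 m2 D12; apply: levy2_le => //; [exact: measurable_wedge_coord|exact: measurable_wedge_coord|].
by move=> p _ _; exact: D12.
Qed.

(** Every enlargement contains, in wedge coordinates, a strip around [p.1 = 1] on which the second
    coordinate is an arbitrary positive number, and the Levy measure of the half line is
    infinite. *)
Lemma wedge_levy_enlarge_E (delta : R) : 0 < delta -> wedge_levy (enlarge (E R) delta) = +oo%E.
Proof.
move=> d0; pose e := Num.min (delta / 5) 2^-1.
have e0 : 0 < e by rewrite lt_min invr_gt0 ltr0n divr_gt0.
have e1 : e <= delta / 5 by rewrite ge_min lexx.
have e2 : e <= 2^-1 by rewrite ge_min lexx orbT.
pose D : set (measurableTypeR R * measurableTypeR R) := `]1 - e, 1 + e[%classic `*` `]0%R, +oo[%classic.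
have mD : measurable D by apply: measurableX; exact: measurable_itv.
have : (levy2 alpha D <= wedge_levy (enlarge (E R) delta))%E.
  apply: levy2_le => //; first by apply: measurable_wedge_coord; exact: measurable_enlarge.
  move=> [x y] /= x0 y0 [/=]; rewrite !in_itv/= andbT => /andP[x1 x2] _.
  apply/enlargeP; exists (x + 2 * e, x - y - 2 * e); first by split => /=; lra.
  apply: le_lt_trans (eucl_dist_le _ _) _ => /=.
  have -> : x - (x + 2 * e) = - (2 * e) by ring.
  have -> : x - y - (x - y - 2 * e) = 2 * e by ring.
  rewrite normrN ger0_norm; [lra|by rewrite mulr_ge0// ltW].
rewrite levy2_prod//.
rewrite levy_infty levy_itv//; [|lra|lra].
rewrite gt0_muley ?leye_eq; first by move=> /eqP.
rewrite lte_fin subr_gt0 !powRN ltf_pV2 ?posrE ?powR_gt0//; [|lra|lra].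
by apply: gt0_ltr_powR => //; rewrite ?nnegrE; lra.
Qed.

Lemma wedge_levy_closure_E : wedge_levy (closure (E R)) = wedge_levy (E R).
Proof.
apply/esym; apply: (levy2_eq_off_lines alpha0 (c1 := 1) (c2 := 1) (e1 := 1) (e2 := 1)).
- by apply: measurable_wedge_coord; exact: measurable_E.
- by apply: measurable_wedge_coord; apply: closed_prod_measurable; exact: closed_closure.
- by move=> p; exact: (@subset_closure _ (E R)).
- move=> p /closure_E_sub[/= h1 h2] n.
  have [|p1] := eqVneq p.1 1; first by constructor 1.
  have [|p2] := eqVneq (p.1 - p.2) 1; first by constructor 3.
  by exfalso; apply: n; split => /=; rewrite lt_neqAle ?h1 ?h2 ?andbT// eq_sym.
Qed.

Lemma wedge_levy_EmB_closed (eps : R) : 0 < eps -> wedge_levy (EmB_closed eps) = wedge_levy (EmB_open eps 0).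
Proof.
move=> e0; apply/esym; apply: (levy2_eq_off_lines alpha0 (c1 := 1) (c2 := 1 + eps) (e1 := 1) (e2 := 1 - eps)).
- by apply: measurable_wedge_coord; exact: measurable_EmB_open.
- by apply: measurable_wedge_coord; exact: measurable_EmB_closed.
- by move=> p /(EmB_open_sub e0)/(@interior_subset _ _)/EmB_sub_closed.
- move=> p [/= h1 h2 h3] n.
  have [|p1] := eqVneq p.1 1; first by constructor 1.
  have [|p2] := eqVneq (p.1 - p.2) 1; first by constructor 3.
  have [|p3] := eqVneq p.1 (1 + eps); first by constructor 2.
  have [|p4] := eqVneq (p.1 - p.2) (1 - eps); first by constructor 4.
  exfalso; apply: n; split => /=; rewrite ?subr0 ?addr0.
  - by rewrite lt_neqAle h1 andbT eq_sym.
  - by rewrite lt_neqAle h2 andbT.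
  - by case: h3 => h; [left|right]; rewrite lt_neqAle h andbT// eq_sym.
Qed.

(** Handles at once the wedge minus the square and its interior: the open and closed models
    enclosing them have equal mass. *)
Lemma wedge_levy_between (eps : R) (D : set (R * R)) : 0 < eps -> measurable D -> EmB_open eps 0 `<=` D -> D `<=` EmB_closed eps ->
  wedge_levy D = wedge_levy (EmB_open eps 0).
Proof.
move=> e0 mD UD DW; apply/eqP; rewrite eq_le; apply/andP; split.
  by rewrite -wedge_levy_EmB_closed//; apply: wedge_levy_le => //; exact: measurable_EmB_closed.
by apply: wedge_levy_le => //; exact: measurable_EmB_open.
Qed.

Lemma levy2_quadrant_fin (a b : R) : 0 < a -> 0 < b ->
  (levy2 alpha (`[a, +oo[%classic `*` `[b, +oo[%classic) < +oo)%E.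
Proof.
move=> a0 b0; rewrite levy2_prod; [|exact: measurable_itv|exact: measurable_itv].
by rewrite !levy_ray// -EFinM ltry.
Qed.

Lemma wedge_levy_EmB_fin (eps delta : R) : 0 < eps -> delta <= 2^-1 -> delta <= eps / 4 -> (wedge_levy (EmB_open eps delta) < +oo)%E.
Proof.
move=> e0 d1 d2.
have h0 : 0 < 2^-1 :> R by rewrite invr_gt0.
have e20 : 0 < eps / 2 by rewrite divr_gt0.
apply: le_lt_trans (levy2_quadrant_fin h0 e20).
apply: levy2_le => //.
- by apply: measurable_wedge_coord; exact: measurable_EmB_open.
- by apply: measurableX; exact: measurable_itv.
- move=> p _ _ /(EmB_open_region d1 d2 e0)[/= ? ?]; split => /=; rewrite in_itv/= andbT; lra.
Qed.

Lemma wedge_levy_EmB_strict (eps eps' : R) : 0 < eps -> eps < eps' -> (wedge_levy (EmB_open eps' 0) < wedge_levy (EmB_open eps 0))%E.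
Proof.
move=> e0 ee'; pose eta := (eps' - eps) / 2.
have etaE : eta = (eps' - eps) / 2 by [].
clearbody eta; have eta0 : 0 < eta by rewrite etaE divr_gt0// subr_gt0.
(* The box [b] has positive mass and lies in only one of the two sets. *)
pose b : set (measurableTypeR R * measurableTypeR R) := `]1 + eps, 1 + eps + eta[%classic `*` `]eps + eta, eps + eps'[%classic.
have mb : measurable b by apply: measurableX; exact: measurable_itv.
have bpos : (0 < levy2 alpha b)%E.
  have pw (x y : R) : 0 < x -> x < y -> 0 < x `^ (- alpha) - y `^ (- alpha).
    move=> x0 xy; have y0 := lt_trans x0 xy.
    rewrite subr_gt0 !powRN ltf_pV2 ?posrE ?powR_gt0//.
    by apply: gt0_ltr_powR => //; rewrite ?nnegrE ltW.
  rewrite levy2_prod; [|exact: measurable_itv|exact: measurable_itv].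
  have q1 : 0 < 1 + eps by lra.
  have q2 : 1 + eps < 1 + eps + eta by lra.
  have q3 : 0 < eps + eta by lra.
  have q4 : eps + eta < eps + eps' by lra.
  rewrite (levy_itv alpha0 q1 q2) (levy_itv alpha0 q3 q4).
  by rewrite -EFinM lte_fin mulr_gt0// pw.
have mU d := measurable_wedge_coord (measurable_EmB_open d 0).
have e'0 := lt_trans e0 ee'.
have fin : wedge_levy (EmB_open eps' 0) \is a fin_num.
  by rewrite ge0_fin_numE ?wedge_levy_ge0//; apply: wedge_levy_EmB_fin => //; rewrite ?invr_ge0// divr_ge0// ltW.
have disj : wedge_coord (EmB_open eps' 0) `&` b = set0.
  apply/seteqP; split => // p [[/= h1 h2 h3] []] /=; rewrite !in_itv/= => /andP[? ?] /andP[? ?].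
  by case: h3 => ?; lra.
have sub : wedge_coord (EmB_open eps' 0) `|` b `<=` wedge_coord (EmB_open eps 0).
  move=> p [[/= h1 h2 h3]|[]] /=.
    by split => //=; case: h3 => ?; [left|right]; lra.
  by rewrite !in_itv/= => /andP[? ?] /andP[? ?]; split => /=; [lra|lra|left; lra].
apply: (@lt_le_trans _ _ (levy2 alpha (wedge_coord (EmB_open eps' 0) `|` b))); last first.
  by apply: levy2_le => //; [exact: measurableU|move=> p _ _; exact: sub].
have -> : levy2 alpha (wedge_coord (EmB_open eps' 0) `|` b) = (wedge_levy (EmB_open eps' 0) + levy2 alpha b)%E.
  rewrite /wedge_levy /levy2 -ge0_integralD//.
  - apply: eq_integral => p _; rewrite -EFinD -mulrDl; congr (_ * _)%:E.
    rewrite !indicE; have [pU|pU] := boolP (p \in wedge_coord (EmB_open eps' 0)).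
      rewrite mem_set; last by left; rewrite -inE.
      rewrite memNset ?addr0// => pb.
      have : (wedge_coord (EmB_open eps' 0) `&` b) p by split => //; rewrite -inE.
      by rewrite disj.
    rewrite add0r; congr ((_ : bool)%:R); apply/idP/idP; rewrite !inE; last by right.
    by move=> [h|//]; move: pU; rewrite notin_setE.
  - by move=> p _; rewrite lee_fin; do 2 apply: mulr_ge0 => //.
  - by apply/measurable_EFinP; exact: measurable_levy2_integrand.
  - by move=> p _; rewrite lee_fin; do 2 apply: mulr_ge0 => //.
  - by apply/measurable_EFinP; exact: measurable_levy2_integrand.
by rewrite lteDl.
Qed.

Lemma wedge_levy_EmB_gt0 (eps : R) : 0 < eps -> (0 < wedge_levy (EmB_open eps 0))%E.
Proof.
by move=> e0; apply: le_lt_trans (@wedge_levy_EmB_strict eps (eps + 1) e0 _); rewrite ?wedge_levy_ge0// ltrDl.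
Qed.
End levy2_sets.

Section J_limits.
Context (R : realType) (alpha : R).
Hypothesis alpha0 : 0 < alpha.
Let l0 s : 0 <= levy_dens alpha s. Proof. by apply: levy_dens_ge0; exact: ltW. Qed.

(** As [delta] decreases to 0 the sets decrease to the closed model, which differs from the open one
    by null lines. Dominated convergence applies because all of them lie in one quadrant of finite
    mass. *)
Lemma cvg_wedge_levy_EmB_outer (eps : R) : 0 < eps -> wedge_levy alpha (EmB_open eps delta) @[delta --> 0^'+] --> wedge_levy alpha (EmB_open eps 0).
Proof.
move=> e0; rewrite -(wedge_levy_EmB_closed alpha0 e0).
have fin : wedge_levy alpha (EmB_closed eps) \is a fin_num.
  by rewrite ge0_fin_numE ?wedge_levy_ge0// wedge_levy_EmB_closed//; apply: wedge_levy_EmB_fin => //; rewrite ?invr_ge0// divr_ge0// ltW.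
rewrite -(fineK fin); apply/cvge_at_rightP => u [u0 ucv]; rewrite (fineK fin).
(* Capping the sequence at [m] keeps every set inside the dominating quadrant [Q]; the cap is
   inactive eventually. *)
pose m : R := Num.min 2^-1 (eps / 4).
have m0 : 0 < m by rewrite lt_min invr_gt0 ltr0n divr_gt0.
pose v n := Num.min (u n) m.
have v0 n : 0 < v n by rewrite lt_min u0 m0.
have v1 n : v n <= 2^-1 by rewrite !ge_min lexx orbT.
have v2 n : v n <= eps / 4 by rewrite !ge_min lexx !orbT.
have ul (c : R) : 0 < c -> \forall n \near \oo, u n < c by move=> c0; apply: (cvgr_lt _ ucv).
pose k (p : R * R) := levy_dens alpha p.1 * levy_dens alpha p.2.
have k0 p : 0 <= k p by apply: mulr_ge0.
pose Q : set (measurableTypeR R * measurableTypeR R) := `[2^-1, +oo[%classic `*` `[eps / 2, +oo[%classic.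
have mQ : measurable Q by apply: measurableX; exact: measurable_itv.
have e20 : 0 < eps / 2 by rewrite divr_gt0.
have lim : (\int[@lebesgue_measure R \x @lebesgue_measure R]_p (\1_(wedge_coord (EmB_open eps (v n))) p * k p)%:E)%E @[n --> \oo] -->
   (\int[@lebesgue_measure R \x @lebesgue_measure R]_p (\1_(wedge_coord (EmB_closed eps)) p * k p)%:E)%E.
  apply: (@real_dominated_cvg _ _ R _ _ _ (fun p : measurableTypeR R * measurableTypeR R => \1_Q p * k p)).
  - by move=> n; apply: measurable_levy2_integrand; apply: measurable_wedge_coord; exact: measurable_EmB_open.
  - move=> p; apply: cvgM; last exact: cvg_cst.
    apply: cvg_near_cst.
    have [pW|pW] := pselect (wedge_coord (EmB_closed eps) p).
      apply: nearW => n; rewrite !indicE !mem_set//; case: pW => /= [w1 w2 w3]; have := v0 n.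
      by split => /=; [lra|lra|case: w3 => ?; [left|right]; lra].
    have vu n : v n <= u n by rewrite ge_min lexx.
    suff : \forall n \near \oo, ~ wedge_coord (EmB_open eps (v n)) p.
      by apply: filterS => n h; rewrite !indicE !memNset.
    have [w1|w1] := ltP p.1 1.
      have := ul (1 - p.1); rewrite subr_gt0 => /(_ w1); apply: filterS => n h [/= z _ _].
      by have := vu n; lra.
    have [w2|w2] := ltP 1 (p.1 - p.2).
      have := ul (p.1 - p.2 - 1); rewrite subr_gt0 => /(_ w2); apply: filterS => n h [/= _ z _].
      by have := vu n; lra.
    have [w3|w3] := leP (1 + eps) p.1; first by exfalso; apply: pW; split => //; left.
    have [w4|w4] := leP (p.1 - p.2) (1 - eps); first by exfalso; apply: pW; split => //; right.
    have := ul (1 + eps - p.1); rewrite subr_gt0 => /(_ w3) H1.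
    have := ul (p.1 - p.2 - (1 - eps)); rewrite subr_gt0 => /(_ w4) H2.
    apply: filterS2 H1 H2 => n H1 H2 [/= _ _]; have := vu n => ? [?|?]; lra.
  - apply: integrable_ge0.
    + exact: measurable_levy2_integrand.
    + by move=> p; apply: mulr_ge0.
    + exact: levy2_quadrant_fin.
  - move=> n p; rewrite ger0_norm; last exact: (mulr_ge0 (ler0n _ _) (k0 p)).
    suff ab : \1_(wedge_coord (EmB_open eps (v n))) p <= \1_Q p :> R by exact: (ler_wpM2r (k0 p) ab).
    rewrite !indicE ler_nat; have [|//] := boolP (p \in wedge_coord (EmB_open eps (v n))).
    rewrite inE => /(EmB_open_region (v1 n) (v2 n) e0)[/= q1 q2].
    rewrite mem_set//; split => /=; rewrite in_itv/= andbT; lra.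
apply: cvg_trans lim; apply: near_eq_cvg; near=> n.
rewrite /wedge_levy; have -> // : u n = v n.
by apply/esym/min_idPl; apply: ltW; near: n; exact: ul.
Unshelve. all: by end_near. Qed.

(** Monotone convergence along eps = 1/(n+1), which remains valid when the mass of the wedge is
    infinite; monotonicity in [eps] upgrades the sequence to the full one-sided limit. *)
Lemma cvg_wedge_levy_EmB_inner : wedge_levy alpha (EmB_open eps 0) @[eps --> 0^'+] --> wedge_levy alpha (E R).
Proof.
have ni : {in Interval (BRight (0 : R)) +oo%O &, nonincreasing_fun (fun eps => wedge_levy alpha (EmB_open eps 0))}.
  move=> x y; rewrite !in_itv/= !andbT => x0 y0; rewrite le_eqVlt => /orP[/eqP -> //|xy].
  by apply: ltW; exact: wedge_levy_EmB_strict.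
have H := @nonincreasing_at_right_cvge R (fun eps => wedge_levy alpha (EmB_open eps 0)) 0 +oo%O isT ni.
suff -> : wedge_levy alpha (E R) = ereal_sup ((fun eps => wedge_levy alpha (EmB_open eps 0)) @` [set` Interval (BRight (0 : R)) +oo%O]) by [].
have Umono : nondecreasing_seq (fun n : nat => wedge_coord (EmB_open (n.+1%:R^-1 : R) 0)).
  move=> n m nm; apply/subsetPset => p [/= h1 h2 h3]; split => //=.
  have : (m.+1%:R^-1 : R) <= n.+1%:R^-1 by rewrite lef_pV2 ?posrE// ler_nat.
  move: (m.+1%:R^-1) (n.+1%:R^-1) h3 => a b h3 ab.
  by case: h3 => ?; [left|right]; lra.
have mU n : measurable (wedge_coord (EmB_open (n.+1%:R^-1 : R) 0)) by apply: measurable_wedge_coord; exact: measurable_EmB_open.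
pose k (p : measurableTypeR R * measurableTypeR R) : \bar R := (levy_dens alpha p.1 * levy_dens alpha p.2)%:E.
have mk : measurable_fun setT k by apply/measurable_EFinP; exact: measurable_levy_dens2.
have k0 p : (0 <= k p)%E by rewrite lee_fin; apply: mulr_ge0.
have JE (D : set (R * R)) : wedge_levy alpha D = (\int[@lebesgue_measure R \x @lebesgue_measure R]_(p in wedge_coord D) k p)%E.
  rewrite [RHS]integral_mkcond; apply: eq_integral => p _; rewrite /patch indicE /k.
  by case: (p \in _); rewrite ?mul1r ?mul0r.
have lim := @ge0_nondecreasing_set_cvg_integral _ _ R _ k (@lebesgue_measure R \x @lebesgue_measure R)%E Umono mU
   (fun i => @measurable_funTS _ _ _ _ _ _ mk) (fun i x _ => k0 x).
have cup : \bigcup_n wedge_coord (EmB_open (n.+1%:R^-1 : R) 0) = wedge_coord (E R).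
  apply/seteqP; split => p.
    by move=> [n _ [/= h1 h2 _]]; split => /=; lra.
  move=> [/= h1 h2].
  (* The first coordinate alone suffices: a point of the wedge satisfies [1 + n.+1%:R^-1 < p.1] for
     this [n]. *)
  exists (Num.truncn (p.1 - 1)^-1) => //; split => /=; [lra|lra|left].
  have q0 : 0 < p.1 - 1 by rewrite subr_gt0.
  have : ((Num.truncn (p.1 - 1)^-1).+1%:R)^-1 < p.1 - 1.
    by rewrite invf_plt ?posrE// truncnS_gt.
  by move: (_.+1%:R^-1) => y; lra.
rewrite cup -JE in lim.
apply/eqP; rewrite eq_le; apply/andP; split.
  rewrite -(cvg_lim _ lim)//; apply: lime_le.
    by apply/cvg_ex; exists (wedge_levy alpha (E R)).
  apply: nearW => n; apply: ereal_sup_ubound; exists (n.+1%:R^-1); first by rewrite /= in_itv/= andbT invr_gt0.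
  exact: JE.
apply: ge_ereal_sup => y [e /=]; rewrite in_itv/= andbT => e0 <-.
apply: wedge_levy_le => //; [exact: measurable_EmB_open|exact: measurable_E|].
by move=> x [/= ? ? _]; split; lra.
Qed.
End J_limits.

(** * The functionals [gplus] and [gminus] and their limits *)

Section L_limits.
Context (R : realType) (Lambda : {finite_measure set (R * R)%type -> \bar R}) (alpha C : R).
Hypothesis alpha0 : 0 < alpha.
Hypothesis C0 : 0 < C.
Hypothesis HL : forall f, measurable_fun setT f -> (forall x, 0 <= f x)%E ->
  (\int[Lambda]_x f x = \sum_(i <- atom_dirs R) (atom_weight alpha i.1)%:E * f (i.1 *: i.2))%E.

Let c4 : 0 < C ^+ 2 / 4. Proof. by rewrite divr_gt0// exprn_gt0. Qed.

Lemma L_E : L C Lambda (E R) 2 alpha = ((C ^+ 2 / 4)%:E * wedge_levy alpha (E R))%E.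
Proof.
apply: L2_wedge => //; first exact: measurable_E.
by move=> x [? ?]; split; [|left]; lra.
Qed.

Lemma L_closure_E : L C Lambda (closure (E R)) 2 alpha = L C Lambda (E R) 2 alpha.
Proof.
rewrite L_E -(wedge_levy_closure_E alpha0); apply: L2_wedge => //.
  by apply: closed_prod_measurable; exact: closed_closure.
move=> x /closure_E_sub[x1 x2]; split; first lra.
have [h|h] := ltP x.2 x.1; [by left|right].
by apply: pair_ext => /=; apply/eqP; rewrite eq_le; apply/andP; split => //; lra.
Qed.

Lemma L_enlarge_E (delta : R) : 0 < delta -> L C Lambda (enlarge (E R) delta) 2 alpha = +oo%E.
Proof.
move=> d0; have := L2_ge C alpha0 HL (measurable_enlarge (E R) d0).
rewrite -[levy2 _ _]/(wedge_levy _ _) wedge_levy_enlarge_E// gt0_muley ?lte_fin ?divr_gt0 ?exprn_gt0//.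
by rewrite leye_eq => /eqP.
Qed.

Lemma gminusE (eps : R) : 0 < eps -> gminus C Lambda alpha eps = ((C ^+ 2 / 4)%:E * wedge_levy alpha (EmB_open eps 0))%E.
Proof.
move=> e0; rewrite /gminus.
have mV : measurable (E R `\` B eps)° by apply: open_prod_measurable; exact: open_interior.
rewrite L2_wedge//.
- congr (_ * _)%E; apply: wedge_levy_between => //; first exact: EmB_open_sub.
  by move=> x /(@interior_subset _ _)/EmB_sub_closed.
- move=> x /(@interior_subset _ _)/EmB_sub_closed/(EmB_closed_region e0)[? ?]; split; [|left]; lra.
Qed.

(** For small [delta] the enlargement lies between [EmB_open eps 0] and [EmB_open eps delta], and
    still within the region where [L2_wedge] applies. *)
Lemma cvg_L_enlarge_EmB (eps : R) : 0 < eps ->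
  L C Lambda (enlarge (E R `\` B eps) delta) 2 alpha @[delta --> 0^'+] --> gminus C Lambda alpha eps.
Proof.
move=> e0; rewrite gminusE//.
apply: (@squeeze_cvge _ _ _ _ (fun=> (C ^+ 2 / 4)%:E * wedge_levy alpha (EmB_open eps 0))%E _
    (fun delta => (C ^+ 2 / 4)%:E * wedge_levy alpha (EmB_open eps delta))%E); last 2 first.
- exact: cvg_cst.
- by apply: cvgeZl => //; exact: cvg_wedge_levy_EmB_outer.
near=> delta.
have d0 : 0 < delta by near: delta; exact: nbhs_right_gt.
have d1 : delta <= 2^-1.
  by apply: ltW; near: delta; apply: nbhs_right_lt; rewrite invr_gt0.
have d2 : delta <= eps / 4.
  by apply: ltW; near: delta; apply: nbhs_right_lt; rewrite divr_gt0.
have mF := measurable_enlarge (E R `\` B eps) d0.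
rewrite L2_wedge//; last first.
  by move=> x /enlarge_EmB_sub/(EmB_open_region d1 d2 e0)[? ?]; split; [|left]; lra.
rewrite !lee_pmul2l ?lte_fin//; apply/andP; split; apply: wedge_levy_le => //.
- exact: measurable_EmB_open.
- by move=> x /(EmB_open_sub e0)/(@interior_subset _ _)/(sub_enlarge d0).
- exact: measurable_EmB_open.
- exact: enlarge_EmB_sub.
Unshelve. all: by end_near. Qed.

Lemma gminus_fin (eps : R) : 0 < eps -> (0 < gminus C Lambda alpha eps < +oo)%E.
Proof.
move=> e0; rewrite gminusE//.
have Jf : (wedge_levy alpha (EmB_open eps 0) < +oo)%E by apply: wedge_levy_EmB_fin; rewrite ?invr_ge0// divr_ge0// ltW.
rewrite mule_gt0 ?lte_fin ?wedge_levy_EmB_gt0//= lte_mul_pinfty// lee_fin ltW//.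
Qed.

Lemma gminus_decreasing (eps eps' : R) : 0 < eps -> eps < eps' ->
  (gminus C Lambda alpha eps' < gminus C Lambda alpha eps)%E.
Proof.
move=> e0 ee'; rewrite !gminusE ?(lt_trans e0 ee')//.
by rewrite lte_pmul2l ?lte_fin//; exact: wedge_levy_EmB_strict.
Qed.

(** Stated with the mass of the wedge as an extended real, so that the finite and infinite cases are
    treated together. *)
Lemma cvg_gminus : gminus C Lambda alpha eps @[eps --> 0^'+] --> ((C ^+ 2 / 4)%:E * wedge_levy alpha (E R))%E.
Proof.
have H : ((C ^+ 2 / 4)%:E * wedge_levy alpha (EmB_open eps 0))%E @[eps --> 0^'+] --> ((C ^+ 2 / 4)%:E * wedge_levy alpha (E R))%E.
  by apply: cvgeZl => //; exact: cvg_wedge_levy_EmB_inner.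
apply: cvg_trans H; apply: near_eq_cvg; near=> eps.
rewrite gminusE//; near: eps; exact: nbhs_right_gt.
Unshelve. all: by end_near. Qed.

(** Closed form of [gplus]: the diagonal ray meets the set exactly between 1 - eps and 1 + eps, and
    the other three rays miss it. *)
Definition gdiag (eps : R) : R := C / 2 * ((1 - eps) `^ (- alpha) - (1 + eps) `^ (- alpha)).

(** A quarter-plane with the same diagonal segment as the wedge united with the square of radius
    [e]. With [e = eps + delta] it contains the [delta]-enlargement of the union for radius
    [eps]. *)
Let G (e : R) : set (R * R) := [set x : R * R | 1 - e < x.1] `&` [set x : R * R | x.2 < 1 + e].

Let L_G (e : R) : 0 < e < 1 -> L C Lambda (G e) 1 alpha = (gdiag e)%:E.
Proof.
move=> /andP[e0 e1]; apply: L1_diag => //; [|lra|lra| | |].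
- by apply: open_prod_measurable; apply: openI; [exact: open_fst_gt|exact: open_snd_lt].
- by move=> s s0 [/= ? ?]; lra.
- by move=> s [/= ? ?]; lra.
- by move=> s s0; split => [[/= ? ?]|/andP[? ?]]; [apply/andP|]; split => /=; lra.
Qed.

Lemma gplusE (eps : R) : 0 < eps < 1 -> gplus C Lambda alpha eps = (gdiag eps)%:E.
Proof.
move=> /andP[e0 e1]; rewrite /gplus interior_E; apply: L1_diag => //; [|lra|lra| | |].
- by apply: measurableU; [exact: measurable_E|exact: measurable_B].
- by move=> s s0 [[/= ? ?]|/BP[/= + _]]; [lra|rewrite ltr_distl => /andP[? ?]; lra].
- by move=> s [[/= ? ?]|/BP[/= + _]]; [lra|rewrite ltr_distl => /andP[? ?]; lra].
- move=> s s0; split; last by move=> /andP[? ?]; right; apply/BP; rewrite /= ltr_distl; split; apply/andP; split; lra.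
  by move=> [[/= ? ?]|/BP[/= + _]]; [lra|rewrite ltr_distl => /andP[? ?]; apply/andP; split; lra].
Qed.

Lemma gdiag_strict (e e' : R) : 0 <= e -> e < e' -> e' < 1 -> gdiag e < gdiag e'.
Proof.
move=> e0 ee' e'1; rewrite /gdiag ltr_pM2l ?divr_gt0//.
have pw (x y : R) : 0 < x -> x < y -> y `^ (- alpha) < x `^ (- alpha).
  move=> x0 xy; have y0 := lt_trans x0 xy.
  rewrite !powRN ltf_pV2 ?posrE ?powR_gt0//.
  by apply: gt0_ltr_powR => //; rewrite ?nnegrE ltW.
have h1 : (1 - e) `^ (- alpha) < (1 - e') `^ (- alpha) by apply: pw; lra.
have h2 : (1 + e') `^ (- alpha) < (1 + e) `^ (- alpha) by apply: pw; lra.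
lra.
Qed.

Lemma gdiag0 : gdiag 0 = 0.
Proof. by rewrite /gdiag subr0 addr0 subrr mulr0. Qed.

Lemma cvg_gdiag (e : R) : 0 <= e -> e < 1 -> {for e, continuous gdiag}.
Proof.
move=> e0 e1; rewrite /gdiag; apply: cvgM; first exact: cvg_cst.
have s1 : 0 < 1 - e by lra.
have s2 : 0 < 1 + e by lra.
apply: cvgB.
  have h : 1 - t @[t --> e] --> 1 - e by apply: cvgB; [exact: cvg_cst|exact: cvg_id].
  exact: (cvg_comp _ _ h (@powR_continuous R (- alpha) _ s1)).
have h : 1 + t @[t --> e] --> 1 + e by apply: cvgD; [exact: cvg_cst|exact: cvg_id].
exact: (cvg_comp _ _ h (@powR_continuous R (- alpha) _ s2)).
Qed.

(** Squeezed between [gplus] at [eps] and the value on the quarter-plane [G (eps + delta)], which is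
    continuous in [delta]. *)
Lemma cvg_L_enlarge_EcupB (eps : R) : 0 < eps < 1 ->
  L C Lambda (enlarge (E R `|` B eps) delta) 1 alpha @[delta --> 0^'+] --> gplus C Lambda alpha eps.
Proof.
move=> e01; have /andP[e0 e1] := e01; rewrite gplusE//.
apply: (@squeeze_cvge _ _ _ _ (fun=> (gdiag eps)%:E) _ (fun delta => (gdiag (eps + delta))%:E)); last 2 first.
- exact: cvg_cst.
- apply/fine_cvgP; split; first by apply: nearW.
  have h : eps + t @[t --> 0^'+] --> eps.
    by rewrite -[X in _ --> X]addr0; apply: cvgD; [exact: cvg_cst|apply: cvg_at_right_filter; exact: cvg_id].
  exact: (cvg_comp _ _ h (cvg_gdiag (ltW e0) e1)).
near=> delta.
have d0 : 0 < delta by near: delta; exact: nbhs_right_gt.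
have d1 : delta < 1 - eps by near: delta; apply: nbhs_right_lt; rewrite subr_gt0.
have mF := measurable_enlarge (E R `|` B eps) d0.
have ed : 0 < eps + delta < 1 by apply/andP; split; lra.
rewrite -(L_G ed) -(gplusE e01) /gplus interior_E; apply/andP; split; apply: L1_le => //; try exact: ltW.
- by apply: measurableU; [exact: measurable_E|exact: measurable_B].
- exact: sub_enlarge.
- by apply: open_prod_measurable; apply: openI; [exact: open_fst_gt|exact: open_snd_lt].
- move=> x /enlarge_near[y yF]; rewrite !ltr_distl => -[/andP[? ?] /andP[? ?]].
  case: yF => [[? ?]|/BP[]]; first by split => /=; lra.
  by rewrite !ltr_distl => /andP[? ?] /andP[? ?]; split => /=; lra.
Unshelve. all: by end_near. Qed.

Lemma gplus_gt0_fin (eps : R) : 0 < eps < 1 -> (0 < gplus C Lambda alpha eps < +oo)%E.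
Proof.
move=> e01; have /andP[e0 e1] := e01; rewrite gplusE// ltry andbT lte_fin -gdiag0.
exact: gdiag_strict.
Qed.

Lemma gplus_increasing (eps eps' : R) : 0 < eps -> eps < eps' -> eps' < 1 ->
  (gplus C Lambda alpha eps < gplus C Lambda alpha eps')%E.
Proof.
move=> e0 ee' e1; rewrite !gplusE ?lte_fin; first by apply: gdiag_strict => //; exact: ltW.
- by rewrite (lt_trans e0 ee') e1.
- by rewrite e0 (lt_trans ee' e1).
Qed.

Lemma cvg_gplus : gplus C Lambda alpha eps @[eps --> 0^'+] --> 0%E.
Proof.
have H : (gdiag e)%:E @[e --> 0^'+] --> 0%E.
  apply/fine_cvgP; split; first by apply: nearW.
  have h : gdiag e @[e --> 0^'+] --> gdiag 0 by apply: cvg_at_right_filter; exact: cvg_gdiag.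
  by rewrite gdiag0 in h.
apply: cvg_trans H; apply: near_eq_cvg; near=> eps.
rewrite gplusE//; apply/andP; split; near: eps; [exact: nbhs_right_gt|exact: nbhs_right_lt].
Unshelve. all: by end_near. Qed.
End L_limits.

(** * Probabilities of dilated sets *)

Section probabilities.
Context (R : realType) d (T : measurableType d) (P : probability T R) (alpha : R).
Context (S1 S2 : {RV P >-> R}) (C : R) (X : T -> R * R).
Hypothesis alpha0 : 0 < alpha.
Hypothesis alpha2 : alpha < 2.
Hypothesis hS1 : has_law_stable P alpha S1.
Hypothesis hS2 : has_law_stable P alpha S2.
Hypothesis hind : independent P S1 S2.
Hypothesis hC : tail_constant P alpha S1 C.
Hypothesis hX : X = fun w => S1 w *: ((1, 1) : R * R) - S2 w *: ((0, 1) : R * R).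

Let C0 : 0 < C. Proof. by have [] := hC. Qed.

Lemma dilate_event (h : R) (F : set (R * R)) : 0 < h ->
  X @^-1` dilate h F = [set w | wedge_coord F (h^-1 * S1 w, h^-1 * S2 w)].
Proof.
move=> h0; have hn : h != 0 by rewrite gt_eqF.
have XE w : X w = (S1 w, S1 w - S2 w).
  by rewrite hX; apply: pair_ext; rewrite /= /GRing.scale/=; ring.
apply/seteqP; split => w; rewrite /wedge_coord/= XE.
  move=> [x Fx e]; have e1 : h * x.1 = S1 w by have := congr1 fst e.
  have e2 : h * x.2 = S1 w - S2 w by have := congr1 snd e.
  rewrite -mulrBr -e2 -e1 !mulrA mulVf// !mul1r; by case: x Fx {e e1 e2}.
move=> Fx; exists (h^-1 * S1 w, h^-1 * S1 w - h^-1 * S2 w) => //.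
by apply: pair_ext; rewrite /= /GRing.scale/= -?mulrBr mulrA divff// mul1r.
Qed.

Lemma dilate_event_E (h : R) : 0 < h ->
  X @^-1` dilate h (E R) = [set w | h < S1 w /\ S1 w - S2 w < h].
Proof.
move=> h0; rewrite dilate_event//; apply/seteqP; split => w; rewrite /wedge_coord /E /= -mulrBr.
  by rewrite ltr_pdivlMl// mulr1 ltr_pdivrMl// mulr1.
by rewrite ltr_pdivlMl// mulr1 ltr_pdivrMl// mulr1.
Qed.

Lemma measurable_event (D : set (measurableTypeR R * measurableTypeR R)) (h : R) : measurable D ->
  measurable [set w | D (h^-1 * S1 w, h^-1 * S2 w)].
Proof.
move=> mD.
have m : measurable_fun setT (fun w => (h^-1 * S1 w, h^-1 * S2 w) : measurableTypeR R * measurableTypeR R).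
  by apply: measurable_fun_pair; apply: (@measurable_funM _ T R) => //.
by rewrite -[X in measurable X]setTI; exact: m.
Qed.

Lemma cvg_prob_coord (F : set (R * R)) : measurable F ->
  (forall p : R * R, wedge_coord F p -> 0 < p.1 /\ 0 < p.2) -> (wedge_levy alpha F < +oo)%E ->
  ((h `^ (2 * alpha))%:E * P (X @^-1` dilate h F))%E @[h --> +oo] --> ((C ^+ 2 / 4)%:E * wedge_levy alpha F)%E.
Proof.
move=> mF F0 Ffin.
have H := joint_asymptotics alpha0 alpha2 hS1 hS2 hind hC (measurable_wedge_coord mF) F0 Ffin.
apply: cvg_trans H; apply: near_eq_cvg; near=> h.
by rewrite dilate_event//; near: h; apply: nbhs_pinfty_gt; exact: num_real.
Unshelve. all: by end_near. Qed.

Lemma tail_eq : tail S2 = tail S1 :> (R -> R).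
Proof. by apply/funext => x; apply: EFin_inj; rewrite (tailE alpha0 hS1) (tailE alpha0 hS2). Qed.

Lemma prob_itv (Y : {RV P >-> R}) (hY : has_law_stable P alpha Y) (a b : R) : a <= b ->
  P (Y @^-1` `]a, b[) = (tail Y a - tail Y b)%:E.
Proof.
move=> ab; rewrite (stable_law_open_itv alpha0 hY) (tailB alpha0 hY)// integral_itv_obnd_cbnd//.
by apply: measurable_funTS; apply/measurable_EFinP; exact: (measurable_stable_dens alpha0 hY).
Qed.

Lemma tailN (Y : {RV P >-> R}) (hY : has_law_stable P alpha Y) (x : R) : tail Y (- x) = 1 - tail Y x.
Proof.
have mf := measurable_stable_dens alpha0 hY.
have f0 := stable_dens_ge0 alpha0 hY.
have E1 : (\int[@lebesgue_measure R]_(t in `]-oo, (- x)%R[) (stable_dens alpha t)%:E = (tail Y x)%:E)%E.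
  rewrite (tailE alpha0 hY) -integral_itv_obnd_cbnd; last exact/measurable_funTS/measurable_EFinP.
  rewrite -(@integral_indicM R `]-oo, - x[%classic (stable_dens alpha)) -(@integral_indicM R `]x, +oo[%classic (stable_dens alpha)).
  rewrite -(@ge0_integral_opp R (fun t => (\1_(`]-oo, (- x)%R[%classic : set R) t * stable_dens alpha t)%:E)).
  - apply: eq_integral => t _; rewrite stable_densN; congr (_ * _)%:E.
    by rewrite !indicE; congr ((_ : bool)%:R); apply/idP/idP; rewrite !inE/= !in_itv/= andbT ltrN2.
  - apply/measurable_EFinP; apply: (@measurable_funM _ (measurableTypeR R)) => //; exact: measurable_indic.
  - by move=> t; rewrite lee_fin; apply: mulr_ge0.
have : P setT = 1%E by exact: probability_setT.
have -> : [set: T] = (Y @^-1` `]-oo, - x[) `|` (Y @^-1` `[- x, +oo[).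
  by apply/seteqP; split => w //= _; rewrite !in_itv/= andbT; have [|] := ltP (Y w) (- x); [left|right].
have mY (A : set R) : measurable A -> measurable (Y @^-1` A).
  by move=> mA; rewrite -[X in measurable X]setTI; exact: measurable_funPT.
rewrite measureU; [|exact: mY|exact: mY|]; last first.
  by apply/seteqP; split => w //= []; rewrite !in_itv/= andbT => h; rewrite leNgt h.
have q1 : P (Y @^-1` `]-oo, - x[) = (tail Y x)%:E by rewrite -E1; apply: (stable_law alpha0 hY).
have q2 : P (Y @^-1` `[- x, +oo[) = (tail Y (- x))%:E by rewrite (tailE alpha0 hY); apply: (stable_law alpha0 hY).
move=> H; have : (tail Y x + tail Y (- x))%:E = 1%E by rewrite EFinD -q1 -q2; exact: H.
by move=> -[<-]; rewrite addrAC subrr add0r.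
Qed.

Lemma cvg_tail0 (c : R) : 0 < c -> tail S1 (c * h) @[h --> +oo] --> (0 : R).
Proof.
move=> c0; have [M M0 HM] := tail_le alpha0 hS1 hC.
have U : M * c `^ (- alpha) * h `^ (- alpha) @[h --> +oo] --> (0 : R).
  rewrite -[X in _ --> X](mulr0 (M * c `^ (- alpha))).
  by apply: cvgM; [exact: cvg_cst|exact: powRN_cvg_pinfty].
apply: (squeeze_cvgr (f := cst 0) (h := fun h => M * c `^ (- alpha) * h `^ (- alpha))); last 2 first.
- exact: cvg_cst.
- exact: U.
near=> h; rewrite (@tail_ge0 R d T P S1)/=.
have h0 : 0 < h by near: h; apply: nbhs_pinfty_gt; exact: num_real.
by apply: le_trans (HM _ (mulr_gt0 c0 h0)) _; rewrite powRM ?(ltW c0) ?(ltW h0)// mulrA.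
Unshelve. all: by end_near. Qed.

(* Above: [hE], negligible at this scale, together with [S1] in an interval
   around [h].  Below: [S1] in a smaller interval and [S2] of smaller order. *)
Lemma cvg_prob_EcupB (eps : R) : alpha < 1 -> 0 < eps < 1 ->
  ((h `^ alpha)%:E * P (X @^-1` dilate h (E R `|` B eps)))%E @[h --> +oo] --> (gdiag alpha C eps)%:E.
Proof.
move=> a1 /andP[e0 e1].
pose A h := [set w | wedge_coord (E R `|` B eps) (h^-1 * S1 w, h^-1 * S2 w)].
have mA h : measurable (A h).
  by apply: measurable_event; apply: measurable_wedge_coord; apply: measurableU; [exact: measurable_E|exact: measurable_B].
suff : ((h `^ alpha)%:E * P (A h))%E @[h --> +oo] --> (gdiag alpha C eps)%:E.
  apply: cvg_trans; apply: near_eq_cvg; near=> h.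
  by rewrite dilate_event//; near: h; apply: nbhs_pinfty_gt; exact: num_real.
have fA h : P (A h) \is a fin_num by apply: fin_num_measure.
apply/fine_cvgP; split; first by apply: nearW => h; rewrite fin_numM.
pose a h := h `^ alpha * fine (P (A h)).
suff : a h @[h --> +oo] --> gdiag alpha C eps.
  by apply: cvg_trans; apply: near_eq_cvg; apply: nearW => h /=; rewrite fineM.
pose Eh h := [set w | wedge_coord (E R) (h^-1 * S1 w, h^-1 * S2 w)].
have mEh h : measurable (Eh h) by apply: measurable_event; apply: measurable_wedge_coord; exact: measurable_E.
have mS (Y : {RV P >-> R}) (D : set R) : measurable D -> measurable (Y @^-1` D).
  by move=> mD; rewrite -[X in measurable X]setTI; exact: measurable_funPT.
(* The wedge has probability of order h^(-2 alpha) because alpha < 1, so at the scale h^alpha it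
   carries an extra factor h^(-alpha) and vanishes. *)
pose U h := h `^ (- alpha) * fine ((h `^ (2 * alpha))%:E * P (Eh h)) +
   (h `^ alpha * tail S1 ((1 - eps) * h) - h `^ alpha * tail S1 ((1 + eps) * h)).
have cT l : 0 < l -> h `^ alpha * tail S1 (l * h) @[h --> +oo] --> l `^ (- alpha) * (C / 2).
  by move=> l0; exact: (cvg_tail_scale hC).
have gE e : gdiag alpha C e = (1 - e) `^ (- alpha) * (C / 2) - (1 + e) `^ (- alpha) * (C / 2).
  by rewrite /gdiag; ring.
have cU : U h @[h --> +oo] --> gdiag alpha C eps.
  have Jfin : (wedge_levy alpha (E R) < +oo)%E by exact: levy2_wedge_fin.
  have hE := joint_asymptotics alpha0 alpha2 hS1 hS2 hind hC (measurable_wedge_coord (@measurable_E R)) _ Jfin.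
  have {}hE : fine ((h `^ (2 * alpha))%:E * P (Eh h)) @[h --> +oo] --> fine ((C ^+ 2 / 4)%:E * wedge_levy alpha (E R))%E.
    apply: fine_cvg; rewrite fineK; first by apply: hE => p [/= ? ?]; split; lra.
    by rewrite fin_numM// ge0_fin_numE ?wedge_levy_ge0.
  have e00 : 0 * fine ((C ^+ 2 / 4)%:E * wedge_levy alpha (E R))%E + gdiag alpha C eps = gdiag alpha C eps by rewrite mul0r add0r.
  rewrite -[X in _ --> X]e00; apply: cvgD.
    by apply: cvgM => //; exact: powRN_cvg_pinfty.
  by rewrite gE; apply: cvgB; apply: cT; lra.
have pos : \forall h \near +oo, (0 : R) < h by apply: nbhs_pinfty_gt; exact: num_real.
have aU : \forall h \near +oo, a h <= U h.
  apply: filterS pos => h h0.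
  have s : (P (A h) <= P (Eh h) + P (S1 @^-1` `]((1 - eps) * h)%R, ((1 + eps) * h)%R[))%E.
    apply: le_trans (measureU2 _ _ _) => //; last by apply: mS; exact: measurable_itv.
    apply: le_measure; rewrite ?inE//.
      by apply: measurableU => //; apply: mS; exact: measurable_itv.
    move=> w [|/BP[/= h1 _]]; first by left.
    right => /=; rewrite in_itv/=; move: h1; rewrite ltr_distl => /andP[h1 h2].
    apply/andP; split.
      by rewrite mulrC -ltr_pdivlMl//; lra.
    by rewrite mulrC -ltr_pdivrMl//; lra.
  rewrite (prob_itv hS1) in s; last by rewrite ler_pM2r//; lra.
  have fE : P (Eh h) \is a fin_num by apply: fin_num_measure.
  rewrite -(fineK (fA h)) -(fineK fE) -EFinD lee_fin in s.
  rewrite /U fineM// mulrA -powRD ?(gt_eqF h0) ?implybT// (_ : - alpha + 2 * alpha = alpha); last ring.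
  by rewrite -mulrBr -mulrDr; apply: ler_wpM2l => //; exact: powR_ge0.
(* [eta] is the room left for S2: if S1/h is within [eps - eta] of 1 and |S2|/h is below [eta], the
   point is in the square. The last factor is the probability of this event for S2, by symmetry. *)
pose Lo eta h := (h `^ alpha * tail S1 ((1 - (eps - eta)) * h) - h `^ alpha * tail S1 ((1 + (eps - eta)) * h)) * (1 - 2 * tail S1 (eta * h)).
have cL eta : 0 < eta -> eta < eps -> Lo eta h @[h --> +oo] --> gdiag alpha C (eps - eta).
  move=> eta0 etae.
  have e10 : gdiag alpha C (eps - eta) = gdiag alpha C (eps - eta) * (1 - 2 * 0) by rewrite mulr0 subr0 mulr1.
  rewrite [X in _ --> X]e10; apply: cvgM.
    by rewrite gE; apply: cvgB; apply: cT; lra.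
  apply: cvgB; first exact: cvg_cst.
  by apply: cvgM; [exact: cvg_cst|exact: cvg_tail0].
have aL eta : 0 < eta -> eta < eps -> \forall h \near +oo, Lo eta h <= a h.
  move=> eta0 etae; apply: filterS pos => h h0.
  have s : (P (S1 @^-1` `]((1 - (eps - eta)) * h)%R, ((1 + (eps - eta)) * h)%R[) * P (S2 @^-1` `](- (eta * h))%R, (eta * h)%R[) <= P (A h))%E.
    rewrite -hind; [|exact: measurable_itv|exact: measurable_itv].
    apply: le_measure; rewrite ?inE//.
      by apply: measurableI; apply: mS; exact: measurable_itv.
    move=> w [] /=; rewrite !in_itv/= => /andP[a1' a2] /andP[b1 b2]; right.
    have i1 : h^-1 * S1 w < 1 + (eps - eta) by rewrite ltr_pdivrMl// mulrC.
    have i2 : 1 - (eps - eta) < h^-1 * S1 w by rewrite ltr_pdivlMl// mulrC.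
    have i3 : h^-1 * S2 w < eta by rewrite ltr_pdivrMl// mulrC.
    have i4 : - eta < h^-1 * S2 w by rewrite ltr_pdivlMl// mulrN mulrC.
    by apply/BP; rewrite /= !ltr_distl; split; apply/andP; split; lra.
  rewrite (prob_itv hS1) in s; last by rewrite ler_pM2r//; lra.
  rewrite (prob_itv hS2) in s; last by rewrite -subr_ge0 opprK addr_ge0// mulr_ge0// ltW.
  rewrite tail_eq (tailN hS1) -(fineK (fA h)) -EFinM lee_fin in s.
  rewrite /Lo /a -mulrBr -mulrA; apply: ler_wpM2l; first exact: powR_ge0.
  apply: le_trans s; rewrite le_eqVlt; apply/orP; left; apply/eqP; ring.
apply/cvgrPdist_le => delta delta0.
have [eta [eta0 etae Heta]] : exists eta, [/\ 0 < eta, eta < eps & gdiag alpha C eps - delta < gdiag alpha C (eps - eta)].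
  have c1 : gdiag alpha C (eps - t) @[t --> 0^'+] --> gdiag alpha C eps.
    have h : eps - t @[t --> 0^'+] --> eps.
      by rewrite -[X in _ --> X]subr0; apply: cvgB; [exact: cvg_cst|apply: cvg_at_right_filter; exact: cvg_id].
    by apply: (cvg_comp _ _ h); apply: cvg_gdiag => //; exact: ltW.
  suff : \forall eta \near 0^'+, [/\ 0 < eta, eta < eps & gdiag alpha C eps - delta < gdiag alpha C (eps - eta)].
    by move=> H; exact: (@filter_ex _ _ (at_right_proper_filter (0 : R)) _ H).
  near=> eta; split.
  - by near: eta; exact: nbhs_right_gt.
  - by near: eta; exact: nbhs_right_lt.
  - by near: eta; apply: (cvgr_gt _ c1); rewrite ltrBlDr ltrDl.
near=> h; rewrite ler_distlC; apply/andP; split.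
  apply: (@le_trans _ _ (Lo eta h)); last by near: h; exact: aL.
  by apply: ltW; near: h; exact: (cvgr_gt _ (cL eta eta0 etae)).
apply: (@le_trans _ _ (U h)); first by near: h.
by apply: ltW; near: h; apply: (cvgr_lt _ cU); rewrite ltrDl.
Unshelve. all: by end_near. Qed.
End probabilities.

Lemma EmB_quadrant (R : realType) (eps : R) (p : R * R) : 0 < eps ->
  wedge_coord (E R `\` B eps) p -> 0 < p.1 /\ 0 < p.2.
Proof. by move=> e0 /(@EmB_sub_closed R eps)/(EmB_closed_region e0)/= [? ?]; split; lra. Qed.

Lemma wedge_levy_EmB (R : realType) (alpha eps : R) : 0 < alpha -> 0 < eps ->
  wedge_levy alpha (E R `\` B eps) = wedge_levy alpha (EmB_open eps 0).
Proof.
move=> alpha0 e0; apply: wedge_levy_between => //.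
- by apply: measurableD; [exact: measurable_E|exact: measurable_B].
- exact: (subset_trans (EmB_open_sub e0) (@interior_subset _ _)).
- exact: EmB_sub_closed.
Qed.

Lemma wedge_levy_E_infty (R : realType) (alpha : R) : 0 < alpha -> 1 <= alpha -> wedge_levy alpha (E R) = +oo%E.
Proof.
move=> alpha0 a1; rewrite /wedge_levy -[levy2 _ _]/(levy2 alpha [set p | 1 < p.1 /\ p.1 - p.2 < 1]).
by rewrite levy2_wedge// betaE_infty// gt0_muley// lte_fin.
Qed.

Theorem proposition4p5 (R : realType) (alpha : R)
    (halpha0 : 0 < alpha) (halpha2 : alpha < 2)
    (d : measure_display) (T : measurableType d) (P : probability T R)
    (S1 S2 : {RV P >-> R})
    (hS1 : has_law_stable P alpha S1) (hS2 : has_law_stable P alpha S2)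
    (hind : independent P S1 S2)
    (C : R) (hC : tail_constant P alpha S1 C)
    (X : T -> R * R)
    (hX : X = fun w => S1 w *: ((1, 1) : R * R) - S2 w *: ((0, 1) : R * R))
    (Lambda : {finite_measure set (R * R)%type -> \bar R})
    (hLambda : spectral_measure P alpha X Lambda) :
  (let r := (Num.sqrt 2)^-1 in
   [/\ Lambda [set (r, r)] = (2 `^ (alpha / 2) / 2)%:E,
       Lambda [set (- r, - r)] = (2 `^ (alpha / 2) / 2)%:E,
       Lambda [set (0, 1)] = (1 / 2)%:E,
       Lambda [set (0, -1)] = (1 / 2)%:E &
       Lambda (~` [set x | [\/ x = (r, r), x = (- r, - r),
                               x = (0, 1) | x = (0, -1)]]) = 0%E])
  /\
  (* (i) *)
  [/\ alpha < 1 ->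
        ((h `^ (2 * alpha))%:E * P (X @^-1` dilate h (E R)))%E @[h --> +oo]
          --> (limit_constant C alpha)%:E,
      alpha = 1 ->
        ((h ^+ 2 / ln h)%:E * P (X @^-1` dilate h (E R)))%E @[h --> +oo]
          --> (C ^+ 2 / 4)%:E &
      1 < alpha ->
        ((h `^ (1 + alpha))%:E * P (X @^-1` dilate h (E R)))%E @[h --> +oo]
          --> ((C * alpha)%:E * 'E_P[fun w => (`|S1 w|)%R] * (4^-1)%:E)%E]
  /\
  (* (ii) *)
  [/\ L C Lambda (enlarge (E R) delta) 2 alpha @[delta --> 0^'+] --> +oo%E,
      L C Lambda ((E R)°) 2 alpha = L C Lambda (closure (E R)) 2 alpha,
      1 <= alpha -> L C Lambda ((E R)°) 2 alpha = +oo%E &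
      alpha < 1 -> L C Lambda ((E R)°) 2 alpha = (limit_constant C alpha)%:E]
  /\
  (* (iii) *)
  (alpha < 1 ->
    (forall eps : R, 0 < eps < 1 ->
      [/\ L C Lambda (enlarge (E R `|` B eps) delta) 1 alpha
            @[delta --> 0^'+] --> gplus C Lambda alpha eps,
          (0 < gplus C Lambda alpha eps < +oo)%E &
          ((h `^ alpha)%:E * P (X @^-1` dilate h (E R `|` B eps)))%E
            @[h --> +oo] --> gplus C Lambda alpha eps])
    /\
    (forall eps : R, 0 < eps ->
      [/\ L C Lambda (enlarge (E R `\` B eps) delta) 2 alpha
            @[delta --> 0^'+] --> gminus C Lambda alpha eps,
          (0 < gminus C Lambda alpha eps < +oo)%E &
          ((h `^ (2 * alpha))%:E * P (X @^-1` dilate h (E R `\` B eps)))%E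
            @[h --> +oo] --> gminus C Lambda alpha eps]))
  /\
  (* (iv) *)
  [/\ forall eps eps' : R, 0 < eps -> eps < eps' -> eps' < 1 ->
        (gplus C Lambda alpha eps < gplus C Lambda alpha eps')%E,
      gplus C Lambda alpha eps @[eps --> 0^'+] --> 0%E,
      forall eps eps' : R, 0 < eps -> eps < eps' ->
        (gminus C Lambda alpha eps' < gminus C Lambda alpha eps)%E,
      1 <= alpha -> gminus C Lambda alpha eps @[eps --> 0^'+] --> +oo%E &
      alpha < 1 -> gminus C Lambda alpha eps @[eps --> 0^'+]
                     --> (limit_constant C alpha)%:E].
Proof.
have [C0 _] := hC.
have HL := spectral_sum halpha0 halpha2 hS1 hS2 hind hX hLambda.
(* The mass of the wedge, finite or infinite, is the common constant behind the case alpha < 1 of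
   (i) and the limits in (ii) and (iv) for two large jumps. *)
have JE1 : alpha < 1 -> ((C ^+ 2 / 4)%:E * wedge_levy alpha (E R) = (limit_constant C alpha)%:E)%E.
  by move=> a1; exact: levy2_wedge_lt1.
have JEoo : 1 <= alpha -> ((C ^+ 2 / 4)%:E * wedge_levy alpha (E R) = +oo)%E.
  by move=> a1; rewrite wedge_levy_E_infty// gt0_muley// lte_fin divr_gt0// exprn_gt0.
have pos : \forall h \near +oo, (0 : R) < h by apply: nbhs_pinfty_gt; exact: num_real.
split.
  move=> r; split.
  - exact: (spectral_massrr halpha0 halpha2 hS1 hS2 hind hX hLambda).
  - rewrite (spectral_sym hLambda).
    exact: (spectral_massrr halpha0 halpha2 hS1 hS2 hind hX hLambda).
  - exact: (spectral_mass01 halpha0 halpha2 hS1 hS2 hind hX hLambda).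
  - have := spectral_sym hLambda 0 1; rewrite oppr0 => ->.
    exact: (spectral_mass01 halpha0 halpha2 hS1 hS2 hind hX hLambda).
  - exact: (spectral_support halpha0 halpha2 hS1 hS2 hind hX hLambda).
split.
  split=> a1.
  - rewrite -JE1//; apply: (cvg_prob_coord halpha0 halpha2 hS1 hS2 hind hC hX).
    + exact: measurable_E.
    + by move=> p [/= ? ?]; split; lra.
    + exact: levy2_wedge_fin.
  - subst alpha; apply: cvg_trans (wedge_eq1 hS1 hS2 hind hC).
    by apply: near_eq_cvg; apply: filterS pos => h h0; rewrite (dilate_event_E hX).
  - apply: cvg_trans (wedge_gt1 halpha0 halpha2 hS1 hS2 hind hC a1).
    by apply: near_eq_cvg; apply: filterS pos => h h0; rewrite (dilate_event_E hX).
split.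
  rewrite interior_E (L_closure_E C halpha0 HL); split=> //.
  - apply: cvg_near_cst; near=> delta; apply: (L_enlarge_E halpha0 C0 HL).
    by near: delta; exact: nbhs_right_gt.
  - by move=> a1; rewrite (L_E C halpha0 HL) JEoo.
  - by move=> a1; rewrite (L_E C halpha0 HL) JE1.
split.
  move=> a1; split=> eps e0; split.
  - exact: cvg_L_enlarge_EcupB.
  - exact: gplus_gt0_fin.
  - by rewrite gplusE//; exact: (cvg_prob_EcupB halpha0 halpha2 hS1 hS2 hind hC hX).
  - exact: cvg_L_enlarge_EmB.
  - exact: gminus_fin.
  - rewrite gminusE// -wedge_levy_EmB//; apply: (cvg_prob_coord halpha0 halpha2 hS1 hS2 hind hC hX).
    + by apply: measurableD; [exact: measurable_E|exact: measurable_B].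
    + by move=> p; exact: EmB_quadrant.
    + by rewrite wedge_levy_EmB//; apply: wedge_levy_EmB_fin => //; rewrite ?invr_ge0// divr_ge0// ltW.
split.
- move=> eps eps'; exact: gplus_increasing.
- exact: cvg_gplus.
- move=> eps eps'; exact: gminus_decreasing.
- by move=> a1; rewrite -(JEoo a1); exact: cvg_gminus.
- by move=> a1; rewrite -(JE1 a1); exact: cvg_gminus.
Unshelve. all: by end_near. Qed.
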